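(* Let $k$ be an algebraically closed field, let $r\ge 2$ and let $M\in\mathrm{rep}(\Gamma_r)$ be indecomposable. Write $q_{\Gamma_r}(x,y)=x^2+y^2-rxy$. The following statements hold. (a) $q_{\Gamma_r}(d_M,d_M+c_M)\le 1$. (b) If $M$ is not simple and of constant Jordan type $[1]^c[2]^d$, then $(c,d)\in\mathrm{IJT}:=\{(c,d)\in\mathbb{N}^2\mid q_{\Gamma_r}(d,d+c)\le 1,\ c\ge r-1\}$. (c) If $N_1,\dots,N_l\in\mathrm{rep}(\Gamma_r)$ are regular indecomposable and $N:=N_1\oplus\cdots\oplus N_l$ is of constant Jordan type $[1]^c[2]^d$, then $q_{\Gamma_r}(d,d+c)<1$ and $c\ge l(r-1)$.
   Context: $k$ has arbitrary characteristic; $\mathbb{N}=\{1,2,\dots\}$. $\Gamma_r$ is the Kronecker quiver with two vertices $1,2$ and $r$ arrows $\gamma_1,\dots,\gamma_r\colon 1\to 2$; $\mathrm{rep}(\Gamma_r)$ is the category of its finite-dimensional $k$-representations. For $M\in\mathrm{rep}(\Gamma_r)$ and $\alpha\in k^r\setminus\{0\}$ put $M^\alpha:=\sum_{i=1}^r\alpha_iM(\gamma_i)\colon M_1\to M_2$. The generic rank is $d_M:=\max\{\mathrm{rk}(M^\alpha)\mid\alpha\in k^r\setminus\{0\}\}$, and $c_M:=\dim_kM_1+\dim_kM_2-2d_M$. $M$ has constant Jordan type if $\mathrm{rk}(M^\alpha)$ is independent of $\alpha\in k^r\setminus\{0\}$; it has constant Jordan type $[1]^c[2]^d$ if moreover this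 rank equals $d$ and $c=\dim_kM_1+\dim_kM_2-2d$ (i.e. the square-zero operator on $M_1\oplus M_2$ induced by $M^\alpha$ has $c$ Jordan blocks of size $1$ and $d$ of size $2$). An indecomposable representation is preprojective (preinjective) if it lies in the orbit of an indecomposable projective (injective) representation under the Auslander–Reiten translation, and regular if it is neither. *)

(* Defs.v *)
From HB Require Import structures.
From mathcomp Require Import all_boot all_order all_algebra.
From mathcomp Require Import boolp.
From Stdlib Require Import Relation_Operators.

Set Implicit Arguments.
Unset Strict Implicit.
Unset Printing Implicit Defensive.

Import Order.TTheory GRing.Theory Num.Theory.
Local Open Scope ring_scope.

Record krep (k : fieldType) (r : nat) := KRep {
  V1 : vectType k;
  V2 : vectType k;
  arr : 'I_r -> 'Hom(V1, V2) }.

Section Rep.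
Variables (k : fieldType) (r : nat).
Local Notation rep := (krep k r).
Implicit Types (L M N P Q X Y Z : rep).

Definition khom M N : vectType k :=
  ('Hom(V1 M, V1 N) * 'Hom(V2 M, V2 N))%type.

Definition is_hom M N (f : khom M N) : Prop :=
  forall i, (f.2 \o arr M i)%VF = (arr N i \o f.1)%VF.

Definition hid M : khom M M := (\1%VF, \1%VF).

Definition hcomp X Y Z (g : khom Y Z) (f : khom X Y) : khom X Z :=
  ((g.1 \o f.1)%VF, (g.2 \o f.2)%VF).

Definition hmono M N (f : khom M N) : Prop :=
  lker f.1 = 0%VS /\ lker f.2 = 0%VS.

Definition hepi M N (f : khom M N) : Prop :=
  limg f.1 = fullv /\ limg f.2 = fullv.

Definition kiso M N : Prop :=
  exists (f : khom M N) (g : khom N M),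
    [/\ is_hom f, is_hom g, hcomp g f = hid M & hcomp f g = hid N].

Definition dim1 M : nat := \dim {:V1 M}.
Definition dim2 M : nat := \dim {:V2 M}.

Definition kzero : rep := @KRep k r 'rV[k]_0 'rV[k]_0 (fun=> 0).

Definition ksum M N : rep :=
  @KRep k r (V1 M * V1 N)%type (V2 M * V2 N)%type
    (fun i => linfun (fun v : V1 M * V1 N => (arr M i v.1, arr N i v.2))).

Lemma ksumE M N i v : arr (ksum M N) i v = (arr M i v.1, arr N i v.2).
Proof.
suff lin : linear (fun v : V1 M * V1 N => (arr M i v.1, arr N i v.2)).
  pose f := GRing.isLinear.Build _ _ _ _ _ lin.
  pose F : {linear _ -> _} := HB.pack
    (fun v : V1 M * V1 N => (arr M i v.1, arr N i v.2)) f.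
  exact: (lfunE F v).
by move=> a u w; rewrite /= !linearP.
Qed.

Definition ksums (l : nat) (N : 'I_l -> rep) : rep :=
  \big[ksum/kzero]_(i < l) N i.

Definition is_zero M : Prop := dim1 M = 0%N /\ dim2 M = 0%N.

Definition indecomposable M : Prop :=
  ~ is_zero M /\ forall X Y, kiso M (ksum X Y) -> is_zero X \/ is_zero Y.

Definition subspaces M : Type := ({vspace V1 M} * {vspace V2 M})%type.

Definition is_subrep M (U : subspaces M) : Prop :=
  forall i, (arr M i @: U.1 <= U.2)%VS.

Definition simple M : Prop :=
  ~ is_zero M /\
  forall U : subspaces M, is_subrep U -> U = (0%VS, 0%VS) \/ U = (fullv, fullv).

Definition pencil M (a : 'rV[k]_r) : 'Hom(V1 M, V2 M) :=
  \sum_i a 0 i *: arr M i.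

Definition rk M (a : 'rV[k]_r) : nat := \dim (limg (pencil M a)).

(* The maximum of the set of values of [rk M] on nonzero vectors; all of them
   are at most [dim1 M], whence the finite range (see [generic_rankP]). *)
Definition generic_rank M : nat :=
  \max_(d < (dim1 M).+1 | `[< exists2 a, a != 0 & rk M a = d >]) d.

Lemma rk_le_dim1 M a : (rk M a <= dim1 M)%N.
Proof. by rewrite /rk /dim1 -(limg_ker_dim (pencil M a) fullv) leq_addl. Qed.

Lemma generic_rankP M : (0 < r)%N ->
  (exists2 a, a != 0 & rk M a = generic_rank M) /\
  (forall a, a != 0 -> (rk M a <= generic_rank M)%N).
Proof.
move=> r_gt0; have le_rk a : a != 0 -> (rk M a <= generic_rank M)%N.
  move=> a0; have lt_rk : (rk M a < (dim1 M).+1)%N by rewrite ltnS rk_le_dim1.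
  rewrite /generic_rank.
  apply: (@leq_bigmax_cond _ _ (fun d : 'I_(dim1 M).+1 => d : nat)
            (Ordinal lt_rk)).
  by apply/asboolP; exists a.
split=> //; pose a0 : 'rV[k]_r := delta_mx 0 (Ordinal r_gt0).
have a0N0 : a0 != 0.
  apply/eqP => /matrixP/(_ 0 (Ordinal r_gt0)).
  by rewrite !mxE !eqxx => /eqP; rewrite oner_eq0.
have lt_rk : (rk M a0 < (dim1 M).+1)%N by rewrite ltnS rk_le_dim1.
have Pa0 : `[< exists2 a, a != 0 & rk M a = Ordinal lt_rk >].
  by apply/asboolP; exists a0.
rewrite /generic_rank (bigop.bigmax_eq_arg (Ordinal lt_rk)) //.
by case: arg_maxnP => //= d /asboolP.
Qed.

(* The subtraction is never truncated, as generic_rank M <= dim1 M, dim2 M. *)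
Definition cdef M : nat := (dim1 M + dim2 M - 2 * generic_rank M)%N.

Definition constant_Jordan_type M (c d : nat) : Prop :=
  (forall a : 'rV[k]_r, a != 0 -> rk M a = d) /\
  (c + 2 * d = dim1 M + dim2 M)%N.

Definition projective P : Prop :=
  forall X Y (g : khom X Y) (f : khom P Y),
    is_hom g -> hepi g -> is_hom f ->
    exists2 h : khom P X, is_hom h & hcomp g h = f.

Definition injective_rep Q : Prop :=
  forall X Y (g : khom X Y) (f : khom X Q),
    is_hom g -> hmono g -> is_hom f ->
    exists2 h : khom Y Q, is_hom h & hcomp h g = f.

Definition hker M N (f : khom M N) : subspaces M := (lker f.1, lker f.2).
Definition himg M N (f : khom M N) : subspaces N := (limg f.1, limg f.2).

Definition superfluous M (U : subspaces M) : Prop :=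
  forall W : subspaces M, is_subrep W ->
    (U.1 + W.1)%VS = fullv -> (U.2 + W.2)%VS = fullv ->
    W = (fullv, fullv).

(* P1 -p1-> P0 -p0-> M -> 0 is exact, and p0 : P0 -> M and
   p1 : P1 -> Ker p0 are projective covers. *)
Definition minimal_presentation M P0 P1 (p1 : khom P1 P0) (p0 : khom P0 M)
    : Prop :=
  [/\ projective P0 /\ projective P1,
      is_hom p0 /\ is_hom p1,
      hepi p0 /\ himg p1 = hker p0 &
      superfluous (hker p0) /\ superfluous (hker p1)].

(* A representation is a left module over the path algebra A; Pproj1 = A e_1
   and Pproj2 = A e_2 are the projective covers of the two simples. *)
Definition Pproj1 : rep :=
  @KRep k r k^o 'rV[k]_r
    (fun i => linfun (fun c : k^o => c *: delta_mx 0 i : 'rV[k]_r)).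

Definition Pproj2 : rep := @KRep k r 'rV[k]_0 k^o (fun=> 0).

(* Right multiplication by the arrow gamma_i : 1 -> 2, as a morphism
   P(2) = A e_2 -> A e_1 = P(1). *)
Definition proj_arr (i : 'I_r) : khom Pproj2 Pproj1 :=
  (0, linfun (fun c : k^o => c *: delta_mx 0 i : 'rV[k]_r)).

Lemma proj_arr_hom i : is_hom (proj_arr i).
Proof.
by move=> j; apply/lfunP => v; rewrite !comp_lfunE /= [v]thinmx0 !linear0.
Qed.

Definition homsp M N : {vspace khom M N} :=
  (\bigcap_(i < r) lker (linfun (fun f : khom M N =>
     (f.2 \o arr M i)%VF - (arr N i \o f.1)%VF)))%VS.

Lemma homspP M N (f : khom M N) : reflect (is_hom f) (f \in homsp M N).
Proof.
pose D i (f : khom M N) := (f.2 \o arr M i)%VF - (arr N i \o f.1)%VF.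
have DE i g : linfun (D i) g = D i g.
  suff lin : linear (D i).
    pose L : {linear _ -> _} :=
      HB.pack (D i) (GRing.isLinear.Build _ _ _ _ _ lin).
    exact: (lfunE L g).
  move=> a u w; rewrite /= /D comp_lfunDl comp_lfunDr -comp_lfunZl -comp_lfunZr.
  by rewrite scalerBr opprD addrACA.
rewrite /homsp; apply: (iffP idP) => [/subv_bigcapP fK i | fH].
  have := fK i isT; rewrite -memvE memv_ker -/(D i) DE subr_eq0 => /eqP; exact.
rewrite memvE; apply/subv_bigcapP => i _.
by rewrite -memvE memv_ker -/(D i) DE subr_eq0; apply/eqP/fH.
Qed.

Definition Hom M N : vectType k := subvs_of (homsp M N).

(* Hom(X, g) and Hom(f, Z); meaningful for morphisms g and f. *)
Definition Hom_post X Y Z (g : khom Y Z) : 'Hom(Hom X Y, Hom X Z) :=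
  linfun (fun h : Hom X Y => vsproj (homsp X Z) (hcomp g (vsval h))).

Definition Hom_pre X Y Z (f : khom X Y) : 'Hom(Hom Y Z, Hom X Z) :=
  linfun (fun h : Hom Y Z => vsproj (homsp X Z) (hcomp (vsval h) f)).

Lemma Hom_postE X Y Z (g : khom Y Z) (h : Hom X Y) :
  is_hom g -> vsval (Hom_post X g h) = hcomp g (vsval h).
Proof.
move=> gH; have lin : linear (fun h : Hom X Y =>
    vsproj (homsp X Z) (hcomp g (vsval h))).
  move=> a u w; rewrite -linearP; congr (vsproj _ _); congr (_, _);
  by rewrite /= comp_lfunDr comp_lfunZr.
pose L : {linear _ -> _} := HB.pack (fun h : Hom X Y =>
    vsproj (homsp X Z) (hcomp g (vsval h))) (GRing.isLinear.Build _ _ _ _ _ lin).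
rewrite /Hom_post (lfunE L h) /= vsprojK //; apply/homspP => i /=.
have /homspP/(_ i) hH := subvsP h.
by rewrite -comp_lfunA hH comp_lfunA gH comp_lfunA.
Qed.

Lemma Hom_preE X Y Z (f : khom X Y) (h : Hom Y Z) :
  is_hom f -> vsval (Hom_pre Z f h) = hcomp (vsval h) f.
Proof.
move=> fH; have lin : linear (fun h : Hom Y Z =>
    vsproj (homsp X Z) (hcomp (vsval h) f)).
  move=> a u w; rewrite -linearP; congr (vsproj _ _); congr (_, _);
  by rewrite /= comp_lfunDl comp_lfunZl.
pose L : {linear _ -> _} := HB.pack (fun h : Hom Y Z =>
    vsproj (homsp X Z) (hcomp (vsval h) f)) (GRing.isLinear.Build _ _ _ _ _ lin).
rewrite /Hom_pre (lfunE L h) /= vsprojK //; apply/homspP => i /=.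
have /homspP/(_ i) hH := subvsP h.
by rewrite -comp_lfunA fH comp_lfunA hH comp_lfunA.
Qed.

Definition dual (U : vectType k) : vectType k := 'Hom(U, k^o).

Definition dual_map (U W : vectType k) (f : 'Hom(U, W))
    : 'Hom(dual W, dual U) :=
  linfun (fun phi : dual W => (phi \o f)%VF : dual U).

Lemma dual_mapE (U W : vectType k) (f : 'Hom(U, W)) (phi : dual W) :
  dual_map f phi = (phi \o f)%VF.
Proof.
have lin : linear (fun phi : dual W => (phi \o f)%VF : dual U).
  by move=> a u w; rewrite comp_lfunDl comp_lfunZl.
pose L : {linear _ -> _} := HB.pack (fun phi : dual W => (phi \o f)%VF : dual U)
  (GRing.isLinear.Build _ _ _ _ _ lin).
exact: (lfunE L phi).
Qed.

(* nu = D Hom_A(-, A), with A = P(1) + P(2): the component of nu(X) at the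
   vertex i is D Hom_A(X, A e_i). *)
Definition nakayama X : rep :=
  @KRep k r (dual (Hom X Pproj1)) (dual (Hom X Pproj2))
    (fun i => dual_map (Hom_post X (proj_arr i))).

Definition nakayama_map X Y (f : khom X Y) : khom (nakayama X) (nakayama Y) :=
  (dual_map (Hom_pre Pproj1 f), dual_map (Hom_pre Pproj2 f)).

(* N is isomorphic to D Tr M. As Tr M is the cokernel of
   Hom(p1, A) : Hom(P0, A) -> Hom(P1, A) for a minimal projective presentation
   of M, D Tr M is the kernel of nu(p1) : nu(P1) -> nu(P0). *)
Definition is_DTr M N : Prop :=
  exists P0 P1 (p1 : khom P1 P0) (p0 : khom P0 M) (u : khom N (nakayama P1)),
    [/\ minimal_presentation p1 p0, is_hom u, hmono u &
        himg u = hker (nakayama_map p1)].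

(* D Tr kills all projectives, so these must be excluded before passing to
   the generated equivalence relation. *)
Definition AR_step M N : Prop :=
  [/\ indecomposable M, ~ projective M & is_DTr M N].

Definition same_AR_orbit : rep -> rep -> Prop :=
  clos_refl_sym_trans rep AR_step.

Definition preprojective M : Prop :=
  indecomposable M /\
  exists P, [/\ indecomposable P, projective P & same_AR_orbit P M].

Definition preinjective M : Prop :=
  indecomposable M /\
  exists Q, [/\ indecomposable Q, injective_rep Q & same_AR_orbit Q M].

Definition regular M : Prop :=
  [/\ indecomposable M, ~ preprojective M & ~ preinjective M].

End Rep.

Arguments kzero {k r}.
Arguments Pproj1 {k r}.
Arguments Pproj2 {k r}.

Definition qform (r : nat) (x y : int) : int :=
  x ^+ 2 + y ^+ 2 - r%:Z * x * y.

Definition IJT (r : nat) : pred (nat * nat) :=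
  fun p => let: (c, d) := p in
  [&& (0 < c)%N, (0 < d)%N, qform r d%:Z (d + c)%:Z <= 1 & (r - 1 <= c)%N].

(* Main.v *)
(* (a) Let K and I be the kernel and the image of M^x for a generic x. Every
   M^t maps K into I, and the maps K -> I and M_1/K -> M_2/I which it induces
   have ranks of sum at most d. So if c > (r - 2) d, then in a suitable basis
   of k^r either a vector outside of U or a functional is killed by all
   combinations of arrows but one, and the representation of dimensions (1, 0),
   (1, 1) or (0, 1) that it generates can be split off numerically. This leaves
   a subquotient of M with c <= (r - 2) d, a subrepresentation and a quotient.
   The three of them contribute vectors below the line of slope rho to
   (d, d + c), where rho is the larger root of t^2 - r t + 1, unless iterated
   reflections of M reach a simple representation; in that case M is preinjective
   (preprojective), q(dim M) = 1 and all M^a are surjective (injective).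

   (b) A constant rank d gives a square-zero matrix N of linear forms on a graded
   free module H. The alternating forms on H killed by im N, and those vanishing
   on ker N, have Hilbert functions with sum that of all forms: the graded pieces
   of suitable filtrations agree locally at each point, hence in large degrees.
   Extending H by one generator at a time, this becomes an equation
   (1 + t X)^a c(t) = (1 + t)^b k(t), with X the shift of the degree, where c(t)
   has degree at most b - d. It forces (X - 1)^(a + b - 2 d + 1) to kill the
   constant term of c(t), which is the Hilbert function of the polynomial ring
   in r variables, whence a + b - 2 d >= r - 1.

   (c) The summands have constant rank as well, and the half-plane below the line
   of slope rho is closed under addition. *)
From HB Require Import structures.
From mathcomp Require Import all_boot all_order all_algebra all_fingroup.
From mathcomp Require Import boolp mpoly.
From mathcomp Require Import zify ring.
From Stdlib Require Import Relation_Operators.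
Require Import Defs.
Set Implicit Arguments.
Unset Strict Implicit.
Unset Printing Implicit Defensive.
Import Order.TTheory GRing.Theory Num.Theory.
Local Open Scope ring_scope.

(** * Dimensions of subspaces given by predicates *)

Section Subspace.
Variable k : fieldType.

(** Part (b) mirrors a computation in the K-theory of P^(r-1), where X is the class of O(1) and the
    kernel and cokernel of a pencil of constant rank are vector bundles. A class becomes a Hilbert
    function up to finitely many values, and an exterior power of a dual bundle a module of
    alternating forms. Bundle sequences split locally: a minor that does not vanish at a point gives
    a splitting up to that minor. To pass from points to large degrees one needs a point in the
    support of any graded quotient that is nonzero in arbitrarily large degrees, hence the basis
    theorem and common eigenvectors. The elimination takes place at t = -1, where (1 + t)^b has a
    zero of order b while 1 + t X becomes 1 - X, which lowers the degree of polynomial functions. In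
    (a) the obstacle is that (d, d + c) is not a dimension vector. A subrepresentation U contributes
    (dim U_2, dim U_1) to it, and a quotient Q contributes (dim Q_1, dim Q_2). Reflections preserve
    the line of slope rho and decrease these dimensions, which replaces any appeal to a
    classification of roots. *)

Definition lsub (V : lmodType k) (P : V -> Prop) :=
  P 0 /\ forall c u v, P u -> P v -> P (c *: u + v).

(** Inverses of parametrisations and coordinates of quotients are total functions with arbitrary
    values outside [P], so linearity is only asked on [P]. *)
Definition lin_on (V W : lmodType k) (P : V -> Prop) (f : V -> W) :=
  forall c u v, P u -> P v -> f (c *: u + v) = c *: f u + f v.

(** Subspaces are predicates with a parametrisation, because the ambient spaces, tensors over a
    polynomial ring, have infinite dimension in general. *)
Definition dimP (V : lmodType k) (P : V -> Prop) n :=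
  exists f : {linear 'rV[k]_n -> V},
    injective f /\ forall v, P v <-> exists x, f x = v.

Definition fd (V : lmodType k) (P : V -> Prop) := exists n, dimP P n.

(** The value 0 is a default for infinite dimension. *)
Definition dm (V : lmodType k) (P : V -> Prop) : nat :=
  if pselect (fd P) is left h then sval (cid h) else 0%N.

Lemma dmP (V : lmodType k) (P : V -> Prop) : fd P -> dimP P (dm P).
Proof. by rewrite /dm; case: pselect => // h _; case: cid. Qed.

Section OneSpace.
Variable V : lmodType k.
Implicit Types P Q : V -> Prop.

Lemma lsubZ P c u : lsub P -> P u -> P (c *: u).
Proof. by move=> [P0 PL] Pu; rewrite -[_ *: _]addr0; apply: PL. Qed.

Lemma lsubD P u v : lsub P -> P u -> P v -> P (u + v).
Proof. by move=> [P0 PL] Pu Pv; rewrite -[u]scale1r; apply: PL. Qed.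

Lemma lsubN P u : lsub P -> P u -> P (- u).
Proof. by move=> sP Pu; rewrite -scaleN1r; apply: lsubZ. Qed.

Lemma lsubB P u v : lsub P -> P u -> P v -> P (u - v).
Proof. by move=> sP Pu Pv; apply: lsubD => //; apply: lsubN. Qed.

Lemma lsub_sum P (I : Type) (s : seq I) (C : pred I) F :
  lsub P -> (forall i, C i -> P (F i)) -> P (\sum_(i <- s | C i) F i).
Proof.
move=> sP PF; elim/big_rec: _ => [|i x Ci Px]; first by case: sP.
by apply: lsubD => //; apply: PF.
Qed.

Lemma dimP_lsub P n : dimP P n -> lsub P.
Proof.
move=> [f [_ fP]]; split; first by apply/fP; exists 0; rewrite linear0.
move=> c u v /fP[x <-] /fP[y <-]; apply/fP; exists (c *: x + y).
by rewrite linearP.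
Qed.

Lemma fd_lsub P : fd P -> lsub P.
Proof. by case=> n /dimP_lsub. Qed.

End OneSpace.

(** A vspace of maximal dimension inside [P] is all of [P], since otherwise a further line could be
    added to it. *)
Lemma lsub_vspace (vT : vectType k) (P : vT -> Prop) : lsub P ->
  exists U : {vspace vT}, forall v, P v <-> v \in U.
Proof.
move=> sP.
pose T n := `[< exists2 U : {vspace vT}, (forall v, v \in U -> P v) & \dim U = n >].
have exT : exists n, T n.
  exists 0%N; apply/asboolP; exists 0%VS; last by rewrite dimv0.
  by move=> v; rewrite memv0 => /eqP ->; case: sP.
have bdT n : T n -> (n <= \dim {:vT})%N.
  by move=> /asboolP[U _ <-]; apply: dimvS; apply: subvf.
case: (ex_maxnP exT bdT) => n /asboolP[U UP dU] maxn.
exists U => v; split=> [Pv|]; last exact: UP.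
have UvP w : w \in (U + <[v]>)%VS -> P w.
  move=> /memv_addP[u uU [w' /vlineP[c ->] ->]].
  by apply: lsubD => //; [apply: UP | apply: lsubZ].
have : (\dim (U + <[v]>) <= \dim U)%N.
  by rewrite dU; apply: maxn; apply/asboolP; exists (U + <[v]>)%VS.
move=> le.
have /eqP -> : U == (U + <[v]>)%VS by rewrite eqEdim addvSl.
by apply: (subvP (addvSr _ _)); apply: memv_line.
Qed.

Lemma dimP_inv (V : lmodType k) (P : V -> Prop) n :
  dimP P n -> exists f : {linear 'rV[k]_n -> V}, exists g : V -> 'rV[k]_n,
   [/\ forall x, P (f x), cancel f g, forall v, P v -> f (g v) = v & lin_on P g].
Proof.
move=> dP; have sP := dimP_lsub dP; case: dP => f [fI fP].
have fPx x : P (f x) by apply/fP; exists x.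
exists f.
pose h v := if pselect (P v) is left pv then sval (cid (proj1 (fP v) pv)) else 0.
have hK v : P v -> f (h v) = v by rewrite /h; case: pselect => // a _; case: cid.
exists h; split=> //.
  by move=> x; apply: fI; rewrite hK.
move=> c u v Pu Pv; apply: fI; rewrite linearP !hK //.
by case: sP => _; apply.
Qed.

Lemma dimP_vspace (vT : vectType k) (V : lmodType k) (f : {linear vT -> V})
    (U : {vspace vT}) (P : V -> Prop) :
  (forall x, x \in U -> f x = 0 -> x = 0) ->
  (forall v, P v <-> exists2 x, x \in U & f x = v) -> dimP P (\dim U).
Proof.
move=> fI fP; pose B := vbasis U.
pose g (x : 'rV[k]_(\dim U)) := f (\sum_i x 0 i *: B`_i).
have gl : linear g.
  move=> c x y; rewrite /g -linearP; congr (f _).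
  rewrite scaler_sumr -big_split /=; apply: eq_bigr => i _.
  by rewrite !mxE scalerDl scalerA.
pose G : {linear 'rV[k]_(\dim U) -> V} :=
  HB.pack g (GRing.isLinear.Build _ _ _ _ g gl).
have BU : basis_of U B by apply: vbasisP.
have inU (x : 'rV[k]_(\dim U)) : \sum_i x 0 i *: B`_i \in U.
  by apply: rpred_sum => i _; apply/rpredZ/vbasis_mem/mem_nth; rewrite size_tuple.
exists G; split=> [x y|v].
  move=> /eqP; rewrite -subr_eq0 -(raddfB G) => /eqP E0.
  have {}E0 := fI _ (inU _) E0.
  have /freeP/(_ _ E0) H := basis_free BU.
  apply/eqP; rewrite -subr_eq0; apply/eqP/rowP=> i; rewrite H mxE //.
rewrite fP; split=> [[x xU <-]|[x <-]]; last by exists (\sum_i x 0 i *: B`_i).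
exists (\row_i coord B i x); rewrite {2}(coord_basis BU xU) /=.
by congr (f _); apply: eq_bigr => i _; rewrite mxE.
Qed.

Section Dim.
Variable V : lmodType k.
Implicit Types P Q U : V -> Prop.

Lemma dimP_uniq P n m : dimP P n -> dimP P m -> n = m.
Proof.
suff le n' m' : dimP P n' -> dimP P m' -> (n' <= m')%N.
  by move=> h1 h2; apply/eqP; rewrite eqn_leq !le.
move=> /dimP_inv[f [f' [Pf fK f'K _]]] /dimP_inv[g [g' [Pg gK g'K g'L]]].
pose h x := g' (f x).
have hl : linear h by move=> c x y; rewrite /h linearP g'L.
pose H : {linear 'rV[k]_n' -> 'rV[k]_m'} :=
  HB.pack h (GRing.isLinear.Build _ _ _ _ h hl).
have HI : lker (linfun H) == 0%VS.
  rewrite -subv0; apply/subvP=> x; rewrite memv_ker lfunE /= => /eqP hx0.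
  by rewrite memv0 -(fK x) -(g'K (f x)) //= -/(h x) hx0 linear0 -(fK 0) linear0.
have := limg_dim_eq (f := linfun H) (U := fullv).
rewrite capfv (eqP HI) => /(_ erefl).
rewrite dimvf /dim /= mul1n => <-.
by apply: leq_trans (dimvS (subvf _)) _; rewrite dimvf /dim /= mul1n.
Qed.

Lemma dmE P n : dimP P n -> dm P = n.
Proof. by move=> h; apply: (@dimP_uniq P) => //; apply: dmP; exists n. Qed.

Lemma dimP_coord Q n P : dimP Q n -> lsub P -> (forall v, P v -> Q v) ->
  exists f : {linear 'rV[k]_n -> V}, exists W : {vspace 'rV[k]_n},
  [/\ injective f, forall v, Q v <-> exists x, f x = v,
     forall x, P (f x) <-> x \in W & dimP P (\dim W)].
Proof.
move=> [f [fI fQ]] sP PQ.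
have [|W WP] := @lsub_vspace _ (fun x => P (f x)).
  split; first by rewrite linear0; case: sP.
  by move=> c u v Pu Pv; rewrite linearP; case: sP => _; apply.
exists f, W; split=> //; apply: (dimP_vspace (f := f)).
  by move=> x _ fx0; apply: fI; rewrite fx0 linear0.
move=> v; split=> [Pv|[x /WP Px <-] //].
by have /fQ[x fx] := PQ _ Pv; exists x => //; apply/WP; rewrite fx.
Qed.

Lemma fd_sub P Q : fd Q -> lsub P -> (forall v, P v -> Q v) -> fd P.
Proof.
by move=> [n dQ] sP PQ; have [f [W [_ _ _ dP]]] := dimP_coord dQ sP PQ; exists (\dim W).
Qed.

Lemma dm_sub P Q : fd Q -> lsub P -> (forall v, P v -> Q v) -> (dm P <= dm Q)%N.
Proof.
move=> /dmP dQ sP PQ; have [f [W [_ _ _ dP]]] := dimP_coord dQ sP PQ.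
by rewrite (dmE dP); apply: leq_trans (dimvS (subvf _)) _; rewrite dimvf /dim /= mul1n.
Qed.

Lemma dm_eq P Q : fd Q -> lsub P -> (forall v, P v -> Q v) ->
  (dm Q <= dm P)%N -> forall v, Q v -> P v.
Proof.
move=> /dmP dQ sP PQ; have [f [W [_ fQ WP dP]]] := dimP_coord dQ sP PQ.
rewrite (dmE dP) => le v /fQ[x <-]; apply/WP.
suff /eqP -> : W == fullv by apply: memvf.
by rewrite eqEdim subvf /= dimvf /dim /= mul1n.
Qed.

Lemma dm_null P : (forall v, P v <-> v = 0) -> dm P = 0%N.
Proof.
move=> P0; apply: dmE; exists (\0%R : {linear 'rV[k]_0 -> V}).
split=> [x y _|v]; first by rewrite [x]thinmx0 [y]thinmx0.
by rewrite P0; split=> [->|[x <-]] //; exists 0.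
Qed.

Lemma eq_dm P Q : (forall v, P v <-> Q v) -> dm P = dm Q.
Proof. by move=> PQ; congr dm; apply/predeqP. Qed.
End Dim.

Lemma lin_on0 (V W : lmodType k) (P : V -> Prop) (f : V -> W) :
  lsub P -> lin_on P f -> f 0 = 0.
Proof.
move=> [P0 _] fL; have := fL (-1) 0 0 P0 P0.
by rewrite scaler0 addr0 => ->; rewrite scaleN1r addNr.
Qed.

Lemma lin_onD (V W : lmodType k) (P : V -> Prop) (f : V -> W) u v :
  lin_on P f -> P u -> P v -> f (u + v) = f u + f v.
Proof. by move=> fL Pu Pv; have := fL 1 u v Pu Pv; rewrite !scale1r. Qed.

(** The map [f] induces an isomorphism from P/U onto P'/U', the last two hypotheses being
    injectivity and surjectivity. The additive form avoids quotient spaces and truncated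
    subtraction. *)
Lemma dm_rel (V V' : lmodType k) (P U : V -> Prop) (P' U' : V' -> Prop) (f : V -> V') :
  fd P -> lsub U -> (forall v, U v -> P v) ->
  fd P' -> lsub U' -> (forall v, U' v -> P' v) ->
  lin_on P f -> (forall v, P v -> P' (f v)) ->
  (forall v, P v -> (U v <-> U' (f v))) ->
  (forall w, P' w -> exists2 v, P v & U' (w - f v)) ->
  (dm P + dm U' = dm P' + dm U)%N.
Proof.
move=> /dmP dP sU UP /dmP dP' sU' UP' fL fP fU fS.
have [g [W [gI gP gW dU]]] := dimP_coord dP sU UP.
have [g' [W' [g'I g'P g'W dU']]] := dimP_coord dP' sU' UP'.
have [h [h' [Ph' hK h'K h'L]]] := dimP_inv dP'.
have Pg x : P (g x) by apply/gP; exists x.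
have ex x : exists y, g' y = f (g x) by apply/g'P/fP.
pose H x := sval (cid (ex x)).
have HE x : g' (H x) = f (g x) by rewrite /H; case: cid.
have hl : linear H.
  by move=> c x y; apply: g'I; rewrite linearP !HE linearP fL.
pose L : 'Hom(_, _) := linfun (HB.pack H (GRing.isLinear.Build _ _ _ _ H hl)
   : {linear 'rV[k]_(dm P) -> 'rV[k]_(dm P')}).
have LE x : L x = H x by rewrite lfunE.
have LW x : (x \in W) = (L x \in W').
  rewrite LE; apply/idP/idP.
    by move=> /gW /fU - /(_ (Pg _)); rewrite -HE => /g'W.
  by move=> /g'W; rewrite HE => /fU - /(_ (Pg _)) /gW.
have full : (limg L + W')%VS = fullv.
  apply/eqP; rewrite eqEsubv subvf /=; apply/subvP=> y _.
  have : P' (g' y) by apply/g'P; exists y.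
  move=> /fS[v /gP[x <-]]; rewrite -HE -raddfB => /g'W Hy.
  rewrite -(subrK (L x) y) addrC; apply: memv_add; first by apply: memv_img; apply: memvf.
  by rewrite LE.
have LcW : (L @: W)%VS = (limg L :&: W')%VS.
  apply/eqP; rewrite eqEsubv; apply/andP; split; apply/subvP=> y.
    by move=> /memv_imgP[x xW ->]; rewrite memv_cap -LW xW memv_img // memvf.
  by rewrite memv_cap => /andP[/memv_imgP[x _ ->]]; rewrite -LW; apply: memv_img.
have kW : (lker L <= W)%VS.
  by apply/subvP=> x; rewrite memv_ker LW => /eqP ->; apply: mem0v.
rewrite (dmE dU) (dmE dU').
have := dimv_sum_cap (limg L) W'; rewrite full -LcW.
have := limg_ker_dim L W; rewrite (capv_idPr kW).
have := limg_ker_dim L fullv; rewrite capfv.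
rewrite !dimvf /dim /= !mul1n.
have ar (n1 n2 n3 n4 n5 n6 n7 : nat) : (n1 + n2 = n3 -> n1 + n4 = n5 ->
  n6 + n4 = n2 + n7 -> n3 + n7 = n6 + n5)%N by lia.
exact: ar.
Qed.
End Subspace.

(** * Graded modules and points of their supports *)

Section Graded.
Variables (k : fieldType) (V : lmodType k) (r : nat) (X : 'I_r -> {linear V -> V}).
Hypothesis XC : forall i j v, X i (X j v) = X j (X i v).
Implicit Types U M : nat -> V -> Prop.

Definition gsub M := forall e, lsub (M e).

Definition gclosed M := forall i e v, M e v -> M e.+1 (X i v).

(** Only large degrees matter, so generation is required from degree [e0] on. *)
Definition generated_from M e0 := forall e, (e0 <= e)%N -> forall v, M e.+1 v ->
  exists2 w : 'I_r -> V, forall i, M e (w i) & v = \sum_i X i (w i).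

Section Noetherian.
Variable M : nat -> V -> Prop.
Hypotheses (Mfd : forall e, fd (M e)) (MX : gclosed M).
Variable e0 : nat.
Hypothesis Mgen : generated_from M e0.

Let Ms e : lsub (M e). Proof. exact: fd_lsub. Qed.

(** Such a [U] stands for a subspace of M / (X_s M + X_(s+1) M + ...), on which only the first [s]
    operators act. *)
Definition contains_tail (s : nat) U := forall e (w : 'I_r -> V),
  (forall i, M e (w i)) -> U e.+1 (\sum_(i < r | (s <= i)%N) X i (w i)).

Definition gens s U e u := exists w : 'I_r -> V,
  [/\ forall i, M e (w i), forall i : 'I_r, (i < s)%N -> U e (w i) &
      u = \sum_i X i (w i)].

Lemma gensD s U e u v : gsub U -> gens s U e u -> gens s U e v -> gens s U e (u + v).
Proof.
move=> sU [w [wM wU ->]] [w' [wM' wU' ->]]; exists (fun i => w i + w' i); split.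
- by move=> i; apply: lsubD.
- by move=> i si; apply: lsubD => //; [apply: wU | apply: wU'].
- by rewrite -big_split; apply: eq_bigr => i _; rewrite raddfD.
Qed.

(** In each degree the dimensions along the chain are bounded, and only finitely many degrees have
    to be stabilised at once. *)
Lemma chain_stab (C : nat -> nat -> V -> Prop) e1 :
  (forall j, gsub (C j)) -> (forall j e v, C j e v -> M e v) ->
  (forall j e v, C j e v -> C j.+1 e v) ->
  exists j0, forall e, (e <= e1)%N -> forall j v, C j e v -> C j0 e v.
Proof.
move=> sC CM Cinc.
have Cle j j' e v : (j <= j')%N -> C j e v -> C j' e v.
  move=> /subnK <-; elim: (j' - j)%N => //= n IH Cv; rewrite addSn; apply: Cinc; exact: IH.
have step e : exists j0, forall j v, C j e v -> C j0 e v.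
  pose T n := `[< exists j, dm (C j e) = n >].
  have exT : exists n, T n by exists (dm (C 0%N e)); apply/asboolP; exists 0%N.
  have bdT n : T n -> (n <= dm (M e))%N.
    by move=> /asboolP[j <-]; apply: dm_sub; [exact: Mfd|exact: sC|exact: CM].
  case: (ex_maxnP exT bdT) => n /asboolP[j0 dj0] nmax; exists j0 => j v Cv.
  have fdC i : fd (C i e) by apply: (fd_sub (Mfd e)); [exact: sC|exact: CM].
  have le : (dm (C (maxn j j0) e) <= dm (C j0 e))%N.
    by rewrite dj0; apply: nmax; apply/asboolP; exists (maxn j j0).
  apply: (dm_eq _ _ _ le); [exact: fdC|exact: sC| |].
    by move=> w; apply: Cle; apply: leq_maxr.
  by apply: Cle Cv; apply: leq_maxl.
elim: e1 => [|e1 [j1 IH]].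
  by have [j0 H] := step 0%N; exists j0 => e; rewrite leqn0 => /eqP ->.
have [j2 H] := step e1.+1; exists (maxn j1 j2) => e.
rewrite leq_eqVlt => /orP[/eqP ->|lt] j v Cv.
  by apply: Cle (leq_maxr _ _) _; apply: H Cv.
by apply: Cle (leq_maxl _ _) _; apply: (IH e) Cv.
Qed.

Definition xmul (x : V -> V) e v :=
  if e is e'.+1 then exists2 m, M e' m & v = x m else v = 0.

(** Induction on the number of variables, as in Hilbert's basis theorem: elements of [U] are written
    x^j m with x = X_s, and the coefficients m, taken modulo x M, form modules over the preceding
    variables to which the induction hypothesis applies. *)
Lemma noetherian_tail s U : (s <= r)%N -> gsub U -> (forall e v, U e v -> M e v) ->
  (forall (i : 'I_r) e v, (i < s)%N -> U e v -> U e.+1 (X i v)) ->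
  contains_tail s U -> exists e1, forall e, (e1 <= e)%N ->
  forall u, U e.+1 u -> gens s U e u.
Proof.
elim: s U => [|s IHs] U sr sU UM UX Ut.
  exists e0 => e le u /UM /(Mgen le)[w wM ->]; exists w; split=> //.
have sUe e : lsub (U e) by apply: sU.
pose os := Ordinal sr; pose x := X os.
pose xM := xmul x.
have xM0 e : xM e 0.
  by case: e => //= e; exists 0; [case: (Ms e) | rewrite linear0].
have xMl e : lsub (xM e).
  split=> // c u v; case: e => [|e] /=.
    by move=> -> ->; rewrite scaler0 addr0.
  move=> [m mM ->] [m' mM' ->]; exists (c *: m + m'); last by rewrite linearP.
  by case: (Ms e) => _; apply.
have xMM e v : xM e v -> M e v.
  case: e => [->|e [m mM ->]]; [by case: (Ms 0)|exact: MX].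
have xMX i e v : xM e v -> xM e.+1 (X i v).
  case: e => [->|e [m mM ->]] /=; first by exists 0; [case: (Ms 0)|rewrite !linear0].
  by exists (X i m); [apply: MX | rewrite /x XC].
pose xj j := iter j x.
have xjl j c u v : xj j (c *: u + v) = c *: xj j u + xj j v.
  by elim: j => //= j ->; rewrite linearP.
have xjB j u v : xj j (u - v) = xj j u - xj j v.
  by rewrite addrC -scaleN1r xjl scaleN1r addrC.
have xj0 j : xj j 0 = 0 by elim: j => //= j ->; rewrite linear0.
have xjD j u v : xj j (u + v) = xj j u + xj j v by rewrite -[u]scale1r xjl !scale1r.
have xjX j i v : xj j (X i v) = X i (xj j v).
  by elim: j => //= j ->; rewrite XC.
have xjM j e v : M e v -> M (j + e)%N (xj j v).
  by elim: j => //= j IH Mv; rewrite addSn; apply: MX; apply: IH.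
have xjU j e v : U e v -> U (j + e)%N (xj j v).
  by elim: j => //= j IH Mv; rewrite addSn; apply: UX => //; apply: IH.
have xjS j v : xj j (x v) = xj j.+1 v by rewrite /xj -iterSr.
(* Here [m] is the lowest coefficient of an element x^j m - x^(j+1) m' of [U]. The chain increases
   with [j] because [U] is stable under x. *)
pose C j e m := M e m /\ exists2 y, xM e y & U (j + e)%N (xj j (m - y)).
have CM j e v : C j e v -> M e v by case.
have sC j : gsub (C j).
  move=> e; split.
    split; first by case: (Ms e).
    by exists 0 => //; rewrite subr0 xj0; case: (sU (j + e)%N).
  move=> c u v [Mu [y yx yU]] [Mv [y' yx' yU']]; split.
    by case: (Ms e) => _; apply.
  exists (c *: y + y'); first by case: (xMl e) => _; apply.
  have -> : c *: u + v - (c *: y + y') = c *: (u - y) + (v - y').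
    by rewrite scalerBr opprD addrACA.
  by rewrite xjl; case: (sU (j + e)%N) => _; apply.
have Cinc j e v : C j e v -> C j.+1 e v.
  move=> [Mv [y yx yU]]; split=> //; exists y => //.
  by rewrite addSn; apply: (UX os).
have Cle j j' e v : (j <= j')%N -> C j e v -> C j' e v.
  move=> /subnK <-; elim: (j' - j)%N => //= n IH Cv; rewrite addSn; apply: Cinc; exact: IH.
have CX j (i : 'I_r) e v : (i < s)%N -> C j e v -> C j e.+1 (X i v).
  move=> si [Mv [y yx yU]]; split; first exact: MX.
  exists (X i y); first exact: xMX.
  by rewrite -raddfB xjX addnS; apply: UX => //; apply: ltnW.
have Ctail j : contains_tail s (C j).
  move=> e w wM; split; first by apply: lsub_sum => // i _; apply: MX.
  exists (x (w os)); first by exists (w os).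
  rewrite (bigD1 os) //= addrAC subrr add0r.
  apply: xjU; rewrite (eq_bigl (fun i : 'I_r => (s < i)%N)); first exact: Ut.
  by move=> i; rewrite -val_eqE /= ltn_neqAle eq_sym andbC.
pose Cinf e v := exists j, C j e v.
have sCinf : gsub Cinf.
  move=> e; split; first by exists 0%N; case: (sC 0%N e).
  move=> c u v [j Cu] [j' Cv]; exists (maxn j j').
  by case: (sC (maxn j j') e) => _; apply; [apply: Cle Cu|apply: Cle Cv];
     rewrite ?leq_maxl ?leq_maxr.
have IHg j : exists e1, forall e, (e1 <= e)%N -> forall u, C j e.+1 u -> gens s (C j) e u.
  by apply: IHs => //; [exact: ltnW|exact: CM|move=> i e v; exact: CX].
have [einf Hinf] : exists e1, forall e, (e1 <= e)%N ->
    forall u, Cinf e.+1 u -> gens s Cinf e u.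
  apply: IHs => //; first exact: ltnW.
  - by move=> e v [j /CM].
  - by move=> i e v si [j Cv]; exists j; apply: CX.
  - by move=> e w wM; exists 0%N; apply: Ctail.
have [j0 Hj0] := chain_stab einf sC CM Cinc.
have sCe j e : lsub (C j e) by apply: sC.
(* Beyond degree [einf] the union of the chain is generated by lower degrees, so the stabilisation
   up to [einf] propagates to all degrees. *)
have Call e j v : C j e v -> C j0 e v.
  elim: e j v => [|e IHe] j v Cv; first by apply: Hj0 Cv.
  case: (leqP e.+1 einf) => le; first exact: (Hj0 _ le j).
  have [|w [wM wC ->]] := Hinf e le v; first by exists j.
  rewrite (bigID (fun i : 'I_r => (i < s)%N)) /=; apply: lsubD => //.
    by apply: lsub_sum => // i si; apply: CX => //; have [j' /IHe] := wC i si.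
  rewrite (eq_bigl (fun i : 'I_r => (s <= i)%N)); first exact: Ctail.
  by move=> i; rewrite -leqNgt.
have [ej Hej] := choice IHg.
(* If j <= j0 and j + e = n + 1 with n >= E, then [e] exceeds the bound [ej j] from which [C j] is
   generated. *)
pose E := (j0 + \max_(j < j0.+1) ej j)%N.
exists E => n En.
(* The degree [e] of the coefficient decreases: once an element generated in degree [n] is
   subtracted, the rest is divisible by x^(j+1). *)
have main e j u m : (j + e = n.+1)%N -> U n.+1 u -> M e m -> u = xj j m ->
    gens s.+1 U n u.
  elim: e j u m => [|e IHe] j u m jen Uu Mm um.
    have jn : j = n.+1 by lia.
    have Cm : C j 0%N m by split=> //; exists 0 => //; rewrite subr0 -um jen.
    have {Cm} [_ [y /= -> Uy]] := Call _ _ _ Cm.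
    rewrite subr0 in Uy.
    have j0n : (j0 <= n)%N by apply: leq_trans En; rewrite leq_addr.
    have Uz : U n (xj (n - j0)%N (xj j0 m)).
      by have := xjU (n - j0)%N _ _ Uy; rewrite (_ : (n - j0 + (j0 + 0)) = n)%N //; lia.
    exists (fun i => if i == os then xj (n - j0)%N (xj j0 m) else 0); split.
    - by move=> i; case: eqP => _; [exact: UM Uz|by case: (Ms n)].
    - by move=> i si; case: eqP => _ //; case: (sU n).
    - rewrite (bigD1 os) //= eqxx big1 ?addr0; last first.
        by move=> i /negPf ->; rewrite linear0.
      by rewrite um jn /xj -iterD subnK.
  have Cm : C j e.+1 m.
    by split=> //; exists 0 => //; rewrite subr0 -um jen.
  case: (leqP j j0) => jj0.
    have ele : (ej j <= e)%N.
      have : (ej j <= \max_(j < j0.+1) ej j)%N.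
        by rewrite (leq_bigmax_cond (Ordinal (jj0 : (j < j0.+1)%N))).
      by move: En; rewrite /E; lia.
    have [w [wM wC mE]] := Hej _ _ ele _ Cm.
    have jen' : (j + e)%N = n by lia.
    have /choice[y yP] : forall i : 'I_r, exists y, (i < s)%N ->
        xM e y /\ U n (xj j (w i - y)).
      move=> i; case: (ltnP i s) => [si|]; last by exists 0.
      by have [_ [y yx yU]] := wC i si; exists y => _; rewrite -jen'.
    pose w1 (i : 'I_r) := if (i < s)%N then xj j (w i - y i)
                          else if i == os then 0 else xj j (w i).
    have w1M i : M n (w1 i).
      rewrite /w1; case: ltnP => [si|_]; first by apply/UM; case: (yP i si).
      by case: eqP => _; [case: (Ms n)|rewrite -jen'; apply: xjM].
    have w1U (i : 'I_r) : (i < s.+1)%N -> U n (w1 i).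
      rewrite ltnS leq_eqVlt /w1 => /orP[/eqP iE|si]; last by rewrite si; case: (yP i si).
      by rewrite iE ltnn -val_eqE /= iE eqxx; case: (sU n).
    pose u1 := \sum_i X i (w1 i).
    have g1 : gens s.+1 U n u1 by exists w1.
    have Uu1 : U n.+1 u1.
      rewrite /u1 (bigID (fun i : 'I_r => (i < s.+1)%N)) /=; apply: lsubD => //.
        by apply: lsub_sum => // i si; apply: UX => //; apply: w1U.
      rewrite (eq_bigl (fun i : 'I_r => (s.+1 <= i)%N)); first exact: Ut.
      by move=> i; rewrite -leqNgt.
    have /choice[z zP] : forall i : 'I_r, exists z, M e z /\ ((i < s)%N -> X i (y i) = x z).
      move=> i; case: (ltnP i s) => [si|_]; last by exists 0; split=> //; case: (Ms e).
      have [/(xMX i) [z zM zE] _] := yP i si; by exists z.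
    have uE : u - u1 = xj j.+1 (w os + \sum_(i < r | (i < s)%N) z i).
      rewrite um mE -xjS raddfD /= xjD.
      have -> : xj j (\sum_i X i (w i)) = \sum_i X i (xj j (w i)).
        by elim/big_rec2: _ => [|i a b _ IH]; rewrite ?xj0 // xjD xjX IH.
      have -> : xj j (X os (\sum_(i < r | (i < s)%N) z i)) =
                \sum_(i < r | (i < s)%N) X i (xj j (y i)).
        rewrite raddf_sum.
        elim/big_rec2: _ => [|i a b si IH]; rewrite ?xj0 // xjD IH; congr (_ + _).
        by rewrite -xjX (proj2 (zP i) si).
      rewrite /u1 -sumrB (bigID (fun i : 'I_r => (i < s)%N)) /= addrC.
      congr (_ + _).
        rewrite (bigD1 os) /= ?ltnn // big1 ?addr0.
          by rewrite /w1 /= ltnn eqxx linear0 subr0 xjX.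
        by move=> i /andP[/negPf nis nio]; rewrite /w1 nis (negPf nio) subrr.
      by apply: eq_bigr => i si; rewrite /w1 si xjB raddfB /= subKr.
    rewrite -(subrK u1 u); apply: gensD => //.
    apply: (IHe j.+1 _ _ _ _ _ uE); first by lia.
      exact: lsubB.
    by apply: lsubD => //; apply: lsub_sum => // i _; case: (zP i).
  (* Now j > j0. As [m] is already a coefficient for x^j0, the corresponding element of [U] can be
     multiplied by x at least once. *)
  have [_ [y yx yU]] := Call _ _ _ Cm.
  have g1 : gens s.+1 U n (xj j (m - y)).
    exists (fun i => if i == os then xj (j - j0.+1)%N (xj j0 (m - y)) else 0).
    have Uz : U n (xj (j - j0.+1)%N (xj j0 (m - y))).
      have := xjU (j - j0.+1)%N _ _ yU.
      by rewrite (_ : (j - j0.+1 + (j0 + e.+1)) = n)%N //; lia.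
    split.
    - by move=> i; case: eqP => _; [exact: UM Uz|by case: (Ms n)].
    - by move=> i _; case: eqP => _ //; case: (sU n).
    - rewrite (bigD1 os) //= eqxx big1 ?addr0; last first.
        by move=> i /negPf ->; rewrite linear0.
      by rewrite {1}(_ : j = (j - j0.+1 + j0).+1) /xj ?iterS -?iterD //; lia.
  rewrite um -(subrK y m) xjD; apply: gensD => //.
  have [z zM yE] := yx.
  apply: (IHe j.+1 _ z) => //; [by lia| |by rewrite yE xjS].
  have -> : xj j y = u - xj j (m - y) by rewrite um xjB subKr.
  apply: lsubB => //.
  have := xjU (j - j0)%N _ _ yU; rewrite (_ : (j - j0 + (j0 + e.+1)) = n.+1)%N; last by lia.
  by rewrite /xj -iterD subnK // ltnW.
move=> u Uu; apply: (main n.+1 0%N u u) => //; exact: UM.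
Qed.

(* Hilbert's basis theorem for graded modules. *)
Lemma noetherian U : gsub U -> (forall e v, U e v -> M e v) -> gclosed U ->
  exists e1, generated_from U e1.
Proof.
move=> sU UM UX.
have [e1 H] : exists e1, forall e, (e1 <= e)%N -> forall u, U e.+1 u -> gens r U e u.
  apply: noetherian_tail => //; first by move=> i e v _; apply: UX.
  move=> e w wM; rewrite big_pred0; first by case: (sU e.+1).
  by move=> i; rewrite leqNgt ltn_ord.
exists e1 => e le v /(H e le)[w [_ wU ->]]; exists w => // i; exact: wU.
Qed.
End Noetherian.
End Graded.

(** * Joint eigenvectors, and points in the support of a graded module *)

Lemma common_eigenrow (k : closedFieldType) r n (A : 'I_r -> 'M[k]_n) : (0 < n)%N ->
  (forall i j, A i *m A j = A j *m A i) ->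
  exists (a : 'I_r -> k) (v : 'rV_n), v != 0 /\ forall i, v *m A i = a i *: v.
Proof.
move=> n0 AC.
suff /(_ r (leqnn r)) [a [v [v0 va]]] : forall s, (s <= r)%N ->
    exists (a : 'I_r -> k) (v : 'rV_n),
      v != 0 /\ forall i : 'I_r, (i < s)%N -> v *m A i = a i *: v.
  by exists a, v; split=> // i; apply/va/ltn_ord.
elim=> [_|s IH sr].
  exists (fun=> 0), (const_mx 1); split=> //.
  by apply/eqP => /matrixP/(_ 0 (Ordinal n0)); rewrite !mxE => /eqP; rewrite oner_eq0.
have [a [v [v0 va]]] := IH (ltnW sr).
(* The joint eigenspace of the first [s] matrices is stable under the next one, which commutes with
   them, and an eigenvector is found inside it. *)
pose W := (\bigcap_(i < r | (i < s)%N) eigenspace (A i) (a i))%MS.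
have vW : (v <= W)%MS.
  by apply/sub_bigcapmxP => i si; apply/eigenspaceP; apply: va.
have W0 : (0 < \rank W)%N.
  by rewrite lt0n mxrank_eq0; apply: contra_neq v0 => W0; apply/eqP; rewrite -submx0 -W0.
pose As := A (Ordinal sr).
have Wst : (W *m As <= W)%MS.
  apply/sub_bigcapmxP => i si; apply/eigenspaceP.
  rewrite -mulmxA AC mulmxA.
  have /eigenspaceP -> : (W <= eigenspace (A i) (a i))%MS.
    by apply: (bigcapmx_inf i).
  by rewrite scalemxAl.
pose B := row_base W.
have BAs : (B *m As <= B)%MS.
  rewrite eq_row_base; apply: submx_trans Wst; apply: submxMr.
  by rewrite eq_row_base.
have /submxP[C BC] := BAs.
have [b bC] : exists b, root (char_poly C) b.
  by apply/closed_rootP; rewrite size_char_poly; move: W0; case: (\rank W).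
have /eigenvalueP[u uC u0] : eigenvalue C b by rewrite eigenvalue_root_char.
exists (fun i => if i == Ordinal sr then b else a i), (u *m B); split.
  apply: contra_neq u0 => uB; apply/(row_free_inj (row_base_free W)).
  by rewrite mul0mx.
move=> i; rewrite ltnS leq_eqVlt => /orP[/eqP iE|si].
  have -> : i = Ordinal sr by apply: val_inj.
  by rewrite eqxx -mulmxA -/As BC mulmxA uC scalemxAl.
rewrite -val_eqE /= ltn_eqF //; apply/eigenspaceP.
apply: submx_trans (submxMl _ _) _; rewrite eq_row_base.
exact: (bigcapmx_inf i).
Qed.

Lemma common_eigencol (k : closedFieldType) r n (A : 'I_r -> 'M[k]_n) : (0 < n)%N ->
  (forall i j, A i *m A j = A j *m A i) ->
  exists (a : 'I_r -> k) (v : 'cV_n), v != 0 /\ forall i, A i *m v = a i *: v.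
Proof.
move=> n0 AC; have [|a [v [v0 va]]] := @common_eigenrow k r n (fun i => (A i)^T) n0.
  by move=> i j; rewrite -!trmx_mul AC.
exists a, v^T; split; first by rewrite trmx_eq0.
by move=> i; apply: trmx_inj; rewrite trmx_mul !linearZ /= !trmxK va.
Qed.

(** Coordinates on P/U, obtained from the component in a complement of [U] within [P]. *)
Lemma quotient_coord (k : fieldType) (V : lmodType k) (P U : V -> Prop) :
  fd P -> lsub U -> (forall v, U v -> P v) ->
  exists q : V -> 'rV[k]_(dm P - dm U),
   [/\ lin_on P q, forall v, P v -> (q v = 0 <-> U v) & 
       forall y, exists2 v, P v & q v = y].
Proof.
move=> /dmP dP sU UP.
have [f [W [fI fP fW dU]]] := dimP_coord dP sU UP.
rewrite (dmE dU).
have [g [g' [Pg gK g'K g'L]]] := dimP_inv dP.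
have gP v : P v -> exists x, g x = v by move=> Pv; exists (g' v); rewrite g'K.
have [|W' W'P] := @lsub_vspace _ _ (fun x => U (g x)).
  split; first by rewrite linear0; case: sU.
  by move=> c u v Pu Pv; rewrite linearP; case: sU => _; apply.
have dU' : dimP U (\dim W').
  apply: (dimP_vspace (f := g)).
    by move=> x _ gx0; rewrite -(gK x) gx0 -(gK 0) linear0.
  move=> v; split=> [Uv|[x /W'P Ux <-] //].
  by exists (g' v); rewrite ?g'K //; [apply/W'P; rewrite g'K //|]; apply: UP.
rewrite (dimP_uniq dU dU').
pose C := (W'^C)%VS.
have dC : \dim C = (dm P - \dim W')%N.
  by rewrite dimv_compl dimvf /dim /= mul1n.
have capC : (C :&: W')%VS = 0%VS by rewrite capvC capv_compl.
have addC : (C + W')%VS = fullv by rewrite addvC addv_complf.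
rewrite -dC.
pose p := daddv_pi C W'.
pose q v : 'rV[k]_(\dim C) := \row_i coord (vbasis C) i (p (g' v)).
have bC := vbasisP C.
have addE w : p w + daddv_pi W' C w = w.
  by apply: daddv_pi_add; rewrite ?addC ?memvf.
have pC x : p x \in C by apply: memv_pi.
exists q; split.
- move=> c u v Pu Pv; apply/rowP=> i; rewrite !mxE g'L //.
  by rewrite !linearP.
- move=> v Pv; split=> [q0|Uv].
    have p0 : p (g' v) = 0.
      rewrite (coord_basis bC (pC _)) big1 // => i _.
      by have /rowP/(_ i) := q0; rewrite !mxE => ->; rewrite scale0r.
    rewrite -(g'K _ Pv); apply/W'P.
    by have := addE (g' v); rewrite p0 add0r => <-; apply: memv_pi.
  apply/rowP=> i; rewrite !mxE.
  have -> : p (g' v) = 0.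
    have wW : g' v \in W' by apply/W'P; rewrite g'K //; apply: UP.
    have E := addE (g' v).
    apply/eqP; rewrite -memv0 -capC memv_cap pC /=.
    by rewrite -(addrK (daddv_pi W' C (g' v)) (p _)) E memvB // memv_pi.
  by rewrite linear0.
- move=> y; pose x := \sum_i y 0 i *: (vbasis C)`_i.
  have xC : x \in C.
    by apply: rpred_sum => i _; apply/rpredZ/vbasis_mem/mem_nth; rewrite size_tuple.
  exists (g x) => //; apply/rowP=> i; rewrite mxE gK.
  have -> : p x = x by apply: daddv_pi_id.
  by rewrite coord_sum_free // (basis_free bC).
Qed.

Section Point.
Variables (k : closedFieldType) (V : lmodType k) (r : nat) (X : 'I_r -> {linear V -> V}).
Hypothesis XC : forall i j v, X i (X j v) = X j (X i v).
Variable M : nat -> V -> Prop.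
Hypotheses (Mfd : forall e, fd (M e)) (MX : gclosed X M).
Variable e0 : nat.
Hypothesis Mgen : generated_from X M e0.
Let Ms e : lsub (M e). Proof. exact: fd_lsub. Qed.

(** Compatible nonzero functionals on M_e/U_e on which the operators act through the scalars [a].
    For [a] nonzero this is a point of projective space in the support of M/U. *)
Definition point_functional (U : nat -> V -> Prop) (a : 'I_r -> k) (f : nat -> V -> k) e1 :=
  forall e, (e1 <= e)%N ->
  [/\ lin_on (M e) (f e : V -> k^o), forall v, U e v -> f e v = 0,
      exists2 v, M e v & f e v != 0 &
      forall i v, M e v -> f e.+1 (X i v) = a i * f e v].

(* When multiplication by x = X_s is eventually surjective modulo U, the
   quotients M_e/U_e stabilise and the X_i act on them as commuting matrices. *)
Lemma point_stable (s : 'I_r) U : gsub U -> (forall e v, U e v -> M e v) -> gclosed X U ->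
  (forall e1, exists2 e, (e1 <= e)%N & ~ (forall v, M e v -> U e v)) ->
  (exists e1, forall e, (e1 <= e)%N -> forall v, M e.+1 v ->
     exists2 m, M e m & U e.+1 (v - X s m)) ->
  exists a, (exists i, a i != 0) /\ exists f e1, point_functional U a f e1.
Proof.
move=> sU UM UX io [e1 surj].
have sUe e : lsub (U e) by apply: sU.
pose q e := (dm (M e) - dm (U e))%N.
have fdU e : fd (U e) by exact: (fd_sub (Mfd e) (sUe e) (UM e)).
have dUM e : (dm (U e) <= dm (M e))%N by exact: (dm_sub (Mfd e) (sUe e) (UM e)).
pose K e v := M e v /\ U e.+1 (X s v).
have sK e : lsub (K e).
  split; first by split; rewrite ?linear0; [case: (Ms e)|case: (sUe e.+1)].
  move=> c u v [Mu Uu] [Mv Uv]; split; rewrite ?linearP.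
    by case: (Ms e) => _; apply.
  by case: (sUe e.+1) => _; apply.
have KM e v : K e v -> M e v by case.
have UK e v : U e v -> K e v by move=> Uv; split; [apply: UM|apply: UX].
have fdK e : fd (K e) by exact: (fd_sub (Mfd e) (sK e) (KM e)).
have q_dec e : (e1 <= e)%N ->
    (dm (M e) + dm (U e.+1) = dm (M e.+1) + dm (K e))%N.
  move=> le; apply: (@dm_rel _ _ _ _ _ _ _ (X s)) => //.
  - exact: KM.
  - exact: UM.
  - by move=> c u v _ _; rewrite linearP.
  - by move=> v; apply: MX.
  - by move=> v Mv; split=> [[]|].
  - by move=> v /(surj _ le).
have U_K e : (dm (U e) <= dm (K e))%N by exact: (dm_sub (fdK e) (sUe e) (UK e)).
(* Since X_s is onto, the dimensions of M_e/U_e do not increase. They become constant, and from then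
   on X_s is also injective. *)
have [e2 e12 q2] : exists2 e2, (e1 <= e2)%N & forall e, (e2 <= e)%N -> q e.+1 = q e.
  pose T n := `[< exists2 e, (e1 <= e)%N & q e = n >].
  have exT : exists n, T n by exists (q e1); apply/asboolP; exists e1.
  case: (ex_minnP exT) => n /asboolP[e2 le2 q2] minn; exists e2 => //.
  have qn e : (e2 <= e)%N -> q e = n.
    move=> /subnK <-; elim: (e - e2)%N => //= j IH.
    apply/eqP; rewrite eqn_leq minn ?andbT; last first.
      by apply/asboolP; exists (j.+1 + e2)%N => //; apply: leq_trans le2 (leq_addl _ _).
    rewrite -IH /q addSn; move: (q_dec (j + e2)%N (leq_trans le2 (leq_addl _ _))).
    by move: (U_K (j + e2)%N) (dUM (j + e2)%N) (dUM (j + e2).+1); lia.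
  by move=> e le; rewrite !qn // leqW.
have pre e : (e2 <= e)%N -> forall v, M e v -> U e.+1 (X s v) -> U e v.
  move=> le v Mv Uv.
  have le1 := leq_trans e12 le.
  apply: (dm_eq (fdK e) (sUe e) (UK e)) => //.
  move: (q_dec e le1) (q2 e le) (dUM e) (dUM e.+1) (U_K e); rewrite /q; lia.
pose c := q e2.
have := quotient_coord (Mfd e2) (sUe e2) (UM e2); rewrite -/(q e2) -/c.
move=> [Q0 [Q0L Q0K Q0S]].
have /choice[lift liftP] : forall em : nat * V, exists m,
    (e2 <= em.1)%N -> M em.1.+1 em.2 -> M em.1 m /\ U em.1.+1 (em.2 - X s m).
  move=> [e m] /=; case: (boolP (e2 <= e)%N) => le; last by exists 0.
  have [Mm|nM] := pselect (M e.+1 m); last by exists 0.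
  by have [m' ? ?] := surj e (leq_trans e12 le) m Mm; exists m'.
(* The coordinates of degree [e2] are transported to all higher degrees by lifting along X_s, so
   that X_s becomes the identity in coordinates. *)
pose Q := fix Q n : V -> 'rV[k]_c := if n is n'.+1 then fun v => Q n' (lift ((n' + e2)%N, v)) else Q0.
have QP n : [/\ lin_on (M (n + e2)%N) (Q n), forall v, M (n + e2)%N v -> (Q n v = 0 <-> U (n + e2)%N v) &
    forall y, exists2 v, M (n + e2)%N v & Q n v = y] /\
    forall v m, M (n + e2)%N m -> M (n + e2).+1 v -> U (n + e2).+1 (v - X s m) -> Q n.+1 v = Q n m.
  elim: n => [|n [[QL QK QS] Qx]].
    split=> // v m Mm Mv Uv /=.
    have [|Ml Ul] := liftP (e2, v) _ Mv; first by [].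
    apply/eqP; rewrite -subr_eq0 -scaleN1r addrC -(Q0L (-1) m _ Mm Ml); apply/eqP/Q0K.
      by apply: lsubD => //; apply: lsubZ.
    apply: pre => //; first by apply: lsubD => //; apply: lsubZ.
    rewrite scaleN1r raddfD raddfN addrC /=.
    have -> : X s (lift (e2, v)) - X s m = (v - X s m) - (v - X s (lift (e2, v))).
      by rewrite opprB [RHS]addrC addrA subrK.
    by apply: lsubB.
  have n1 : (e2 <= n + e2)%N by apply: leq_addl.
  have Qx' v m : M (n + e2)%N m -> M (n + e2).+1 v -> U (n + e2).+1 (v - X s m) ->
      Q n.+1 v = Q n m by apply: Qx.
  have P1 : [/\ lin_on (M (n.+1 + e2)%N) (Q n.+1),
      forall v, M (n.+1 + e2)%N v -> (Q n.+1 v = 0 <-> U (n.+1 + e2)%N v) &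
      forall y, exists2 v, M (n.+1 + e2)%N v & Q n.+1 v = y].
    rewrite addSn; split.
    - move=> a u v Mu Mv.
      have [Mu' Uu'] := liftP (_, u) n1 Mu; have [Mv' Uv'] := liftP (_, v) n1 Mv.
      set u' := lift _ in Mu' Uu'; set v' := lift _ in Mv' Uv'.
      rewrite (Qx' u u') // (Qx' v v') // -QL //; apply: Qx'.
      + by case: (Ms (n + e2)%N) => _; apply.
      + by case: (Ms (n + e2).+1) => _; apply.
      + rewrite linearP.
        have -> : a *: u + v - (a *: X s u' + X s v') = a *: (u - X s u') + (v - X s v').
          by rewrite scalerBr opprD addrACA.
        by case: (sUe (n + e2).+1) => _; apply.
    - move=> v Mv; have [Mv' Uv'] := liftP (_, v) n1 Mv.
      set v' := lift _ in Mv' Uv'; rewrite (Qx' v v') // QK //.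
      have vE : v = (v - X s v') + X s v' by rewrite subrK.
      split=> [Uv|Uv]; first by rewrite vE; apply: lsubD => //; apply: UX.
      apply: pre => //; have -> : X s v' = v - (v - X s v') by rewrite subKr.
      exact: lsubB.
    - move=> y; have [m Mm Qm] := QS y; exists (X s m); first exact: MX.
      rewrite (Qx' _ m) //; [exact: MX|rewrite subrr; by case: (sUe (n + e2).+1)].
  split=> // v m Mm Mv Uv /=; rewrite addSn in Mm Mv Uv; case: P1 => QL1 QK1 QS1.
  rewrite addSn in QL1 QK1.
  have n2 : (e2 <= (n + e2).+1)%N by apply: leqW.
  have [Ml Ul] := liftP (_, v) n2 Mv.
  rewrite -/(Q n.+1 _) -/(Q n.+1 m).
  apply/eqP; rewrite -subr_eq0 -scaleN1r addrC -(QL1 (-1) m _ Mm Ml); apply/eqP/QK1.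
    by apply: lsubD => //; apply: lsubZ.
  apply: pre => //; first by apply: lsubD => //; apply: lsubZ.
  rewrite scaleN1r raddfD raddfN addrC /=.
  set l := lift _ in Ml Ul *.
  have -> : X s l - X s m = (v - X s m) - (v - X s l).
    by rewrite opprB [RHS]addrC addrA subrK.
  by apply: lsubB.
pose sec n y := sval (cid2 (let: conj (And3 _ _ h) _ := QP n in h y)).
have secM n y : M (n + e2)%N (sec n y) by rewrite /sec; case: cid2.
have secQ n y : Q n (sec n y) = y by rewrite /sec; case: cid2.
have QL n : lin_on (M (n + e2)%N) (Q n) by case: (QP n) => -[].
have QK n v : M (n + e2)%N v -> (Q n v = 0 <-> U (n + e2)%N v) by case: (QP n) => -[_ h _] _; apply: h.
have Qx n v m : M (n + e2)%N m -> M (n + e2).+1 v -> U (n + e2).+1 (v - X s m) ->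
   Q n.+1 v = Q n m by case: (QP n) => _; apply.
have QXs n m : M (n + e2)%N m -> Q n.+1 (X s m) = Q n m.
  move=> Mm; apply: Qx => //; first exact: MX.
  by rewrite subrr; case: (sUe (n + e2).+1).
have QN i : exists N : 'M[k]_c, forall m, M e2 m -> Q 1%N (X i m) = Q 0%N m *m N.
  have QLX : lin_on (M e2) (fun m => Q 1%N (X i m)).
    by move=> b u v Mu Mv; rewrite linearP (QL 1%N) //; apply: MX.
  pose h y := Q 1%N (X i (sec 0%N y)).
  have hE m : M e2 m -> Q 1%N (X i m) = h (Q 0%N m).
    move=> Mm; rewrite /h; have Ms' := secM 0%N (Q 0%N m).
    have : U e2 (m - sec 0%N (Q 0%N m)).
      apply/(QK 0%N); first exact: lsubB.
      by rewrite addrC -scaleN1r (QL 0%N) // secQ scaleN1r addNr.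
    move=> /(UX i) Uv.
    have Mv : M (1 + e2)%N (X i (m - sec 0%N (Q 0%N m))) by apply: UM.
    have H : Q 1%N (X i (m - sec 0%N (Q 0%N m))) = 0 by apply/(QK 1%N).
    rewrite -(subrK (X i (sec 0%N (Q 0%N m))) (X i m)) -raddfB.
    rewrite (lin_onD (QL 1%N)) ?H ?add0r //; exact: (MX _ Ms').
  have hL : linear h.
    move=> b u v; set m := b *: sec 0%N u + sec 0%N v.
    have Mm : M e2 m by case: (Ms e2) => _; apply; apply: (secM 0%N).
    have -> : b *: u + v = Q 0%N m by rewrite (QL 0%N) ?secQ //; apply: (secM 0%N).
    by rewrite -(hE m Mm) QLX //; apply: (secM 0%N).
  pose H : {linear 'rV[k]_c -> 'rV[k]_c} := HB.pack h (GRing.isLinear.Build _ _ _ _ h hL).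
  exists (lin1_mx H) => m Mm; rewrite hE // -[h _]/(H _).
  by rewrite mul_rV_lin1.
have /choice[N N0] := QN.
have NP n i m : M (n + e2)%N m -> Q n.+1 (X i m) = Q n m *m N i.
  elim: n i m => [|n IH] i m Mm; first exact: N0.
  rewrite addSn in Mm.
  have [Ml Ul] := liftP (_, m) (leq_addl n e2) Mm.
  set l := lift _ in Ml Ul.
  rewrite (Qx n m l) // (Qx n.+1 (X i m) (X i l)) ?addSn; first exact: IH.
  - exact: MX.
  - by do 1!apply: MX.
  - by rewrite XC -raddfB; apply: UX.
have NC i j : N i *m N j = N j *m N i.
  apply/row_matrixP=> a; rewrite !rowE -(secQ 0%N (delta_mx 0 a)) !mulmxA.
  set m := sec _ _; have Mm : M e2 m by apply: (secM 0%N).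
  have E b b' : Q 2%N (X b' (X b m)) = Q 0%N m *m N b *m N b'.
    by rewrite (NP 1%N) ?(NP 0%N) //; exact: MX.
  by rewrite -!E XC.
have c0 : (0 < c)%N.
  rewrite lt0n; apply/negP => /eqP c0.
  have qe e : (e2 <= e)%N -> q e = 0%N.
    by move=> /subnK <-; elim: (e - e2)%N => //= j <-; rewrite addSn q2 // leq_addl.
  have [e le []] := io e2; apply: dm_eq => //; first exact: UM.
  by move: (qe e le) (dUM e); rewrite /q; lia.
have [a [z [z0 az]]] := common_eigencol c0 NC.
exists a; split.
  (* As X_s acts by the identity matrix, a_s = 0 would give z = 0. *)
  exists s; apply/eqP => as0; move: (az s); rewrite as0 scale0r => Nz.
  case/eqP: z0; rewrite -[z]mul1mx.
  rewrite -[RHS]Nz; congr (_ *m _); symmetry; apply/row_matrixP=> b.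
  rewrite !rowE mulmx1 -{1}(secQ 0%N (delta_mx 0 b)) -N0; last exact: (secM 0%N).
  by rewrite QXs ?secQ //; exact: (secM 0%N).
exists (fun e v => (Q (e - e2)%N v *m z) 0 0), e2 => e le.
rewrite (_ : e = e - e2 + e2)%N; last by rewrite subnK.
rewrite addnK -addSn addnK; move: (e - e2)%N => n {e le}; split.
- by move=> b u v Mu Mv; rewrite QL // mulmxDl -scalemxAl !mxE.
- by move=> v Uv; rewrite (proj2 (QK _ _ (UM _ _ Uv)) Uv) mul0mx mxE.
- have [i zi] : exists i, z i 0 != 0.
    apply/existsP; apply: contraNT z0; rewrite negb_exists => /forallP z0.
    by apply/eqP/colP => i; rewrite mxE; apply/eqP; have := z0 i; rewrite negbK.
  exists (sec n (delta_mx 0 i)); first exact: secM.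
  by rewrite secQ -rowE mxE.
- by move=> i v Mv; rewrite NP // -mulmxA az -scalemxAr mxE.
Qed.

(** Variables are dropped from the end as long as M/(U + X_s M) stays nonzero in arbitrarily large
    degrees. At the first one for which this fails, X_s is eventually onto modulo [U]. Some variable
    must fail, since M/(X_0 M + ... + X_(r-1) M) vanishes in large degrees. *)
Lemma point U : gsub U -> (forall e v, U e v -> M e v) -> gclosed X U ->
  (forall e1, exists2 e, (e1 <= e)%N & ~ (forall v, M e v -> U e v)) ->
  exists a, (exists i, a i != 0) /\ exists f e1, point_functional U a f e1.
Proof.
move=> sU UM UX io.
suff /(_ r (leqnn r) U) : forall s, (s <= r)%N -> forall U : nat -> V -> Prop,
    gsub U -> (forall e v, U e v -> M e v) -> gclosed X U -> contains_tail X M s U ->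
    (forall e1, exists2 e, (e1 <= e)%N & ~ (forall v, M e v -> U e v)) ->
    exists a, (exists i, a i != 0) /\ exists f e1, point_functional U a f e1.
  apply=> // e w wM; rewrite big_pred0; first by case: (sU e.+1).
  by move=> i; rewrite leqNgt ltn_ord.
elim=> [|s IH] sr {sU UM UX io}U sU UM UX Ut io.
  have [[|e] le []] := io e0.+1; first by [].
  by move=> v /(Mgen le)[w wM ->]; apply: Ut.
pose os := Ordinal sr.
have sUe e : lsub (U e) by apply: sU.
pose U' e v := M e v /\ exists2 y, xmul M (X os) e y & U e (v - y).
have UU' e v : U e v -> U' e v.
  move=> Uv; split; first exact: UM.
  exists 0; last by rewrite subr0.
  by case: e Uv => //= e _; exists 0; [case: (Ms e)|rewrite linear0].
have sU' : gsub U'.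
  move=> e; split; first by apply: UU'; case: (sUe e).
  move=> c u v [Mu [y yx yU]] [Mv [z zx zU]]; split; first by case: (Ms e) => _; apply.
  exists (c *: y + z).
    case: e {Mu Mv yU zU} yx zx => [|e] /=; first by move=> -> ->; rewrite scaler0 addr0.
    move=> [m mM ->] [m' mM' ->]; exists (c *: m + m'); last by rewrite linearP.
    by case: (Ms e) => _; apply.
  have -> : c *: u + v - (c *: y + z) = c *: (u - y) + (v - z).
    by rewrite scalerBr opprD addrACA.
  by case: (sUe e) => _; apply.
have UX' : gclosed X U'.
  move=> i e v [Mv [y yx yU]]; split; first exact: MX.
  exists (X i y); last by rewrite -raddfB; apply: UX.
  case: e {Mv yU} yx => [->|e [m mM ->]] /=.
    by exists 0; [case: (Ms 0%N)|rewrite !linear0].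
  by exists (X i m); [apply: MX|rewrite XC].
have [io'|nio'] := pselect (forall e1, exists2 e, (e1 <= e)%N & ~ (forall v, M e v -> U' e v)).
  have [||a [a0 [f [e1 fP]]]] := IH (ltnW sr) U' sU' _ UX' _ io'.
  - by move=> e v [].
  - move=> e w wM; split; first by apply: lsub_sum => // i _; apply: MX.
    exists (X os (w os)); first by exists (w os).
    rewrite (bigD1 os) //= addrAC subrr add0r.
    rewrite (eq_bigl (fun i : 'I_r => (s < i)%N)); first exact: Ut.
    by move=> i; rewrite -val_eqE /= ltn_neqAle eq_sym andbC.
  - exists a; split=> //; exists f, e1 => e /fP[fL f0 fN fX]; split=> // v Uv.
    by apply: f0; apply: UU'.
apply: (@point_stable os) => //.
move/existsNP: nio' => [e1 He]; exists e1 => e le v Mv.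
have [_ [y [m mM ->] yU]] : U' e.+1 v; last by exists m.
apply: contrapT => nU'; apply: He; exists e.+1; first exact: leqW.
by move=> H; apply: nU'; apply: H.
Qed.
End Point.

(** * Homogeneous polynomials and tensors *)

Section Homog.
Variables (k : fieldType) (r : nat).
Local Notation R := {mpoly k[r]}.
Definition hom (d : nat) (p : R) : Prop := p \is d.-homog.

Lemma hom0 d : hom d 0. Proof. exact: dhomog0. Qed.

Lemma homZ d c p : hom d p -> hom d (c *: p).
Proof. by move=> hp; apply: rpredZ. Qed.

Lemma homD d p q : hom d p -> hom d q -> hom d (p + q).
Proof. by move=> hp hq; apply: rpredD. Qed.

Lemma homN d p : hom d p -> hom d (- p).
Proof. by move=> hp; rewrite -scaleN1r; apply: homZ. Qed.

Lemma homM d e p q : hom d p -> hom e q -> hom (d + e)%N (p * q).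
Proof. exact: dhomogM. Qed.

Lemma hom_sum d (I : Type) (s : seq I) (C : pred I) F :
  (forall i, C i -> hom d (F i)) -> hom d (\sum_(i <- s | C i) F i).
Proof. by move=> H; apply: rpred_sum. Qed.

Lemma homX i : hom 1 'X_i.
Proof. by rewrite /hom dhomogX /= mdeg1. Qed.

Lemma homog_split d p : hom d.+1 p ->
  exists2 q : 'I_r -> R, forall i, hom d (q i) & p = \sum_i 'X_i * q i.
Proof.
move=> hp.
have /choice[c cP] : forall m : 'X_{1..r}, exists c : option 'I_r, mdeg m = d.+1 ->
    exists2 i, c = Some i & (0 < m i)%N.
  move=> m; have [/existsP[i mi]|] := boolP [exists i : 'I_r, (0 < m i)%N].
    by exists (Some i) => _; exists i.
  rewrite negb_exists => /forallP m0; exists None => dm0.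
  move: dm0; rewrite mdegE big1 // => i _.
  by apply/eqP; have := m0 i; rewrite lt0n negbK.
exists (fun i => \sum_(m <- msupp p | c m == Some i) p@_m *: 'X_[m - U_(i)]).
  move=> i; rewrite big_seq_cond; apply: hom_sum => m /andP[/(dhomogP _ _ _ hp) /= dm /eqP cm].
  apply: homZ; rewrite /hom dhomogX /=.
  have [i' ci mi] := cP m dm.
  have ii : i' = i by move: ci; rewrite cm => -[].
  rewrite ii in mi.
  have mE : m = (m - U_(i) + U_(i))%MM.
    apply/mnmP => j; rewrite mnmDE mnmBE mnm1E.
    by case: eqP => [<-|_]; rewrite ?addn0 ?subn0 // subnK.
  by move: dm; rewrite {1}mE mdegD mdeg1 addn1 => -[->].
rewrite {1}[p]mpolyE.
under [RHS]eq_bigr do rewrite mulr_sumr.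
rewrite (exchange_big_dep xpredT) //=.
rewrite [LHS]big_seq_cond [RHS]big_seq_cond.
apply: eq_bigr => m /andP[/(dhomogP _ _ _ hp) /= dm _].
have [i ci mi] := cP m dm.
rewrite (big_pred1 i) => [|j]; last by rewrite /= ci eq_sym; apply/eqP/eqP => [[]|->].
rewrite -scalerAr -mpolyXD; congr (_ *: 'X_[_]).
apply/mnmP => j; rewrite mnmDE mnmBE mnm1E.
by case: eqP => [<-|_]; rewrite ?add0n ?subn0 // addnC subnK.
Qed.

Lemma hom_ind d (P : R -> Prop) : P 0 ->
  (forall p q, hom d p -> hom d q -> P p -> P q -> P (p + q)) ->
  (forall c m, mdeg m = d -> P (c *: 'X_[m])) -> forall p, hom d p -> P p.
Proof.
move=> P0 PD PX p hp; rewrite [p]mpolyE big_seq.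
suff [] : hom d (\sum_(m <- msupp p | m \in msupp p) p@_m *: 'X_[m]) /\
          P (\sum_(m <- msupp p | m \in msupp p) p@_m *: 'X_[m]) by [].
elim/big_rec: _ => [|m x /(dhomogP _ _ _ hp) /= dm [hx Px]]; first by split=> //; apply: hom0.
have hm : hom d (p@_m *: 'X_[m]) by apply: homZ; rewrite /hom dhomogX /= dm.
by split; [apply: homD|apply: PD => //; apply: PX].
Qed.

End Homog.


Section Tensor.
Variables (k : fieldType) (r : nat).
Local Notation R := {mpoly k[r]}.
Definition vec (I : finType) := {ffun I -> R^o}.
HB.instance Definition _ I := GRing.Lmodule.on (vec I).
(** Read through [ev], these are the n-linear forms on the free module R^I. *)
Definition tens n (I : finType) := {ffun {ffun 'I_n -> I} -> R}.
HB.instance Definition _ n I := GRing.Lmodule.on (tens n I).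

Definition dl (I : finType) (j : I) : vec I := [ffun i => (i == j)%:R].

Lemma vecE (I : finType) (v : vec I) : v = \sum_j v j *: dl j.
Proof.
apply/ffunP=> i; rewrite sum_ffunE (bigD1 i) //= big1 ?addr0.
  by rewrite !ffunE eqxx [RHS]mulr1.
by move=> j ji; rewrite !ffunE eq_sym (negPf ji) [LHS]mulr0.
Qed.

Section Ev.
Variables (n : nat) (I : finType).
Implicit Types (t u : tens n I) (Y : 'I_n -> vec I).

Definition ev t Y : R := \sum_f t f * \prod_i Y i (f i).

Lemma evD t u Y : ev (t + u) Y = ev t Y + ev u Y.
Proof. by rewrite -big_split; apply: eq_bigr => f _; rewrite ffunE mulrDl. Qed.

Lemma evZ c t Y : ev (c *: t) Y = c *: ev t Y.
Proof. by rewrite scaler_sumr; apply: eq_bigr => f _; rewrite ffunE scalerAl. Qed.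

Lemma ev0 Y : ev 0 Y = 0.
Proof. by apply: big1 => f _; rewrite ffunE mul0r. Qed.

Lemma evN t Y : ev (- t) Y = - ev t Y.
Proof. by rewrite -scaleN1r evZ scaleN1r. Qed.

Definition pmul (p : R) t : tens n I := [ffun f => p * t f].

Lemma ev_pmul p t Y : ev (pmul p t) Y = p * ev t Y.
Proof. by rewrite mulr_sumr; apply: eq_bigr => f _; rewrite ffunE mulrA. Qed.

Lemma ev_dl t (f : {ffun 'I_n -> I}) : ev t (fun i => dl (f i)) = t f.
Proof.
rewrite /ev (bigD1 f) //= [X in _ + X]big1 ?addr0 => [|g gf].
  by rewrite big1 ?mulr1 // => i _; rewrite ffunE eqxx.
have [i gi] : exists i, g i != f i.
  by apply/existsP; apply: contraNT gf; rewrite negb_exists => /forallP H;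
     apply/eqP/ffunP => i; apply/eqP; have := H i; rewrite negbK.
by rewrite (bigD1 i) //= ffunE (negPf gi) mul0r mulr0.
Qed.

Lemma tens_ext t u : (forall Y, ev t Y = ev u Y) -> t = u.
Proof. by move=> H; apply/ffunP => f; rewrite -!ev_dl H. Qed.

Lemma ev_split t Y Y' : ev t (fun i => Y i + Y' i) =
  \sum_(S : {set 'I_n}) ev t (fun i => if i \in S then Y' i else Y i).
Proof.
rewrite /ev exchange_big; apply: eq_bigr => f _; rewrite -mulr_sumr; congr (_ * _).
under eq_bigr do rewrite ffunE addrC.
rewrite bigA_distr; apply: eq_big => // S _; apply: eq_bigr => i _.
by case: (i \in S).
Qed.

Lemma ev_scale t (c : 'I_n -> R) Y :
  ev t (fun i => c i *: Y i) = (\prod_i c i) * ev t Y.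
Proof.
rewrite mulr_sumr; apply: eq_bigr => f _.
rewrite mulrCA; congr (_ * _); rewrite -big_split; apply: eq_bigr => i _.
by rewrite ffunE.
Qed.

Lemma ev_zero t Y i : Y i = 0 -> ev t Y = 0.
Proof.
move=> Yi; apply: big1 => f _; rewrite (bigD1 i) //= Yi ffunE mul0r mulr0 //.
Qed.

Lemma eq_ev t Y Y' : (forall i, Y i = Y' i) -> ev t Y = ev t Y'.
Proof. by move=> H; congr ev; apply/funext. Qed.
End Ev.

Definition pull n (I J : finType) (L : vec J -> vec I) (t : tens n I) : tens n J :=
  [ffun f : {ffun 'I_n -> J} => ev t (fun i => L (dl (f i)))].

Lemma ev_pull n (I J : finType) (L : {linear vec J -> vec I}) (t : tens n I) Y :
  ev (pull L t) Y = ev t (fun i => L (Y i)).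
Proof.
rewrite /ev.
transitivity (\sum_(g : {ffun 'I_n -> J}) \sum_f (t f * \prod_i (Y i (g i) * L (dl (g i)) (f i)))).
  apply: eq_bigr => g _; rewrite ffunE mulr_suml; apply: eq_bigr => f _.
  by rewrite -mulrA -big_split /=; congr (_ * _); apply: eq_bigr => i _; rewrite mulrC.
rewrite exchange_big; apply: eq_bigr => f _; rewrite -mulr_sumr; congr (_ * _).
rewrite -(bigA_distr_bigA (fun i j => Y i j * L (dl j) (f i))) /=.
apply: eq_bigr => i _; rewrite [in RHS](vecE (Y i)) linear_sum sum_ffunE.
apply: eq_bigr => j _.
have -> : L (Y i j *: dl j) = Y i j *: L (dl j) by rewrite linearZ.
by rewrite ffunE.
Qed.

Section Pull.
Variables (n : nat) (I J : finType) (L : vec J -> vec I).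
Lemma pullP c (t u : tens n I) : pull L (c *: t + u) = c *: pull L t + pull L u.
Proof. by apply/ffunP=> f; rewrite !ffunE evD evZ. Qed.
Lemma pull_pmul p (t : tens n I) : pull L (pmul p t) = pmul p (pull L t).
Proof. by apply/ffunP=> f; rewrite !ffunE ev_pmul. Qed.
End Pull.

(* Coordinates carry degrees, so that a tensor is homogeneous of degree e when
   its coefficient at f has degree e + the weight of f. *)
Definition thom n (I : finType) (w : I -> nat) e (t : tens n I) : Prop :=
  forall f : {ffun 'I_n -> I}, hom (e + \sum_i w (f i))%N (t f).

(** The first alternative covers entries whose degree d + c - w i would be negative. *)
Definition vhom (I : finType) (w : I -> nat) d (v : vec I) c :=
  forall i, v i = 0 \/ exists2 e, hom e (v i) & (e + w i = d + c)%N.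

Definition ghom (I J : finType) (wJ : J -> nat) (wI : I -> nat) d (L : vec J -> vec I) :=
  forall j, vhom wI d (L (dl j)) (wJ j).

Lemma thom_ev n (I J : finType) (wJ : J -> nat) (wI : I -> nat) e d (t : tens n I)
   (f : 'I_n -> J) (Y : 'I_n -> vec I) :
  thom wI e t -> (forall i, vhom wI d (Y i) (wJ (f i))) ->
  hom (e + n * d + \sum_i wJ (f i))%N (ev t Y).
Proof.
move=> ht hY; apply: hom_sum => g _.
have [/existsP[i /eqP Y0]|] := boolP [exists i, Y i (g i) == 0].
  by rewrite [X in _ * X](bigD1 i) //= Y0 mul0r mulr0; apply: hom0.
rewrite negb_exists => /forallP Y0.
have /choice[c cP] : forall i, exists c, hom c (Y i (g i)) /\ (c + wI (g i) = d + wJ (f i))%N.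
  by move=> i; case: (hY i (g i)) => [E|[c ? ?]]; [move: (Y0 i); rewrite E eqxx|exists c].
have -> : (e + n * d + \sum_i wJ (f i) = e + \sum_i wI (g i) + \sum_i c i)%N.
  have : (\sum_(i < n) (c i + wI (g i)) = \sum_(i < n) (d + wJ (f i)))%N.
    by apply: eq_bigr => i _; case: (cP i).
  rewrite !big_split /= sum_nat_const card_ord; lia.
apply: homM; first exact: ht.
rewrite /hom; elim/big_rec2: _ => [|i a b _ IH]; first exact: dhomog1.
by apply: homM => //; case: (cP i).
Qed.

Lemma thom_pull n (I J : finType) (wJ : J -> nat) (wI : I -> nat) e d (t : tens n I) L :
  thom wI e t -> ghom wJ wI d L -> thom wJ (e + n * d)%N (pull L t).
Proof.
move=> ht hL f; rewrite ffunE; apply: (thom_ev (wI := wI)) => // i; exact: hL.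
Qed.

Lemma thom_pmul n (I : finType) (w : I -> nat) d e p (t : tens n I) :
  hom d p -> thom w e t -> thom w (d + e)%N (pmul p t).
Proof. by move=> hp ht f; rewrite ffunE -addnA; apply: homM. Qed.

Lemma lsub_thom n (I : finType) (w : I -> nat) e : lsub (@thom n I w e).
Proof.
split=> [f|c u v hu hv f]; first by rewrite ffunE; apply: hom0.
by rewrite !ffunE; apply/homD=> //; apply: homZ.
Qed.
End Tensor.

(** * Alternating forms *)

Section Alt.
Variables (k : fieldType) (r : nat).
Local Notation R := {mpoly k[r]}.

Section OneIndex.
Variables (n : nat) (I : finType).
Implicit Types (t u : tens k r n I) (Y : 'I_n -> vec k r I).

(** Vanishing on repeated arguments, since antisymmetry would be too weak in characteristic 2. *)
Definition alt t := forall Y i i', i != i' -> Y i = Y i' -> ev t Y = 0.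

Definition upd Y i (x : vec k r I) : 'I_n -> vec k r I := fun j => if j == i then x else Y j.

Lemma ev_updD t Y i (x y : vec k r I) :
  ev t (upd Y i (x + y)) = ev t (upd Y i x) + ev t (upd Y i y).
Proof.
rewrite -big_split /=; apply: eq_bigr => f _; rewrite -mulrDr; congr (_ * _).
have key z : \prod_j upd Y i z j (f j) = z (f i) * \prod_(j | j != i) Y j (f j).
  rewrite (bigD1 i) //= /upd eqxx; congr (_ * _).
  by apply: eq_bigr => j /negPf ->.
by rewrite !key ffunE mulrDl.
Qed.

Lemma swap_of_alt t i i' Y : i != i' ->
  (forall Z, Z i = Z i' -> ev t Z = 0) ->
  ev t (fun j => Y (tperm i i' j)) = - ev t Y.
Proof.
move=> ii' H.
have ni : (i' == i) = false by rewrite eq_sym; apply/negbTE.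
pose Z a b := upd (upd Y i a) i' b.
have ZD a b c : ev t (Z a (b + c)) = ev t (Z a b) + ev t (Z a c) by apply: ev_updD.
have ZC a b : Z a b = upd (upd Y i' b) i a.
  apply/funext => j; rewrite /Z /upd; case: eqP => [->|//]; by rewrite ni.
have DZ a b c : ev t (Z (a + b) c) = ev t (Z a c) + ev t (Z b c).
  by rewrite !ZC ev_updD.
have Z0 a : ev t (Z a a) = 0.
  by apply: H; rewrite /Z /upd eqxx; case: eqP => // _; rewrite eqxx.
have := Z0 (Y i + Y i'); rewrite ZD !DZ !Z0 add0r addr0 => /eqP.
rewrite addr_eq0 => /eqP E.
have -> : (fun j => Y (tperm i i' j)) = Z (Y i') (Y i).
  apply/funext => j; rewrite /Z /upd; case: tpermP => [->|->|].
  - by rewrite eqxx (negPf ii').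
  - by rewrite eqxx.
  - by move=> /eqP/negPf -> /eqP/negPf ->.
have -> : ev t Y = ev t (Z (Y i) (Y i')).
  apply: eq_ev => j; rewrite /Z /upd; case: eqP => [->//|_]; by case: eqP => [->|].
by rewrite E.
Qed.

Lemma alt_swap t i i' Y : alt t -> i != i' ->
  ev t (fun j => Y (tperm i i' j)) = - ev t Y.
Proof. by move=> at_ ii'; apply: swap_of_alt => // Z; apply: at_. Qed.

(** By the adjacent case, transposing neighbours changes the sign, and such transpositions bring two
    equal arguments together. *)
Lemma alt_adjacent t :
  (forall Y (i i' : 'I_n), i' = i.+1 :> nat -> Y i = Y i' -> ev t Y = 0) -> alt t.
Proof.
move=> H.
suff Hlt Y (i i' : 'I_n) : (i < i')%N -> Y i = Y i' -> ev t Y = 0.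
  move=> Y i i' ii' Yii'; case: (ltngtP i i') => [lt|lt|/val_inj E].
  - exact: (Hlt Y i i').
  - exact: (Hlt Y i' i).
  - by rewrite E eqxx in ii'.
move=> lt; have [d] : exists d, (i' = i.+1 + d :> nat)%N by exists (i' - i.+1)%N; lia.
elim: d Y i' {lt} => [|d IH] Y i' E Yii'; first by apply: (H Y i i'); rewrite // E addn0.
have lt : (i'.-1 < n)%N by have := ltn_ord i'; lia.
pose i2 := Ordinal lt.
have i2i' : i2 != i' by rewrite -val_eqE /=; lia.
have E2 : (i2 = i.+1 + d :> nat)%N by rewrite /=; lia.
have := @swap_of_alt t i2 i' Y i2i'.
rewrite (IH _ i2) //; last first.
  rewrite tpermL tpermD //; last by rewrite -val_eqE /= E; lia.
  by rewrite -val_eqE /=; lia.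
move=> S; apply/eqP; rewrite -oppr_eq0; apply/eqP; symmetry; apply: S => Z.
by apply: H; rewrite -[X in _ = X.+1]/(i'.-1); lia.
Qed.

Definition fperm (f : {ffun 'I_n -> I}) i i' : {ffun 'I_n -> I} := [ffun l => f (tperm i i' l)].

Lemma alt_coefP t : alt t <-> forall (f : {ffun 'I_n -> I}) i i', i != i' ->
  (f i = f i' -> t f = 0) /\ t (fperm f i i') = - t f.
Proof.
split=> [at_ f i i' ii'|H].
  split=> [fii'|]; first by rewrite -ev_dl; apply: (at_ _ i i'); rewrite // fii'.
  rewrite -[t f]ev_dl -(alt_swap _ at_ ii') -[LHS]ev_dl; apply: eq_ev => j.
  by rewrite ffunE.
move=> Y i i' ii' Yii'.
pose F f := t f * \prod_l Y l (f l).
have FK : cancel (fun f => fperm f i i') (fun f => fperm f i i').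
  move=> f.
  suff: fperm (fperm f i i') i i' = f by [].
  by apply/ffunP => l; rewrite !ffunE tpermK.
have Ff f : F (fperm f i i') = - F f.
  rewrite /F (proj2 (H f i i' ii')) mulNr; congr (- (_ * _)).
  rewrite (reindex_inj (@perm_inj _ (tperm i i'))) /=.
  apply: eq_bigr => l _; rewrite ffunE tpermK.
  have -> : Y (tperm i i' l) = Y l by case: tpermP => [->|->|].
  by [].
rewrite -[ev t Y]/(\sum_f F f).
(* The arguments at i and i' are equal, so the terms with f i before f i' cancel those with f i
   after f i', and the terms with f i = f i' vanish. *)
rewrite (bigID (fun f : {ffun 'I_n -> I} => (enum_rank (f i) < enum_rank (f i'))%N)) /=.
rewrite [X in _ + X](bigID (fun f : {ffun 'I_n -> I} => (enum_rank (f i') < enum_rank (f i))%N)) /=.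
rewrite [X in _ + (_ + X)]big1 ?addr0; last first.
  move=> f; rewrite -!leqNgt => /andP[l1 l2].
  rewrite /F (proj1 (H f i i' ii')) ?mul0r //.
  by apply/enum_rank_inj/val_inj/eqP; rewrite eqn_leq l1 l2.
rewrite [X in _ + X](reindex_inj (can_inj FK)) /=.
rewrite -[X in X + _]opprK -sumrN.
under [X in - X + _]eq_bigr do rewrite -Ff.
rewrite addrC; apply/eqP; rewrite subr_eq0; apply/eqP.
by apply: eq_bigl => f; rewrite !ffunE tpermL tpermR; lia.
Qed.

Lemma lsub_alt : lsub alt.
Proof.
split=> [Y i i' _ _|c u v hu hv Y i i' ii' Yi]; first exact: ev0.
by rewrite evD evZ (hu _ i i') // (hv _ i i') // scaler0 addr0.
Qed.

Lemma alt_pmul p t : alt t -> alt (pmul p t).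
Proof. by move=> at_ Y i i' ii' Yi; rewrite ev_pmul (at_ _ i i') // mulr0. Qed.

End OneIndex.

Lemma alt_pull n (I J : finType) (L : {linear vec k r J -> vec k r I}) (t : tens k r n I) :
  alt t -> alt (pull L t).
Proof.
by move=> at_ Y i i' ii' Yi; rewrite ev_pull (at_ _ i i') // Yi.
Qed.

Section Sum.
Variables (n : nat) (I : finType).
Local Notation vecI := (vec k r I).
Local Notation vecII := (vec k r (I + I)%type).

Definition inL (v : vecI) : vecII := [ffun x => if x is inl i then v i else 0].
Definition inR (v : vecI) : vecII := [ffun x => if x is inr i then v i else 0].

Definition arg (S : {set 'I_n}) (u v : 'I_n -> vecI) : 'I_n -> vecII :=
  fun i => if i \in S then inR (v i) else inL (u i).

Definition is_inr (x : I + I) := if x is inr _ then true else false.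

(** The part with exactly [j] arguments in the second copy. It plays the role of the summand of
    Alt^n(H + H) that is Alt^(n-j)(H) tensor Alt^j(H), so that no tensor product of forms is
    formed. *)
Definition comp j (t : tens k r n (I + I)%type) : tens k r n (I + I)%type :=
  [ffun f : {ffun 'I_n -> (I + I)%type} =>
     if #|[set i | is_inr (f i)]| == j then t f else 0].

Lemma ev_comp j t S u v :
  ev (comp j t) (arg S u v) = if #|S| == j then ev t (arg S u v) else 0.
Proof.
have key (f : {ffun 'I_n -> (I + I)%type}) : [set i | is_inr (f i)] != S -> \prod_i arg S u v i (f i) = 0.
  move=> nS; have [i] : exists i, is_inr (f i) != (i \in S).
    apply/existsP; apply: contraNT nS; rewrite negb_exists => /forallP H.
    by apply/eqP/setP => i; rewrite inE; apply/eqP; have := H i; rewrite negbK.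
  rewrite (bigD1 i) //= /arg.
  by case: (i \in S); case: (f i) => x //= _; rewrite ffunE mul0r.
case: eqP => [Sj|nSj].
  apply: eq_bigr => f _; rewrite ffunE.
  have [/eqP SE|/key ->] := boolP ([set i | is_inr (f i)] == S); last by rewrite !mulr0.
  by rewrite SE Sj eqxx.
apply: big1 => f _; rewrite ffunE.
have [/eqP SE|/key ->] := boolP ([set i | is_inr (f i)] == S); last by rewrite mulr0.
by rewrite SE; case: eqP => //; rewrite mul0r.
Qed.

Lemma comp_alt j t : alt t -> alt (comp j t).
Proof.
move=> /alt_coefP H; apply/alt_coefP => f i i' ii'; rewrite !ffunE.
have [H1 H2] := H f i i' ii'.
have -> : #|[set l | is_inr (fperm f i i' l)]| = #|[set l | is_inr (f l)]|.
  rewrite -[RHS](card_preimset _ (@perm_inj _ (tperm i i'))); apply: eq_card => l.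
  by rewrite !inE ffunE.
by case: eqP => _; split=> //; rewrite oppr0.
Qed.

Lemma compP j c t u : comp j (c *: t + u) = c *: comp j t + comp j u.
Proof. by apply/ffunP => f; rewrite !ffunE; case: ifP => _; rewrite ?scaler0 ?addr0. Qed.

Lemma comp_pmul j p t : comp j (pmul p t) = pmul p (comp j t).
Proof. by apply/ffunP => f; rewrite !ffunE; case: ifP => _; rewrite ?mulr0. Qed.

Lemma thom_comp j w e t : thom w e t -> thom w e (comp j t).
Proof. by move=> ht f; rewrite ffunE; case: ifP => _ //; apply: hom0. Qed.

End Sum.

Section Fd.
Variables (n : nat) (I : finType) (w : I -> nat).

Lemma fd_image (vT : vectType k) (V : lmodType k) (f : {linear vT -> V}) (P : V -> Prop) :
  lsub P -> (forall v, P v -> exists x, f x = v) -> fd P.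
Proof.
move=> sP Pf.
have [|W WP] := @lsub_vspace _ _ (fun x => P (f x)).
  split; first by rewrite linear0; case: sP.
  by move=> c u v Pu Pv; rewrite linearP; case: sP => _; apply.
have [|K KP] := @lsub_vspace _ _ (fun x => f x = 0).
  split; first by rewrite linear0.
  by move=> c u v fu fv; rewrite linearP fu fv scaler0 addr0.
exists (\dim (W :\: K)); apply: (dimP_vspace (f := f)).
  move=> x xW /KP xK; apply/eqP; rewrite -memv0.
  have : x \in ((W :\: K) :&: K)%VS by rewrite memv_cap xW.
  by rewrite capv_diff.
move=> v; split=> [Pv|[x /(subvP (diffvSl _ _)) /WP Px <-] //].
have [x fx] := Pf v Pv.
have : x \in ((W :\: K) + (W :&: K))%VS.
  by rewrite addv_diff_cap; apply/WP; rewrite fx.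
move=> /memv_addP[y yW [z]]; rewrite memv_cap => /andP[_ /KP fz] xE.
by exists y => //; rewrite -fx xE linearD fz addr0.
Qed.

Lemma fd_thom e : fd (@thom k r n I w e).
Proof.
pose D := \max_(f : {ffun 'I_n -> I}) (e + \sum_i w (f i))%N.
pose T := ({ffun 'I_n -> I} * 'X_{1..r < D.+1})%type.
pose F (x : {ffun T -> k^o}) : tens k r n I :=
  [ffun f => \sum_(m : 'X_{1..r < D.+1}) x (f, m) *: 'X_[m]].
have Fl : linear F.
  move=> c x y; apply/ffunP => f; rewrite !ffunE scaler_sumr -big_split /=.
  by apply: eq_bigr => m _; rewrite !ffunE scalerDl scalerA.
apply: (@fd_image {ffun T -> k^o} _ (HB.pack F (GRing.isLinear.Build _ _ _ _ F Fl))).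
  exact: lsub_thom.
move=> t ht; exists [ffun fm : T => (t fm.1)@_(bmnm fm.2)]; apply/ffunP => f; rewrite ffunE.
rewrite [RHS](@mpolywE _ _ D.+1); first by apply: eq_bigr => m _; rewrite ffunE.
rewrite mmeasureE; apply/bigmax_leqP_seq => m + _ => /(dhomogP _ _ _ (ht f)) /= ->; rewrite ltnS.
exact: (leq_bigmax f).
Qed.

Definition mulX (i : 'I_r) (t : tens k r n I) : tens k r n I := pmul 'X_i t.
Lemma mulX_linear i : linear (mulX i).
Proof. by move=> c t u; apply/ffunP => f; rewrite !ffunE mulrDr scalerAr. Qed.
HB.instance Definition _ i := GRing.isLinear.Build _ _ _ _ (mulX i) (mulX_linear i).

Lemma mulXC i j t : mulX i (mulX j t) = mulX j (mulX i t).
Proof. by apply/ffunP => f; rewrite !ffunE mulrCA. Qed.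

Lemma thom_mulX : gclosed (fun i => mulX i) (@thom k r n I w).
Proof. by move=> i e t ht; rewrite -add1n; apply: thom_pmul => //; apply: homX. Qed.

Lemma thom_gen : generated_from (fun i => mulX i) (@thom k r n I w) 0.
Proof.
move=> e _ t ht.
have /choice[q qP] : forall f : {ffun 'I_n -> I}, exists q : 'I_r -> R, (forall i, hom (e + \sum_i w (f i)) (q i)) /\ t f = \sum_i 'X_i * q i.
  by move=> f; have := ht f; rewrite addSn => /homog_split[q hq E]; exists q.
exists (fun i => [ffun f : {ffun 'I_n -> I} => q f i]); first by move=> i f; rewrite ffunE; case: (qP f).
apply/ffunP => f; rewrite sum_ffunE (proj2 (qP f)); apply: eq_bigr => i _.
by rewrite !ffunE.
Qed.
End Fd.
End Alt.

Section Families.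
Variables (k : closedFieldType) (r : nat).
Local Notation R := {mpoly k[r]}.

Section Fam.
Variables (n : nat) (I : finType) (w : I -> nat) (S : ('I_n -> vec k r I) -> Prop).

Definition van (t : tens k r n I) := forall Y, S Y -> ev t Y = 0.

(** A module of alternating forms is encoded by a set of argument tuples on which its elements
    vanish; a larger set gives a smaller module. *)
Definition fam e (t : tens k r n I) := [/\ thom w e t, alt t & van t].

Lemma fam_lsub e : lsub (fam e).
Proof.
split; first by split; [case: (lsub_thom k r n w e)|case: (lsub_alt k r n I)|move=> Y _; apply: ev0].
move=> c t u [ht at_ vt] [hu au vu]; split.
- by case: (lsub_thom k r n w e) => _; apply.
- by case: (lsub_alt k r n I) => _; apply.
- by move=> Y SY; rewrite evD evZ vt // vu // scaler0 addr0.
Qed.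

Lemma fam_fd e : fd (fam e).
Proof. by apply: (fd_sub (fd_thom k r n w e) (fam_lsub e)) => t []. Qed.

Lemma fam_pmul d e p t : hom d p -> fam e t -> fam (d + e) (pmul p t).
Proof.
move=> hp [ht at_ vt]; split; [exact: thom_pmul|exact: alt_pmul|].
by move=> Y SY; rewrite ev_pmul vt // mulr0.
Qed.

Lemma fam_mulX : gclosed (fun i => @mulX k r n I i) fam.
Proof. by move=> i e t; rewrite -add1n; apply: fam_pmul; apply: homX. Qed.

Lemma fam_gen : exists e0, generated_from (fun i => @mulX k r n I i) fam e0.
Proof.
apply: (@noetherian _ _ _ _ (@mulXC k r n I) _ (fd_thom k r n w) (@thom_mulX k r n I w)
  _ (@thom_gen k r n I w)); first exact: fam_lsub.
  by move=> e t [].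
exact: fam_mulX.
Qed.

Lemma point_pmul (U : nat -> tens k r n I -> Prop) a f e1 d p :
  point_functional (fun i => @mulX k r n I i) fam U a f e1 ->
  hom d p -> forall e t, (e1 <= e)%N -> fam e t ->
  f (d + e)%N (pmul p t) = p.@[a] * f e t.
Proof.
move=> pf hp e t le ft.
have fL e' : (e1 <= e')%N -> lin_on (fam e') (f e' : _ -> k^o) by move=> /pf[].
have led : (e1 <= d + e)%N by apply: leq_trans le (leq_addl _ _).
have f0 : f (d + e)%N 0 = 0 by apply: (lin_on0 (fam_lsub _) (fL _ led)).
apply: (@hom_ind k r d (fun p => f (d + e)%N (pmul p t) = p.@[a] * f e t) _ _ _ p hp)
  => {p hp} [|p q hp hq IHp IHq|c m dm].
- rewrite meval0 mul0r -[RHS]f0; congr (f _ _).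
  by apply/ffunP => g; rewrite !ffunE mul0r.
- rewrite mevalD mulrDl -IHp -IHq.
  have -> : pmul (p + q) t = pmul p t + pmul q t.
    by apply/ffunP => g; rewrite !ffunE mulrDl.
  by apply: (lin_onD (fL _ led)); apply: fam_pmul.
have -> : pmul (c *: 'X_[m]) t = c *: pmul 'X_[m] t + 0.
  by rewrite addr0; apply/ffunP => g; rewrite !ffunE scalerAl.
rewrite fL //; last 2 first.
- by apply: fam_pmul => //; rewrite /hom dhomogX /= dm.
- by case: (fam_lsub (d + e)).
rewrite f0 addr0 mevalZ -mulrA; congr (_ * _).
elim: d m dm led {fL f0} => [|d IH] m dm led.
  have -> : m = 0%MM by apply/eqP; rewrite -mdeg_eq0 dm.
  rewrite mpolyX0 meval1 mul1r; congr (f _ _).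
  by apply/ffunP => g; rewrite !ffunE mul1r.
have [i mi] : exists i, (0 < m i)%N.
  apply/existsP; apply: contraPT (dm); rewrite negb_exists => /forallP m0.
  rewrite mdegE big1 // => i _; apply/eqP; have := m0 i; by rewrite lt0n negbK.
have mE : m = (U_(i) + (m - U_(i)))%MM.
  apply/mnmP => j; rewrite mnmDE mnmBE mnm1E.
  by case: eqP => [<-|_]; rewrite ?subn0 ?add0n // addnC subnK.
have dm' : mdeg (m - U_(i)) = d by move: dm; rewrite {1}mE mdegD mdeg1 add1n => -[->].
rewrite mE mpolyXD mevalM mevalXU -mulrA -IH //; last exact: leq_trans le (leq_addl _ _).
have led' : (e1 <= d + e)%N by apply: leq_trans le (leq_addl _ _).
have [_ _ _ fX] := pf _ led'.
rewrite -fX; last by apply: fam_pmul => //; rewrite /hom dhomogX /= dm'.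
by rewrite addSn; congr (f _ _); apply/ffunP => g; rewrite !ffunE mulrA.
Qed.

(* Otherwise the quotient has a point in its support, where p does not vanish. *)
Lemma eventually_full (U : nat -> tens k r n I -> Prop) :
  gsub U -> (forall e t, U e t -> fam e t) -> gclosed (fun i => @mulX k r n I i) U ->
  (forall a : 'I_r -> k, (exists i, a i != 0) -> exists d p, [/\ hom d p, p.@[a] != 0 &
     forall e t, fam e t -> U (d + e)%N (pmul p t)]) ->
  exists e0, forall e, (e0 <= e)%N -> forall t, fam e t -> U e t.
Proof.
move=> sU UF UX H; apply: contrapT => nex.
have [e0 gen] := fam_gen.
have [|a [a0 [f [e1 pf]]]] := @point _ _ _ _ (@mulXC k r n I) _ fam_fd fam_mulX _ gen U sU UF UX.
  move=> e1; apply: contrapT => ne; apply: nex; exists e1 => e le t ft.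
  by apply: contrapT => nU; apply: ne; exists e => // /(_ t ft).
have [d [p [hp pa HU]]] := H a a0.
have [_ _ [t ft ft0] _] := pf e1 (leqnn _).
have := point_pmul pf hp (leqnn _) ft.
have [_ f0 _ _] := pf (d + e1)%N (leq_addl _ _).
rewrite f0; last exact: HU.
by move/eqP; rewrite eq_sym mulf_eq0 (negPf pa) (negPf ft0).
Qed.
End Fam.

Lemma fam_mono n (I : finType) (w : I -> nat) (S S' : ('I_n -> vec k r I) -> Prop) e t :
  (forall Y, S' Y -> S Y) -> fam w S e t -> fam w S' e t.
Proof. by move=> SS [ht at_ vt]; split=> // Y /SS; apply: vt. Qed.

Lemma ghom_comp (I J K : finType) (wI : I -> nat) (wJ : J -> nat) (wK : K -> nat) d1 d2
    (L1 : {linear vec k r J -> vec k r I}) (L2 : {linear vec k r I -> vec k r K}) :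
  ghom wJ wI d1 L1 -> ghom wI wK d2 L2 -> ghom wJ wK (d1 + d2) (L2 \o L1).
Proof.
move=> h1 h2 j x; rewrite /= (vecE (L1 (dl k r j))) raddf_sum sum_ffunE.
have key i : hom (d1 + d2 + wJ j - wK x)%N ((L1 (dl k r j)) i * L2 (dl k r i) x) /\
   ((L1 (dl k r j)) i * L2 (dl k r i) x != 0 -> (wK x <= d1 + d2 + wJ j)%N).
  case: (h1 j i) => [->|[e1 he1 E1]]; first by rewrite mul0r eqxx; split=> //; apply: hom0.
  case: (h2 i x) => [->|[e2 he2 E2]]; first by rewrite mulr0 eqxx; split=> //; apply: hom0.
  have -> : (d1 + d2 + wJ j - wK x = e1 + e2)%N by lia.
  by split; [apply: homM|lia].
have Ez i : L2 ((L1 (dl k r j)) i *: dl k r i) x = (L1 (dl k r j)) i * L2 (dl k r i) x.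
  by rewrite linearZ ffunE.
case: (leqP (wK x) (d1 + d2 + wJ j)) => le.
  right; exists (d1 + d2 + wJ j - wK x)%N; last by rewrite subnK.
  by apply: hom_sum => i _; rewrite Ez; case: (key i).
left; apply: big1 => i _; rewrite Ez; apply/eqP; apply: contraTT le => /(proj2 (key i)).
by rewrite -leqNgt.
Qed.
End Families.

(** * Square-zero operators and Hilbert functions *)

Section Star.
Variables (k : closedFieldType) (r n : nat) (I : finType) (w : I -> nat).
Local Notation R := {mpoly k[r]}.
Local Notation vecI := (vec k r I).
Local Notation vecII := (vec k r (I + I)%type).

Definition w2 (x : I + I) := match x with inl i => w i | inr i => w i end.

Definition glue_l (L1 L2 : vecI -> vecI) (x : vecII) : vecI :=
  L1 [ffun i => x (inl i)] + L2 [ffun i => x (inr i)].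

Definition glue_r (L1 L2 : vecI -> vecI) (v : vecI) : vecII := inL (L1 v) + inR (L2 v).

Section Glue.
Variables L1 L2 : {linear vecI -> vecI}.
Lemma glue_l_linear : linear (glue_l L1 L2).
Proof.
move=> c x y; rewrite /glue_l.
have E (g : I -> I + I) : [ffun i => (c *: x + y) (g i)] =
    c *: [ffun i => x (g i)] + [ffun i => y (g i)] :> vecI.
  by apply/ffunP => i; rewrite !ffunE.
by rewrite !E !linearP scalerDr addrACA.
Qed.
HB.instance Definition _ := GRing.isLinear.Build _ _ _ _ (glue_l L1 L2) glue_l_linear.

Lemma glue_r_linear : linear (glue_r L1 L2).
Proof.
move=> c x y; apply/ffunP => -[] i; rewrite !ffunE !linearP !ffunE.
  by rewrite !addr0.
by rewrite !add0r.
Qed.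
HB.instance Definition _ := GRing.isLinear.Build _ _ _ _ (glue_r L1 L2) glue_r_linear.

Lemma glue_l_inL v : glue_l L1 L2 (inL v) = L1 v.
Proof.
rewrite /glue_l.
have -> : [ffun i => inL v (inl i)] = v by apply/ffunP => i; rewrite !ffunE.
have -> : [ffun i => inL v (inr i)] = 0 :> vecI by apply/ffunP => i; rewrite !ffunE.
by rewrite linear0 addr0.
Qed.

Lemma glue_l_inR v : glue_l L1 L2 (inR v) = L2 v.
Proof.
rewrite /glue_l.
have -> : [ffun i => inR v (inr i)] = v by apply/ffunP => i; rewrite !ffunE.
have -> : [ffun i => inR v (inl i)] = 0 :> vecI by apply/ffunP => i; rewrite !ffunE.
by rewrite linear0 add0r.
Qed.

Lemma ghom_glue_l d : ghom w w d L1 -> ghom w w d L2 -> ghom w2 w d (glue_l L1 L2).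
Proof.
move=> h1 h2 [] j.
  have -> : dl k r (inl j) = inL (dl k r j) :> vecII by apply/ffunP => -[] i; rewrite !ffunE.
  by rewrite glue_l_inL; apply: h1.
have -> : dl k r (inr j) = inR (dl k r j) :> vecII by apply/ffunP => -[] i; rewrite !ffunE.
by rewrite glue_l_inR; apply: h2.
Qed.

Lemma ghom_glue_r d : ghom w w d L1 -> ghom w w d L2 -> ghom w w2 d (glue_r L1 L2).
Proof.
move=> h1 h2 j [] i; rewrite !ffunE ?addr0 ?add0r.
  by case: (h1 j i) => [|[e ? ?]]; [left|right; exists e].
by case: (h2 j i) => [|[e ? ?]]; [left|right; exists e].
Qed.

Lemma ev_glue_l j (t : tens k r n I) S (u v : 'I_n -> vecI) :
  ev (comp j (pull (glue_l L1 L2) t)) (arg S u v) =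
  if #|S| == j then ev t (fun i => if i \in S then L2 (v i) else L1 (u i)) else 0.
Proof.
rewrite ev_comp ev_pull; case: eqP => // _; apply: eq_ev => i.
by rewrite /arg; case: (i \in S); [exact: glue_l_inR|exact: glue_l_inL].
Qed.

Lemma ev_glue_r (t : tens k r n (I + I)%type) Y :
  ev (pull (glue_r L1 L2) t) Y = \sum_S ev t (arg S (L1 \o Y) (L2 \o Y)).
Proof.
rewrite ev_pull -[LHS]/(ev t (fun i => inL (L1 (Y i)) + inR (L2 (Y i)))) ev_split.
by apply: eq_bigr => S _; apply: eq_ev.
Qed.
End Glue.

Variables (j : nat) (SV SU : ('I_n -> vecII) -> Prop).
Hypothesis SVU : forall Y, SV Y -> SU Y.

(** The two hypotheses on [f] say that it maps [fam SA] modulo [fam SA'] injectively into [fam SV]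
    modulo [fam SU]. Near each point it is onto up to p^n, one factor p for each argument, hence it
    is onto in large degrees by [eventually_full]. *)
Lemma graded_step (SA SA' : ('I_n -> vecI) -> Prop) (L1 L2 : {linear vecI -> vecI}) :
  ghom w w 0 L1 -> ghom w w 0 L2 -> (forall Y, SA Y -> SA' Y) ->
  let f := fun t : tens k r n I => comp j (pull (glue_l L1 L2) t) in
  (forall t, alt t -> van SA t -> van SV (f t)) ->
  (forall t, alt t -> van SA t -> van SA' t <-> van SU (f t)) ->
  (forall a : 'I_r -> k, (exists i, a i != 0) ->
   exists d p (G1 G2 : {linear vecI -> vecI}), [/\ hom d p, p.@[a] != 0,
     ghom w w d G1 /\ ghom w w d G2 &
     forall t, alt t -> van SV t -> van SA (pull (glue_r G1 G2) t) /\
       van SU (pmul (p ^+ n) t - f (pull (glue_r G1 G2) t))]) ->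
  exists e0, forall e, (e0 <= e)%N ->
  (dm (fam w SA e) + dm (fam w2 SU e) = dm (fam w2 SV e) + dm (fam w SA' e))%N.
Proof.
move=> h1 h2 SAA' f fV fU loc.
have flin c t u : f (c *: t + u) = c *: f t + f u by rewrite /f pullP compP.
have ff e t : thom w e t -> alt t -> thom w2 e (f t) /\ alt (f t).
  move=> ht at_; split; last by apply: comp_alt; apply: alt_pull.
  apply: thom_comp; rewrite -[e]addn0 -(muln0 n); apply: thom_pull ht _.
  exact: ghom_glue_l.
have famf e t : fam w SA e t -> fam w2 SV e (f t).
  by move=> [ht at_ vt]; have [? ?] := ff e t ht at_; split=> //; apply: fV.
pose U e t := fam w2 SV e t /\ exists2 s, fam w SA e s & fam w2 SU e (t - f s).
have sU : gsub U.
  move=> e; split.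
    split; first by case: (fam_lsub w2 SV e).
    exists 0; first by case: (fam_lsub w SA e).
    have -> : f 0 = 0 by have := flin (-1) 0 0; rewrite scaler0 addr0 scaleN1r addNr.
    by rewrite subr0; case: (fam_lsub w2 SU e).
  move=> c t u [Vt [s As Us]] [Vu [s' As' Us']]; split.
    by case: (fam_lsub w2 SV e) => _; apply.
  exists (c *: s + s'); first by case: (fam_lsub w SA e) => _; apply.
  rewrite flin; have -> : c *: t + u - (c *: f s + f s') = c *: (t - f s) + (u - f s').
    by rewrite scalerBr opprD addrACA.
  by case: (fam_lsub w2 SU e) => _; apply.
have UX : gclosed (fun i => @mulX k r n (I + I)%type i) U.
  move=> i e t [Vt [s As Us]]; split; first exact: fam_mulX.
  exists (mulX i s); first exact: fam_mulX.
  have -> : mulX i t - f (mulX i s) = mulX i (t - f s).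
    by rewrite raddfB /= /f /mulX pull_pmul comp_pmul.
  exact: fam_mulX.
have [e0 He0] : exists e0, forall e, (e0 <= e)%N -> forall t, fam w2 SV e t -> U e t.
  apply: (eventually_full sU _ UX); first by move=> e t [].
  move=> a a0; have [d [p [G1 [G2 [hp pa [hG1 hG2] H]]]]] := loc a a0.
  exists (n * d)%N, (p ^+ n); split.
  - by rewrite mulnC; apply: dhomogMn.
  - by rewrite rmorphXn expf_neq0.
  have hpn : hom (n * d)%N (p ^+ n) by rewrite mulnC; apply: dhomogMn.
  move=> e t Vt; split; first exact: fam_pmul.
  have [ht at_ vt] := Vt; have [vA vU] := H t at_ vt.
  have fG : fam w SA (n * d + e)%N (pull (glue_r G1 G2) t).
    split=> //; last exact: alt_pull.
    by rewrite addnC; apply: thom_pull ht _; apply: ghom_glue_r.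
  exists (pull (glue_r G1 G2) t) => //.
  have [hG aG vG] := fG; have [hf af] := ff _ _ hG aG.
  split=> //; first by apply: (lsubB (lsub_thom k r n w2 _)) => //; apply: thom_pmul.
  by apply: (lsubB (lsub_alt k r n _)) => //; apply: alt_pmul.
exists e0 => e le; apply: (@dm_rel _ _ _ _ _ _ _ f).
- exact: fam_fd.
- exact: fam_lsub.
- by move=> t; apply: fam_mono.
- exact: fam_fd.
- exact: fam_lsub.
- by move=> t; apply: fam_mono.
- by move=> c t u _ _; apply: flin.
- exact: famf.
- move=> t [ht at_ vt]; have [hf af] := ff _ _ ht at_; split=> [[_ _ v]|[_ _ v]].
    by split=> //; apply/(fU t at_ vt).
  by split=> //; apply/(fU t at_ vt).
- by move=> t Vt; have [_] := He0 e le t Vt.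
Qed.
End Star.

Section SquareZero.
Variables (k : closedFieldType) (r n : nat) (I : finType) (w : I -> nat).
Local Notation R := {mpoly k[r]}.
Local Notation vecI := (vec k r I).
Local Notation vecII := (vec k r (I + I)%type).
Variable N : {linear vecI -> vecI}.
Hypothesis NN : forall v, N (N v) = 0.
Hypothesis hN : ghom w w 0 N.
Hypothesis hQ : forall a : 'I_r -> k, (exists i, a i != 0) ->
  exists d p (Q : {linear vecI -> vecI}), [/\ hom d p, p.@[a] != 0, ghom w w d Q &
    forall v, N (Q (N v)) = p *: N v].

Let isZ (v : vecI) := N v = 0.
Let isIm (v : vecI) := exists h, v = N h.

Let ZZ c v : isZ v -> isZ (c *: v).
Proof. by rewrite /isZ linearZ /= => ->; rewrite scaler0. Qed.

Let ImZc c v : isIm v -> isIm (c *: v).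
Proof. by move=> [h ->]; exists (c *: h); rewrite linearZ. Qed.

Definition SP j (Y : 'I_n -> vecI) := (exists i, isIm (Y i)) \/
  exists2 S : {set 'I_n}, forall i, i \in S -> isZ (Y i) & (n < #|S| + j)%N.
Definition SR j (Y : 'I_n -> vecI) := (forall i, isZ (Y i)) /\
  exists2 S : {set 'I_n}, forall i, i \in S -> isIm (Y i) & (j <= #|S|)%N.
Definition SU j (Y : 'I_n -> vecII) := exists S u v, Y = arg S u v /\
  (#|S| <> j \/ forall i, i \notin S -> isZ (u i)).
Definition SV j (Y : 'I_n -> vecII) := exists S u v, Y = arg S u v /\
  (#|S| <> j \/ (forall i, i \notin S -> isZ (u i)) /\
   ((exists2 i, i \notin S & isIm (u i)) \/ (exists2 i, i \in S & isZ (v i)))).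

Lemma SVU j Y : SV j Y -> SU j Y.
Proof.
by move=> [S [u [v [-> H]]]]; exists S, u, v; split=> //; case: H => [?|[? _]]; [left|right].
Qed.

Section VanV.
Variables (j : nat) (t : tens k r n (I + I)%type).
Hypothesis vt : van (SV j) t.

Lemma vanV1 (S : {set 'I_n}) u v : #|S| <> j -> ev t (arg S u v) = 0.
Proof. by move=> Sj; apply: vt; exists S, u, v; split=> //; left. Qed.

Lemma vanV2 (S : {set 'I_n}) u v i : (forall i, i \notin S -> isZ (u i)) ->
  i \notin S -> isIm (u i) -> ev t (arg S u v) = 0.
Proof. by move=> Zu iS Iu; apply: vt; exists S, u, v; split=> //; right; split=> //; left; exists i. Qed.

Lemma vanV3 (S : {set 'I_n}) u v i : (forall i, i \notin S -> isZ (u i)) ->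
  i \in S -> isZ (v i) -> ev t (arg S u v) = 0.
Proof. by move=> Zu iS Iu; apply: vt; exists S, u, v; split=> //; right; split=> //; right; exists i. Qed.

Lemma vanVz (S : {set 'I_n}) u v z : (forall i, i \notin S -> isZ (u i)) ->
  (forall i, isZ (z i)) -> ev t (arg S u (fun i => v i + z i)) = ev t (arg S u v).
Proof.
move=> Zu Zz.
have E i : arg S u (fun i => v i + z i) i = arg S u v i + (if i \in S then inR (z i) else 0).
  rewrite /arg; case: (i \in S); last by rewrite addr0.
  by apply/ffunP => -[] x; rewrite !ffunE ?addr0.
rewrite (eq_ev _ E) ev_split (bigD1 set0) //= big1 ?addr0.
  by apply: eq_ev => i; rewrite inE.
move=> T T0; have [TS|/subsetPn[i iT iS]] := boolP (T \subset S).
  have /set0Pn[i iT] := T0.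
  rewrite (_ : ev _ _ = ev t (arg S u (fun l => if l \in T then z l else v l))).
    by apply: (@vanV3 S _ _ i) => //; [apply: (subsetP TS)|rewrite iT].
  apply: eq_ev => l; rewrite /arg; case: ifP => lT; last by case: (l \in S).
  by rewrite (subsetP TS).
by apply: (@ev_zero _ _ _ _ _ _ i); rewrite iT (negPf iS).
Qed.

Lemma ev_arg_scale (S : {set 'I_n}) p u v :
  ev t (arg S (fun i => p *: u i) (fun i => p *: v i)) = p ^+ n * ev t (arg S u v).
Proof.
have E i : arg S (fun i => p *: u i) (fun i => p *: v i) i = p *: arg S u v i.
  by rewrite /arg; case: (i \in S); apply/ffunP => -[] x; rewrite !ffunE ?[RHS]mulr0.
by rewrite (eq_ev _ E) ev_scale prodr_const card_ord.
Qed.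
End VanV.

Let idl : {linear vecI -> vecI} := idfun.
Let hid : ghom w w 0 idl.
Proof.
move=> x i; rewrite ffunE; case: eqP => [->|_]; last by left.
by right; exists 0%N; rewrite ?add0n //; apply: dhomog1.
Qed.

Let scl (p : R) : {linear vecI -> vecI} := *:%R p.
Let hscl d p : hom d p -> ghom w w d (scl p).
Proof.
move=> hp x i; rewrite !ffunE; case: eqP => [->|_]; last by left; apply: mulr0.
by right; exists d; rewrite //= [_ *: _]mulr1.
Qed.

Lemma neq_sets (S T : {set 'I_n}) : #|S| = #|T| -> S != T -> exists2 i, i \in S & i \notin T.
Proof.
move=> ST nST; apply/subsetPn; apply: contraNN nST => sST.
by rewrite eqEcard sST ST leqnn.
Qed.

(** The [j] right arguments are pulled back along [N]. A local inverse is given by [Q], because Q (N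
    v) - p v lies in Z. *)
Lemma stepR j : exists e0, forall e, (e0 <= e)%N ->
  (dm (fam w (SR j.+1) e) + dm (fam (w2 w) (SU j) e) =
   dm (fam (w2 w) (SV j) e) + dm (fam w (SR j) e))%N.
Proof.
apply: (@graded_step k r n I w j (SV j) (SU j) (@SVU j) (SR j.+1) (SR j) idl N) => //.
- by move=> Y [ZY [S SI jS]]; split=> //; exists S => //; apply: ltnW.
- move=> t at_ vt _ [S [u [v [-> H]]]]; rewrite ev_glue_l; case: eqP => // Sj.
  case: H => [//|[Zu [[i iS Iu]|[i iS Zv]]]]; last first.
    by apply: (@ev_zero _ _ _ _ _ _ i); rewrite iS.
  apply: vt; split=> [l|]; first by case: (boolP (l \in S)) => lS; [apply: NN|apply: Zu].
  exists (i |: S); last by rewrite cardsU1 iS Sj.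
  move=> l; rewrite !inE => /orP[/eqP ->|lS]; first by rewrite (negPf iS).
  by rewrite lS; exists (v l).
- move=> t at_ vt; split=> H.
    move=> _ [S [u [v [-> HS]]]]; rewrite ev_glue_l; case: eqP => // Sj.
    case: HS => // Zu; apply: H; split=> [l|].
      by case: (boolP (l \in S)) => lS; [apply: NN|apply: Zu].
    by exists S; [move=> l lS; rewrite lS; exists (v l)|rewrite Sj].
  move=> Y [ZY [S SI jS]]; case: (ltngtP j #|S|) => [lt|lt|Sj].
  - by apply: vt; split=> //; exists S.
  - by rewrite ltnNge jS in lt.
  have /choice[v vE] : forall i, exists v, i \in S -> Y i = N v.
    by move=> i; case: (boolP (i \in S)) => [/SI[h]|_]; [exists h|exists 0].
  have := H (arg S Y v); rewrite ev_glue_l Sj eqxx => HH.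
  rewrite -[RHS]HH; last by exists S, Y, v; split=> //; right.
  by apply: eq_ev => i; case: ifP => // /vE ->.
move=> a a0; have [d [p [Q [hp pa hQd NQN]]]] := hQ a0.
exists d, p, (scl p), Q; split=> //; first by split=> //; apply: hscl.
move=> t at_ vt.
have ZQ v : isZ (Q (N v) - p *: v) by rewrite /isZ linearB /= NQN linearZ subrr.
split.
  move=> Y [ZY [S SI jS]]; rewrite ev_glue_r big1 // => T _.
  have [Tj|/eqP nTj] := eqVneq #|T| j; last exact: (vanV1 vt).
  have [i iS iT] : exists2 i, i \in S & i \notin T.
    apply/subsetPn; apply/negP => /subset_leq_card; rewrite Tj => /(leq_ltn_trans) /(_ jS).
    by rewrite ltnn.
  apply: (vanV2 vt _ (i := i)) => //; first by move=> l _; apply: ZZ.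
  by apply: ImZc; apply: SI.
move=> _ [S [u [v [-> HS]]]]; rewrite evD evN ev_pmul ev_glue_l.
case: eqP => [Sj|nSj]; last by rewrite (vanV1 vt) // mulr0 subrr.
case: HS => // Zu; rewrite ev_glue_r (bigD1 S) //= [X in _ - (_ + X)]big1 ?addr0.
  rewrite -(ev_arg_scale t).
  have := @vanVz j t vt S (fun i => p *: u i) (fun i => p *: v i)
    (fun i => Q (N (v i)) - p *: v i) (fun i iS => ZZ p (Zu i iS)) (fun i => ZQ (v i)).
  move=> <-; apply/eqP; rewrite subr_eq0; apply/eqP; apply: eq_ev => i.
  by rewrite /arg /=; case: ifP => // iS; rewrite addrC subrK.
(* If T differs from S but has the same size, some place of S lies outside T, and the left argument
   there is a multiple of N (v i), thus in B. *)
move=> T TS; have [Tj|/eqP nTj] := eqVneq #|T| j; last exact: (vanV1 vt).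
have [||i iS iT] := @neq_sets S T; [by rewrite Sj|by rewrite eq_sym|].
apply: (vanV2 vt _ (i := i)) => //=.
  by move=> l lT; apply: ZZ; case: (boolP (l \in S)) => lS; [apply: NN|apply: Zu].
by rewrite iS; apply: ImZc; exists (v i).
Qed.

(** Both copies map to H identically. The local inverse uses p - Q N on the left, which sends H into
    Z and is multiplication by p on Z. *)
Lemma stepP j : exists e0, forall e, (e0 <= e)%N ->
  (dm (fam w (SP j) e) + dm (fam (w2 w) (SU j) e) =
   dm (fam (w2 w) (SV j) e) + dm (fam w (SP j.+1) e))%N.
Proof.
apply: (@graded_step k r n I w j (SV j) (SU j) (@SVU j) (SP j) (SP j.+1) idl idl) => //.
- by move=> Y [?|[S SZ lt]]; [left|right; exists S => //; lia].
- move=> t at_ vt _ [S [u [v [-> H]]]]; rewrite ev_glue_l; case: eqP => // Sj.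
  case: H => [//|[Zu [[i iS Iu]|[i iS Zv]]]]; apply: vt.
    by left; exists i; rewrite (negPf iS).
  right; exists (i |: ~: S).
    move=> l; rewrite !inE => /orP[/eqP ->|lS]; first by rewrite iS.
    by rewrite (negPf lS); apply: Zu.
  by rewrite cardsU1 !inE iS /= cardsCs setCK card_ord; have := max_card S; rewrite card_ord Sj; lia.
- move=> t at_ vt; split=> H.
    move=> _ [S [u [v [-> HS]]]]; rewrite ev_glue_l; case: eqP => // Sj.
    case: HS => // Zu; apply: H; right; exists (~: S).
      by move=> l; rewrite inE => lS; rewrite (negPf lS); apply: Zu.
    by rewrite cardsCs setCK card_ord; have := max_card S; rewrite card_ord Sj; lia.
  move=> Y [IY|[S SZ]]; first by apply: vt; left.
  case: (ltngtP n (#|S| + j)%N) => [lt|lt|nS] hS.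
  - by apply: vt; right; exists S.
  - by lia.
  have := H (arg (~: S) Y Y); rewrite ev_glue_l cardsCs setCK card_ord.
  rewrite (_ : n - #|S| = j)%N; last by lia.
  rewrite eqxx => HH; rewrite -[RHS]HH; last first.
    exists (~: S), Y, Y; split=> //; right => i; rewrite inE negbK; exact: SZ.
  by apply: eq_ev => i; case: ifP.
move=> a a0; have [d [p [Q [hp pa hQd NQN]]]] := hQ a0.
pose pr v : vecI := p *: v - Q (N v).
have prl : linear pr.
  by move=> c u v; rewrite /pr (linearP N) (linearP Q) scalerBr opprD scalerDr !scalerA mulrC addrACA.
pose Pr : {linear vecI -> vecI} := HB.pack pr (GRing.isLinear.Build _ _ _ _ pr prl).
have hPr : ghom w w d Pr.
  have h1 := hscl hp; have h2 := ghom_comp hN hQd.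
  move=> x i; rewrite /= /pr.
  have -> : (p *: dl k r x - Q (N (dl k r x))) i = (p *: dl k r x) i - Q (N (dl k r x)) i.
    by rewrite [LHS]ffunE; congr (_ + _); rewrite [LHS]ffunE.
  have hE (y : R) : (y = 0 \/ exists2 e, hom e y & (e + w i = d + w x)%N) ->
      hom (d + w x - w i)%N y /\ (y != 0 -> (w i <= d + w x)%N).
    case=> [->|[e he E]]; first by rewrite eqxx; split=> //; apply: hom0.
    by split; [rewrite (_ : _ - _ = e)%N //; lia|lia].
  have [e1 n1] := hE _ (h1 x i); have [e2 n2] := hE _ (h2 x i).
  case: (leqP (w i) (d + w x)) => le.
    right; exists (d + w x - w i)%N; last by rewrite subnK.
    by apply: homD => //; apply: homN.
  left.
  have -> : (p *: dl k r x) i = 0.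
    by apply/eqP; apply: contraTT le => /n1; rewrite -leqNgt.
  have -> : Q (N (dl k r x)) i = 0.
    by apply/eqP; apply: contraTT le => /n2; rewrite -leqNgt.
  by rewrite subrr.
exists d, p, Pr, (scl p); split=> //; first by split=> //; apply: hscl.
move=> t at_ vt.
have ZPr v : isZ (pr v) by rewrite /isZ /pr linearB /= NQN linearZ subrr.
have PrZ v : isZ v -> pr v = p *: v by rewrite /isZ /pr => ->; rewrite linear0 subr0.
split.
  move=> Y [[i [h Yi]]|[S SZ lt]]; rewrite ev_glue_r big1 // => T _.
    have [iT|iT] := boolP (i \in T).
      apply: (vanV3 vt (i := i)); [by move=> l _; apply: ZPr|by []|].
      by rewrite /= Yi; apply: ZZ; apply: NN.
    apply: (vanV2 vt _ (i := i)); [by move=> l _; apply: ZPr|by []|].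
    by rewrite /= -/(pr _) PrZ ?Yi; [apply: ImZc; exists h|apply: NN].
  have [Tj|/eqP nTj] := eqVneq #|T| j; last exact: (vanV1 vt).
  have [i iS iT] : exists2 i, i \in S & i \in T.
    apply/exists_inP; apply: contraLR lt => /exists_inPn H.
    rewrite -leqNgt -Tj.
    have : [disjoint S & T] by rewrite disjoint_subset; apply/subsetP => i /H.
    by rewrite -leq_card_setU => /eqP <-; have := max_card (S :|: T); rewrite card_ord.
  apply: (vanV3 vt (i := i)); [by move=> l _; apply: ZPr|by []|].
  by apply: ZZ; apply: SZ.
move=> _ [S [u [v [-> HS]]]]; rewrite evD evN ev_pmul ev_glue_l.
case: eqP => [Sj|nSj]; last by rewrite (vanV1 vt) // mulr0 subrr.
case: HS => // Zu; rewrite ev_glue_r (bigD1 S) //= [X in _ - (_ + X)]big1 ?addr0.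
  rewrite -(ev_arg_scale t).
  apply/eqP; rewrite subr_eq0; apply/eqP; apply: eq_ev => i.
  rewrite /arg /=; case: ifP => // iS.
  by rewrite -/(pr _) PrZ //; apply: Zu; rewrite iS.
move=> T TS; have [Tj|/eqP nTj] := eqVneq #|T| j; last exact: (vanV1 vt).
have [||i iT iS] := @neq_sets T S; [by rewrite Sj|by []|].
apply: (vanV3 vt (i := i)); [by move=> l _; apply: ZPr|by []|].
by rewrite /= (negPf iS); apply: ZZ; apply: Zu.
Qed.

Definition SIm (Y : 'I_n -> vecI) := exists i, isIm (Y i).
Definition SKer (Y : 'I_n -> vecI) := forall i, isZ (Y i).

(* Hilbert functions of the exterior powers of (H/im N)^* and (ker N)^*. *)
Lemma square_zero_hilbert : exists e0, forall e, (e0 <= e)%N ->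
  (dm (fam w SIm e) + dm (fam w SKer e) = dm (@fam k r n I w (fun=> False) e))%N.
Proof.
have eqfam S S' e : (forall Y, S Y <-> S' Y) -> dm (@fam k r n I w S e) = dm (fam w S' e).
  by move=> SS; apply: eq_dm => t; split; apply: fam_mono => Y; case: (SS Y).
(* In large degrees the sum for [SP j] and [SR j] does not depend on [j], as the two steps change
   its terms by opposite amounts. At j = 0 it is the left side, at j = n + 1 the first term is 0 and
   the second counts all forms. *)
have step j : exists e0, forall e, (e0 <= e)%N ->
    (dm (fam w SIm e) + dm (fam w SKer e) = dm (fam w (SP j) e) + dm (fam w (SR j) e))%N.
  elim: j => [|j [e0 IH]].
    exists 0%N => e _; congr (_ + _)%N; apply: eqfam => Y; split.
    - by move=> ?; left.
    - move=> [//|[S SZ]]; rewrite addn0 => lt.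
      by have := max_card S; rewrite card_ord leqNgt lt.
    - by move=> ZY; split=> //; exists set0 => // i; rewrite inE.
    - by case.
  have [e1 H1] := stepR j; have [e2 H2] := stepP j.
  exists (maxn e0 (maxn e1 e2)) => e; rewrite !geq_max => /and3P[l0 l1 l2].
  by rewrite IH //; move: (H1 e l1) (H2 e l2); lia.
have [e0 H] := step n.+1; exists e0 => e le; rewrite H //.
rewrite (_ : dm (fam w (SP n.+1) e) = 0%N) ?add0n.
  apply: eqfam => Y; split=> // -[_ [S _ lt]].
  by have := max_card S; rewrite card_ord leqNgt lt.
apply: dm_null => t; split=> [[_ _ vt]|->]; last by case: (fam_lsub w (SP n.+1) e).
apply: tens_ext => Y; rewrite ev0; apply: vt.
by right; exists set0 => [i|]; rewrite ?inE // addnS ltnS leq_addl.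
Qed.
End SquareZero.

(** * Minors *)

(** Induction on the number of variables: at each value of the other variables, the polynomial in
    the last one has no nonroot and is therefore zero. *)
Lemma mpoly_eval0 (k : closedFieldType) n (p : {mpoly k[n]}) :
  (forall v, p.@[v] = 0) -> p = 0.
Proof.
elim: n p => [|n IH] p p0.
  apply/mpolyP => m; rewrite mcoeff0.
  have m0 (m' : 'X_{1..0}) : m' = 0%MM by apply/mnmP => -[].
  have := p0 (fun=> 0); rewrite mevalE => E.
  have [/eqP -> //|pm] := boolP (p@_m == 0).
  move: E; rewrite (bigD1_seq m) ?mcoeff_msupp ?msupp_uniq //= big_ord0 mulr1.
  by rewrite big1 ?addr0 // => m' /eqP[]; rewrite (m0 m) (m0 m').
have coefE j u : ((muni p)`_j)@_u = p@_[multinom (if unlift ord_max i is Some i' then u i' else j) | i < n.+1].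
  set mu := [multinom _ | i < _].
  have muE m : (m == mu) = ([multinom m (widen_ord (leqnSn n) i) | i < n] == u) && (m ord_max == j).
    rewrite /mu; apply/eqP/andP => [->|[/eqP <- /eqP <-]].
      split; last by rewrite mnmE unlift_none.
      apply/eqP/mnmP => i; rewrite !mnmE.
      have -> : widen_ord (leqnSn n) i = lift ord_max i.
        by apply: val_inj; rewrite /= /bump leqNgt ltn_ord.
      by rewrite liftK.
    apply/mnmP => i; rewrite !mnmE; case: unliftP => [i'|] -> //.
    rewrite mnmE; congr (m _); apply: val_inj.
    by rewrite /= /bump leqNgt ltn_ord.
  rewrite muniE coef_sum raddf_sum /=.
  transitivity (\sum_(m <- msupp p) p@_m * (m == mu)%:R).
    apply: eq_bigr => m _; rewrite coefZ coefXn muE [j == _]eq_sym.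
    case: (m ord_max == j); rewrite ?andbT ?andbF ?mulr1 ?mulr0 ?mcoeff0 //.
    by rewrite mcoeffZ mcoeffX.
  have [mup|nmu] := boolP (mu \in msupp p).
    rewrite (bigD1_seq mu) ?msupp_uniq //= eqxx mulr1 big1 ?addr0 //.
    by move=> m /negPf ->; rewrite mulr0.
  rewrite big1_seq ?(memN_msupp_eq0 nmu) // => m /= mp.
  by case: eqP mp nmu => [-> ->|_ _ _]; rewrite ?mulr0.
suff m0 : muni p = 0.
  apply/mpolyP => m; rewrite mcoeff0.
  have := coefE (m ord_max) [multinom m (lift ord_max i) | i < n].
  rewrite m0 coef0 mcoeff0 => ->; congr (p@_ _); apply/mnmP => i.
  by rewrite mnmE; case: unliftP => [i'|] -> //; rewrite mnmE.
apply/polyP => j; rewrite coef0; apply: IH => v.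
suff q0 : map_poly (meval v) (muni p) = 0.
  by have := congr1 (fun q : {poly k} => q`_j) q0; rewrite coef_map coef0.
apply/eqP; apply: contraT => /closed_nonrootP[t] /negP[]; apply/rootP.
pose ext i := if unlift ord_max i is Some i' then v i' else t.
suff -> : (map_poly (meval v) (muni p)).[t] = p.@[ext] by [].
rewrite mevalE muniE rmorph_sum horner_sum; apply: eq_bigr => m _.
rewrite /= map_polyZ hornerZ map_polyXn hornerXn.
rewrite -[X in X * _]/((p@_m *: 'X_[[multinom m (widen_ord (leqnSn n) i) | i < n]]).@[v]).
rewrite mevalZ mevalX -mulrA; congr (_ * _).
rewrite big_ord_recr /= {2}/ext unlift_none; congr (_ * _).
apply: eq_bigr => i _; rewrite mnmE /ext.
have -> : widen_ord (leqnSn n) i = lift ord_max i.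
  by apply: val_inj; rewrite /= /bump leqNgt ltn_ord.
by rewrite liftK.
Qed.

Lemma minor_exists (F : fieldType) a b d (A : 'M[F]_(a, b)) : \rank A = d ->
  exists (f : 'I_d -> 'I_a) (g : 'I_d -> 'I_b), \det (mxsub f g A) != 0.
Proof.
move=> <-; pose f := maxrankfun A; pose B := rowsub f A.
have rB : \rank B^T = \rank A by rewrite mxrank_tr eq_maxrowsub.
pose g (i : 'I_(\rank A)) := maxrankfun B^T (cast_ord (esym rB) i).
exists f, g; rewrite -unitfE -unitmxE -unitmx_tr -row_free_unit.
have := maxrowsub_free B^T; rewrite /row_free => /eqP E.
have : \rank (rowsub g B^T) = \rank A.
  have gen n (e : n = \rank B^T) :
      \rank (rowsub (fun i : 'I_n => maxrankfun B^T (cast_ord e i)) B^T) = n.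
    subst n; rewrite -[RHS]E; congr (\rank _).
    by apply/matrixP => i j; rewrite !mxE cast_ord_id.
  exact: gen.
have -> : (mxsub f g A)^T = rowsub g B^T by apply/matrixP => i l; rewrite !mxE.
by move=> ->.
Qed.

(** The [d] selected rows are independent, so they span the row space of [A]. *)
Lemma minor_factor (F : fieldType) a b d (A : 'M[F]_(a, b)) f g : (\rank A <= d)%N ->
  mxsub f g A \in unitmx ->
  A = colsub g A *m invmx (mxsub f g A : 'M_d) *m rowsub f A.
Proof.
move=> rA uA.
have sub : (rowsub f A <= A)%MS by apply: rowsub_sub.
have rr : (d <= \rank (rowsub f A))%N.
  rewrite -[X in (X <= _)%N](mxrank_unit uA).
  have -> : mxsub f g A = rowsub f A *m colsub g 1%:M.
    apply/matrixP => i j; rewrite !mxE (bigD1 (g j)) //= !mxE eqxx mulr1 big1 ?addr0 //.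
    by move=> l /negPf lg; rewrite !mxE lg mulr0.
  exact: mxrankM_maxl.
have /submxP[X AX] : (A <= rowsub f A)%MS.
  by rewrite -(mxrank_leqif_sup sub); apply/eqP/anti_leq; rewrite (leq_trans rA rr) mxrankS.
rewrite {1}AX; congr (_ *m _).
have -> : colsub g A = X *m mxsub f g A.
  rewrite {1}AX; apply/matrixP => i j; rewrite !mxE; apply: eq_bigr => l _.
  by rewrite !mxE.
by rewrite mulmxK.
Qed.

(** Where the minor does not vanish this is [minor_factor]. After multiplication by the minor it
    holds at every point, hence for polynomials, and the minor is cancelled. *)
Lemma minor_identity (k : closedFieldType) r a b d (A : 'M[{mpoly k[r]}]_(a, b))
   (f : 'I_d -> 'I_a) (g : 'I_d -> 'I_b) :
  (forall v, \rank (map_mx (meval v) A) <= d)%N -> \det (mxsub f g A) != 0 ->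
  \det (mxsub f g A) *: A = colsub g A *m \adj (mxsub f g A) *m rowsub f A.
Proof.
move=> rA nz; set D := \det _.
suff E : D *: (D *: A - colsub g A *m \adj (mxsub f g A) *m rowsub f A) = 0.
  apply/matrixP => i j; apply/eqP; rewrite -subr_eq0.
  have /matrixP/(_ i j) := E; rewrite !mxE => /eqP.
  by rewrite mulf_eq0 (negPf nz).
apply/matrixP => i j; rewrite [RHS]mxE; apply: mpoly_eval0 => v.
pose Av := map_mx (meval v) A.
have Dv : D.@[v] = \det (mxsub f g Av) by rewrite /D -det_map_mx map_mxsub.
rewrite mxE mevalM Dv.
have [->|nzv] := eqVneq (\det (mxsub f g Av)) 0; first by rewrite mul0r.
have uA : mxsub f g Av \in unitmx by rewrite unitmxE unitfE.
have := minor_factor (rA v) uA; rewrite -/Av => AE.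
have EE : \det (mxsub f g Av) *: Av = colsub g Av *m \adj (mxsub f g Av) *m rowsub f Av.
  rewrite {2}AE /invmx uA -scalemxAr -scalemxAl scalerA divff ?scale1r //.
suff -> : (((D *: A - colsub g A *m \adj (mxsub f g A) *m rowsub f A) i j)).@[v] = 0 by rewrite mulr0.
have -> : ((D *: A - colsub g A *m \adj (mxsub f g A) *m rowsub f A) i j).@[v] =
  (map_mx (meval v) (D *: A - colsub g A *m \adj (mxsub f g A) *m rowsub f A)) i j.
  by rewrite [RHS]mxE.
rewrite map_mxB map_mxZ !map_mxM map_mx_adj !map_mxsub -/Av.
rewrite -[X in X *: _]/(D.@[v]) Dv EE.
by rewrite subrr mxE.
Qed.

(** * Adding a basis vector *)

Section Insert.
Variables (k : fieldType) (r n : nat) (I : finType).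
Local Notation R := {mpoly k[r]}.

Definition ins (i : 'I_n.+1) (j : I) (g : {ffun 'I_n -> I}) : {ffun 'I_n.+1 -> I} :=
  [ffun l => if unlift i l is Some l' then g l' else j].

Lemma ins_lift i j g l : ins i j g (lift i l) = g l.
Proof. by rewrite ffunE liftK. Qed.

Lemma ins_id i j g : ins i j g i = j.
Proof. by rewrite ffunE unlift_none. Qed.

Lemma sum_ins (V : nmodType) (i : 'I_n.+1) (F : {ffun 'I_n.+1 -> I} -> V) :
  \sum_f F f = \sum_j \sum_g F (ins i j g).
Proof.
rewrite pair_big /=.
rewrite (reindex (fun jg : I * {ffun 'I_n -> I} => ins i jg.1 jg.2)) //=.
exists (fun f : {ffun 'I_n.+1 -> I} => (f i, [ffun l => f (lift i l)])) => [[j g] _|f _] /=.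
  by rewrite ins_id; congr (_, _); apply/ffunP => l; rewrite ffunE ins_lift.
by apply/ffunP => l; rewrite ffunE; case: unliftP => [l'|] -> //; rewrite ffunE.
Qed.

Lemma ev_ins (t : tens k r n.+1 I) i Y :
  ev t Y = \sum_j \sum_g t (ins i j g) * (Y i j * \prod_l Y (lift i l) (g l)).
Proof.
rewrite /ev (sum_ins i); apply: eq_bigr => j _; apply: eq_bigr => g _.
rewrite (bigD1_ord i) //= ins_id; congr (_ * (_ * _)).
by apply: eq_bigr => l _; rewrite ins_lift.
Qed.

Definition cons_arg (v : vec k r I) (Y : 'I_n -> vec k r I) : 'I_n.+1 -> vec k r I :=
  fun l => if unlift ord0 l is Some l' then Y l' else v.

(** The interior product with [v]. *)
Definition fix0 (v : vec k r I) (t : tens k r n.+1 I) : tens k r n I :=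
  [ffun g => \sum_j v j * t (ins ord0 j g)].

Lemma ev_fix0 v t Y : ev (fix0 v t) Y = ev t (cons_arg v Y).
Proof.
rewrite (ev_ins t ord0) exchange_big /=; apply: eq_bigr => g _.
rewrite ffunE mulr_suml; apply: eq_bigr => j _.
rewrite /cons_arg unlift_none mulrCA mulrA; congr (_ * _).
by apply: eq_bigr => l _; rewrite liftK.
Qed.

Lemma fix0P v c t u : fix0 v (c *: t + u) = c *: fix0 v t + fix0 v u.
Proof.
apply/ffunP => g; rewrite !ffunE scaler_sumr -big_split; apply: eq_bigr => j _.
by rewrite !ffunE mulrDr scalerAr.
Qed.

Lemma alt_fix0 v t : alt t -> alt (fix0 v t).
Proof.
move=> at_ Y i i' ii' Yi; rewrite ev_fix0; apply: (at_ _ (lift ord0 i) (lift ord0 i')).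
  by apply: contra_neq ii'; apply: lift_inj.
by rewrite /cons_arg !liftK.
Qed.

(** The exterior product of [t] with the linear form of coefficients [nu]. *)
Definition wedge (nu : I -> R) (t : tens k r n I) : tens k r n.+1 I :=
  [ffun f : {ffun 'I_n.+1 -> I} =>
     \sum_(i < n.+1) (-1) ^+ i * (nu (f i) * t [ffun l => f (lift i l)])].

Lemma ev_wedge nu t Y : ev (wedge nu t) Y =
  \sum_(i < n.+1) (-1) ^+ i * ((\sum_j nu j * Y i j) * ev t (fun l => Y (lift i l))).
Proof.
transitivity (\sum_(i < n.+1) \sum_(f : {ffun 'I_n.+1 -> I}) (-1) ^+ i * (nu (f i) * t [ffun l => f (lift i l)]) * \prod_l Y l (f l)).
  by rewrite exchange_big; apply: eq_bigr => f _; rewrite ffunE mulr_suml.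
apply: eq_bigr => i _; rewrite (sum_ins i) mulr_suml mulr_sumr.
apply: eq_bigr => j _; rewrite !mulr_sumr; apply: eq_bigr => g _.
rewrite (bigD1_ord i) //= !ins_id -!mulrA; congr (_ * (_ * _)).
have -> : [ffun l => ins i j g (lift i l)] = g by apply/ffunP => l; rewrite ffunE ins_lift.
rewrite mulrCA; congr (_ * (_ * _)); by apply: eq_bigr => l _; rewrite ins_lift.
Qed.

Lemma alt_wedge nu t : alt t -> alt (wedge nu t).
Proof.
move=> at_; apply: alt_adjacent => Y i i' ii' Yi; rewrite ev_wedge.
have nii' : i' != i by rewrite -val_eqE /= ii'; lia.
(* Only the terms of i and i' = i + 1 survive. Their signs are opposite, and omitting either of two
   equal neighbours leaves the same arguments. *)
rewrite (bigD1 i) //= (bigD1 i') //= [X in _ + (_ + X)]big1 ?addr0.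
  rewrite Yi ii' exprS mulN1r mulNr; apply/eqP; rewrite subr_eq0.
  apply/eqP; congr (_ * (_ * _)); apply: eq_ev => l.
  have [li|lN] := eqVneq (l : nat) i.
    have -> : lift i l = i' by apply: val_inj; rewrite /= /bump -li leqnn ii' li.
    have -> : lift i' l = i by apply: val_inj; rewrite /= /bump ii' li ltnn.
    by [].
  by congr (Y _); apply: val_inj; rewrite /= /bump ii' ltn_neqAle eq_sym lN.
move=> j /andP[ji ji'].
have /unlift_some[l lE _] := ji; have /unlift_some[l' lE' _] := ji'.
rewrite (at_ _ l l') ?mulr0 //; last by rewrite -lE -lE'.
by apply: contra_neq nii' => E; rewrite lE lE' E.
Qed.
End Insert.

Section Extend.
Variables (k : closedFieldType) (r n : nat) (I J : finType) (g : I -> J) (x0 : J)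
  (gi : J -> option I).
Hypotheses (gK : forall i, gi (g i) = Some i) (gx0 : gi x0 = None)
  (giK : forall x, if gi x is Some i then g i = x else x = x0).
Local Notation R := {mpoly k[r]}.
Local Notation vecI := (vec k r I).
Local Notation vecJ := (vec k r J).
Variable (w : J -> nat).
Let wI i := w (g i).

Definition emb (v : vecI) : vecJ := [ffun x => if gi x is Some i then v i else 0].
Definition res (v : vecJ) : vecI := [ffun i => v (g i)].

Lemma emb_linear : linear emb.
Proof.
move=> c u v; apply/ffunP => x; rewrite !ffunE; case: (gi x) => [i|]; rewrite ?ffunE //.
by rewrite scaler0 addr0.
Qed.
HB.instance Definition _ := GRing.isLinear.Build _ _ _ _ emb emb_linear.

Lemma res_linear : linear res.
Proof. by move=> c u v; apply/ffunP => i; rewrite !ffunE. Qed.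
HB.instance Definition _ := GRing.isLinear.Build _ _ _ _ res res_linear.

Lemma embK v : res (emb v) = v.
Proof. by apply/ffunP => i; rewrite !ffunE gK. Qed.

Lemma emb_x0 v : emb v x0 = 0. Proof. by rewrite ffunE gx0. Qed.

Lemma emb_res v : v = emb (res v) + v x0 *: dl k r x0.
Proof.
apply/ffunP => x; rewrite !ffunE; have := giK x; case: (gi x) (gK) => [i|] _ E.
  rewrite ffunE E; case: eqP => [xx0|_]; last by rewrite [_ *: _]mulr0 addr0.
  by have := gK i; rewrite E xx0 gx0.
by rewrite E eqxx add0r [RHS]mulr1.
Qed.

Lemma emb_dl i : emb (dl k r i) = dl k r (g i).
Proof.
apply/ffunP => x; rewrite !ffunE; have := giK x.
case E: (gi x) => [i'|] gx; first rewrite ffunE -gx.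
  congr (_%:R); congr nat_of_bool; apply/eqP/eqP => [->//|gi'].
  by have := gK i'; rewrite gi' gK => -[].
case: eqP => // xg; by have := gK i; rewrite -xg E.
Qed.

Lemma res_dl i : res (dl k r (g i)) = dl k r i.
Proof. by rewrite -emb_dl embK. Qed.

Lemma res_dl0 : res (dl k r x0) = 0.
Proof.
apply/ffunP => i; rewrite !ffunE; case: eqP => // gix.
by have := gK i; rewrite gix gx0.
Qed.

Lemma vhom_dl (T : finType) (wT : T -> nat) x : vhom wT 0 (dl k r x) (wT x).
Proof.
move=> y; rewrite ffunE; case: eqP => [->|_]; last by left.
by right; exists 0%N => //; apply: dhomog1.
Qed.

Lemma ghom_emb : ghom wI w 0 emb.
Proof. by move=> i; rewrite emb_dl; apply: vhom_dl. Qed.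

Lemma ghom_res : ghom w wI 0 res.
Proof.
move=> x; have := giK x; case: (gi x) => [i <-|->].
  by rewrite res_dl; apply: vhom_dl.
by rewrite res_dl0 => i; left; rewrite ffunE.
Qed.

Lemma alt_scaled m (K : finType) (t : tens k r m K) (Y : 'I_m -> vec k r K) i i' a b v : alt t ->
  i != i' -> Y i = a *: v -> Y i' = b *: v -> ev t Y = 0.
Proof.
move=> at_ ii' Yi Yi'.
have ni : (i' == i) = false by rewrite eq_sym; apply/negbTE.
pose c l := if l == i then a else if l == i' then b else 1.
pose Z l := if (l == i) || (l == i') then v else Y l.
rewrite (eq_ev _ (Y' := fun l => c l *: Z l)).
  by rewrite ev_scale (at_ Z i i') ?mulr0 // /Z !eqxx orbT.
move=> l; rewrite /c /Z; case: eqP => [->//|_]; case: eqP => [->//|_].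
by rewrite scale1r.
Qed.

Variables (S1 : ('I_n.+1 -> vecI) -> Prop) (S0 : ('I_n -> vecI) -> Prop)
  (SJ : ('I_n.+1 -> vecJ) -> Prop).
Hypotheses
  (h1 : forall Y, S1 Y -> SJ (fun i => emb (Y i)))
  (h2 : forall Y, SJ Y -> S1 (fun i => res (Y i)))
  (h3 : forall Y, S0 Y -> SJ (cons_arg (dl k r x0) (fun i => emb (Y i))))
  (h4 : forall Y, SJ Y -> forall i, Y i x0 = 0 \/ S0 (fun l => res (Y (lift i l)))).

Definition contr (t : tens k r n.+1 J) : tens k r n I := pull emb (fix0 (dl k r x0) t).

Lemma ev_contr t Y :
  ev (contr t) Y = ev t (cons_arg (dl k r x0) (fun i => emb (Y i))).
Proof. by rewrite ev_pull ev_fix0. Qed.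

Definition wedge0 (t : tens k r n I) : tens k r n.+1 J :=
  wedge (fun j => (j == x0)%:R) (pull res t).

Lemma ev_wedge0 t Y : ev (wedge0 t) Y =
  \sum_(i < n.+1) (-1) ^+ i * (Y i x0 * ev t (fun l => res (Y (lift i l)))).
Proof.
rewrite ev_wedge; apply: eq_bigr => i _; rewrite ev_pull; congr (_ * (_ * _)).
rewrite (bigD1 x0) //= eqxx mul1r big1 ?addr0 // => j /negPf ->.
by rewrite mul0r.
Qed.

Lemma contr_wedge0 t : contr (wedge0 t) = t.
Proof.
apply: tens_ext => Y; rewrite ev_contr ev_wedge0 (bigD1 ord0) //= big1 ?addr0.
  rewrite expr0 mul1r /cons_arg unlift_none ffunE eqxx mul1r.
  by apply: eq_ev => i; rewrite liftK embK.
move=> i i0; rewrite /cons_arg; case: unliftP i0 => [l|] ->; last by rewrite eqxx.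
by move=> _; rewrite emb_x0 mul0r mulr0.
Qed.

(** Each argument is a vector of R^I plus a multiple of the new basis vector. Terms with that vector
    in two places vanish, and those with it in one place are governed by the contraction. *)
Lemma contr_inj t : alt t -> pull emb t = 0 -> contr t = 0 -> t = 0.
Proof.
move=> at_ pt ct.
have ft : fix0 (dl k r x0) t = 0.
  apply: tens_ext => Y; rewrite ev0 ev_fix0.
  have YE l : cons_arg (dl k r x0) Y l =
     cons_arg (dl k r x0) (fun i => emb (res (Y i))) l +
     cons_arg 0 (fun i => Y i x0 *: dl k r x0) l.
    by rewrite /cons_arg; case: unliftP => [l'|] _; rewrite ?addr0 // -emb_res.
  rewrite (eq_ev _ YE) ev_split (bigD1 set0) //= big1 ?addr0.
    have := ev_contr t (fun i => res (Y i)); rewrite ct ev0 => ->.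
    by apply: eq_ev => l; rewrite inE.
  move=> S /set0Pn[l lS]; have [l0|/unlift_some[l' l'E _]] := eqVneq ord0 l.
    by apply: (@ev_zero _ _ _ _ _ _ l); rewrite lS /cons_arg -l0 unlift_none.
  have [S0'|S0'] := boolP (ord0 \in S).
    by apply: (@ev_zero _ _ _ _ _ _ ord0); rewrite S0' /cons_arg unlift_none.
  apply: (@alt_scaled _ _ _ _ ord0 l 1 (Y l' x0) (dl k r x0) at_).
  - by rewrite l'E; apply: neq_lift.
  - by rewrite (negPf S0') /cons_arg unlift_none scale1r.
  - by rewrite lS /cons_arg l'E liftK.
apply: tens_ext => Y; rewrite ev0.
rewrite (eq_ev _ (fun l => emb_res (Y l))) ev_split (bigD1 set0) //= big1 ?addr0.
  have := ev_pull [the {linear vecI -> vecJ} of emb] t (fun i => res (Y i)).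
  rewrite pt ev0 => ->.
  by apply: eq_ev => l; rewrite inE.
move=> S /set0Pn[i iS].
pose Z l := if l \in S then Y l x0 *: dl k r x0 else emb (res (Y l)).
change (ev t Z = 0).
have key (Z' : 'I_n.+1 -> vecJ) c : Z' ord0 = c *: dl k r x0 -> ev t Z' = 0.
  move=> Z0; have := ev_fix0 (dl k r x0) t (fun l => Z' (lift ord0 l)).
  rewrite ft ev0 => /(congr1 ( *%R c)); rewrite mulr0 => E; rewrite [RHS]E.
  pose cc (l : 'I_n.+1) : R := if l == ord0 then c else 1.
  rewrite (eq_ev _ (Y' := fun l => cc l *: cons_arg (dl k r x0) (fun l => Z' (lift ord0 l)) l)).
    rewrite ev_scale; congr (_ * _); rewrite (bigD1 ord0) //= /cc eqxx big1 ?mulr1 //.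
    by move=> l /negPf ->.
  move=> l; rewrite /cc /cons_arg; case: unliftP => [l'|] ->; last by rewrite eqxx.
  by rewrite eq_sym (negPf (neq_lift _ _)) scale1r.
have [i0|i0] := eqVneq i ord0; first by apply: (key _ (Y i x0)); rewrite /Z -i0 iS.
apply/eqP; rewrite -oppr_eq0 -(alt_swap _ at_ i0); apply/eqP.
by apply: (key _ (Y i x0)); rewrite tpermR /Z iS.
Qed.

Lemma thom_contr e t : thom w e t -> thom wI (e + w x0) (contr t).
Proof.
move=> ht; rewrite -[(e + w x0)%N]addn0 -(muln0 n).
apply: thom_pull ghom_emb => f; rewrite ffunE.
apply: hom_sum => j _; rewrite ffunE; case: eqP => [->|_]; last by rewrite mul0r; apply: hom0.
rewrite mul1r; have := ht (ins ord0 x0 f).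
rewrite (bigD1_ord ord0) //= ins_id addnA.
by under eq_bigr do rewrite ins_lift.
Qed.

Lemma thom_wedge0 e t : thom wI (e + w x0) t -> thom w e (wedge0 t).
Proof.
move=> ht f; rewrite ffunE; apply: hom_sum => i _.
have -> : (-1) ^+ i = ((-1) ^+ i)%:MP :> R by rewrite rmorphXn rmorphN1.
rewrite mul_mpolyC; apply: homZ.
case: eqP => [fi|_]; last by rewrite mul0r; apply: hom0.
rewrite mul1r (bigD1_ord i) //= fi addnA.
have := @thom_pull k r n I J w wI (e + w x0) 0 t res ht ghom_res [ffun l => f (lift i l)].
rewrite muln0 addn0.
by under eq_bigr do rewrite ffunE.
Qed.

(** A form on R^J amounts to its restriction to R^I together with its contraction with the new basis
    vector, which has one argument less and a degree raised by the weight of that vector. The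
    hypotheses [h1] to [h4] make the vanishing conditions split in the same way. *)
Lemma dm_extend e : dm (fam w SJ e) = (dm (fam wI S1 e) + dm (fam wI S0 (e + w x0)))%N.
Proof.
pose K t := fam w SJ e t /\ pull emb t = 0.
have sK : lsub K.
  split; first by split; [case: (fam_lsub w SJ e)|apply/ffunP => f; rewrite !ffunE ev0].
  move=> c t u [ft pt] [fu pu]; split; first by case: (fam_lsub w SJ e) => _; apply.
  by rewrite pullP pt pu scaler0 addr0.
have null (V : lmodType k) : lsub (fun v : V => v = 0).
  by split=> // c u v -> ->; rewrite scaler0 addr0.
have dm_null' (V : lmodType k) : dm (fun v : V => v = 0) = 0%N by apply: dm_null.
have fdK : fd K by apply: (fd_sub (fam_fd w SJ e) sK) => t [].
have E1 : (dm (fam w SJ e) + 0 = dm (fam wI S1 e) + dm K)%N.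
  rewrite -(dm_null' (tens k r n.+1 I)); apply: (@dm_rel _ _ _ _ _ _ _ (pull emb)).
  - exact: fam_fd.
  - exact: sK.
  - by move=> t [].
  - exact: fam_fd.
  - exact: null.
  - by move=> t ->; case: (fam_lsub wI S1 e).
  - by move=> c t u _ _; apply: pullP.
  - move=> t [ht at_ vt]; split; last by move=> Y SY; rewrite ev_pull vt //; apply: h1.
      by rewrite -[e]addn0 -(muln0 n.+1); apply: thom_pull ghom_emb.
    exact: alt_pull.
  - by move=> t ft; split=> [[]|].
  - move=> t [ht at_ vt]; exists (pull res t).
      split; last by move=> Y SY; rewrite ev_pull vt //; apply: h2.
        by rewrite -[e]addn0 -(muln0 n.+1); apply: thom_pull ghom_res.
      exact: alt_pull.
    apply: tens_ext => Y; rewrite ev0 evD evN !ev_pull.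
    by apply/eqP; rewrite subr_eq0; apply/eqP; apply: eq_ev => i; symmetry; apply: embK.
have cP c t u : contr (c *: t + u) = c *: contr t + contr u by rewrite /contr fix0P pullP.
have E2 : (dm K + 0 = dm (fam wI S0 (e + w x0)) + 0)%N.
  rewrite -{1}(dm_null' (tens k r n I)) -(dm_null' (tens k r n.+1 J)).
  apply: (@dm_rel _ _ _ _ _ _ _ contr).
  - exact: fdK.
  - exact: null.
  - by move=> t ->; case: sK.
  - exact: fam_fd.
  - exact: null.
  - by move=> t ->; case: (fam_lsub wI S0 (e + w x0)%N).
  - by move=> c t u _ _; apply: cP.
  - move=> t [[ht at_ vt] _]; split; first exact: thom_contr.
      by apply: alt_pull; apply: alt_fix0.
    by move=> Y SY; rewrite ev_contr vt //; apply: h3.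
  - move=> t [[ht at_ vt] pt]; split=> [->|]; last exact: contr_inj.
    by have := cP (-1) 0 0; rewrite scaler0 addr0 scaleN1r addNr.
  - move=> t [ht at_ vt]; exists (wedge0 t); last by rewrite contr_wedge0 subrr.
    split; last first.
      apply: tens_ext => Y; rewrite ev_pull ev_wedge0 ev0 big1 // => i _.
      by rewrite emb_x0 mul0r mulr0.
    split; first exact: thom_wedge0.
      by apply: alt_wedge; apply: alt_pull.
    move=> Y SY; rewrite ev_wedge0 big1 // => i _.
    by case: (h4 SY i) => [->|/vt ->]; rewrite ?mul0r ?mulr0.
lia.
Qed.
End Extend.

(** * Elimination in the ring of shift operators *)

Section Toeplitz.
Variables (d p m : nat).
Hypothesis d0 : (0 < d)%N.

(** The matrix that sends the coefficients of a polynomial of degree at most [m] to the coefficients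
    of degrees d - 1, ..., d - 1 + m of its product with (1 + u)^(d + p). *)
Definition toep : 'M[rat]_m.+1 :=
  \matrix_(l, i) (if (i <= d.-1 + l)%N then 'C(d + p, d.-1 + l - i)%:R else 0).

Lemma dvdp_deriv_exp (q g : {poly rat}) c : q ^+ c.+1 %| g -> q ^+ c %| g^`().
Proof.
move=> /dvdpP[s ->]; rewrite derivM deriv_exp /=.
apply: dvdp_add; first by rewrite exprS mulrA dvdp_mull.
by rewrite dvdp_mull // -mulr_natl mulrA dvdp_mull.
Qed.

(* If T h = 0, the (d-1)-st derivative of (1+u)^(d+p) h(u) is divisible by
   u^(m+1) (1+u)^(p+1), which exceeds its degree. *)
Lemma toep_unit : toep \in unitmx.
Proof.
rewrite -unitmx_tr -row_free_unit -kermx_eq0; apply/rowV0P => v /sub_kermxP v0.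
pose h : {poly rat} := \poly_(i < m.+1) (if insub i is Some i' then v 0 i' else 0).
have hi (i : 'I_m.+1) : h`_i = v 0 i by rewrite coef_poly ltn_ord valK.
pose q : {poly rat} := 'X + 1.
have qc n j : (q ^+ n)`_j = 'C(n, j)%:R.
  rewrite /q exprDn coef_sum.
  have [jn|jn] := leqP j n; last first.
    rewrite bin_small // big1 // => i _; rewrite expr1n mulr1 coefMn coefXn.
    by case: eqP => [E|_]; rewrite ?mul0rn //; have := leq_subr i n; rewrite -E leqNgt jn.
  have lt : (n - j < n.+1)%N by rewrite ltnS leq_subr.
  rewrite (bigD1 (Ordinal lt)) //= expr1n mulr1 coefMn coefXn subKn // eqxx bin_sub //.
  rewrite big1 ?addr0 // => i ni; rewrite expr1n mulr1 coefMn coefXn.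
  case: eqP => [E|_]; rewrite ?mul0rn //; case/eqP: ni; apply: val_inj => /=.
  by rewrite E subKn // -ltnS.
have sq : size q = 2%N by rewrite /q -[1]/(1%:P) size_XaddC.
pose f : {poly rat} := q ^+ (d + p) * h.
have fz (l : 'I_m.+1) : f`_(d.-1 + l) = 0.
  have /matrixP/(_ 0 l) := v0; rewrite !mxE => E; rewrite -[RHS]E.
  rewrite /f mulrC coefM.
  transitivity (\sum_(i < m.+1 | (i <= d.-1 + l)%N) h`_i * (q ^+ (d + p))`_(d.-1 + l - i)).
    pose F i := h`_i * (q ^+ (d + p))`_(d.-1 + l - i).
    rewrite (big_ord_widen_cond _ (fun _ => true) F (leq_addr m.+1 (d.-1 + l).+1)).
    rewrite (big_ord_widen_cond _ (fun i => i <= d.-1 + l)%N F (leq_addl (d.-1 + l).+1 m.+1)).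
    rewrite [LHS](bigID (fun i : 'I_(_ + _) => (i < m.+1)%N)) /= [X in _ + X]big1 ?addr0.
      by apply: eq_bigl => i; rewrite ltnS andbC.
    by move=> i /andP[_ im]; rewrite /F coef_poly (negPf im) mul0r.
  rewrite big_mkcond; apply: eq_bigr => i _; rewrite !mxE hi.
  by case: ifP => _; rewrite ?mulr0 // qc.
have qdvd n : (n <= d + p)%N -> q ^+ (d + p - n) %| f^`(n).
  elim: n => [|n IH] le; first by rewrite subn0 derivn0 dvdp_mulr.
  rewrite derivnS; apply: dvdp_deriv_exp; rewrite subnSK //; apply: IH; exact: ltnW.
have Xdvd : 'X^(m.+1) %| f^`(d.-1).
  apply/dvdpP; exists (\poly_(i < size f) (f^`(d.-1))`_(i + m.+1)).
  apply/polyP => j; rewrite coefMXn; case: ltnP => jm.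
    by rewrite coef_derivn (fz (Ordinal jm)) mul0rn.
  rewrite coef_poly subnK //; case: ltnP => // sf.
  rewrite coef_derivn nth_default ?mul0rn //; apply: (leq_trans sf); exact: leq_trans (leq_subr _ _) (leq_addl _ _).
have cop : coprimep (q ^+ p.+1) 'X^(m.+1).
  apply: coprimep_expl; apply: coprimep_expr; rewrite coprimepX.
  by rewrite /root /q !hornerE oner_eq0.
have both : q ^+ p.+1 * 'X^(m.+1) %| f^`(d.-1).
  rewrite Gauss_dvdp // Xdvd andbT.
  have := qdvd d.-1 (leq_trans (leq_pred _) (leq_addr _ _)).
  by rewrite (_ : d + p - d.-1 = p.+1)%N //; lia.
have q0 n : q ^+ n != 0 by rewrite expf_neq0 // -size_poly_gt0 sq.
have sh : (size h <= m.+1)%N by apply: size_poly.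
have sqn n : size (q ^+ n) = n.+1.
  by rewrite -(prednK (_ : 0 < size (q ^+ n))%N) ?size_poly_gt0 // size_exp sq mul1n.
have sf : (size f <= d + p + m.+1)%N.
  by have := size_polyMleq (q ^+ (d + p)) h; rewrite -/f sqn; lia.
have f0' : f^`(d.-1) = 0.
  apply/eqP; apply: contraT => nz; have := dvdp_leq nz both.
  rewrite size_mul // ?expf_neq0 ?polyX_eq0 // sqn size_polyXn.
  have : (size (f^`(d.-1)) <= size f - d.-1)%N.
    apply/leq_sizeP => j jl; rewrite coef_derivn nth_default ?mul0rn // -leq_subLR; exact: jl.
  by move=> s1 s2; have := leq_trans s2 (leq_trans s1 (leq_sub2r _ sf)); lia.
(* In characteristic 0 the vanishing derivative leaves f of degree less than d - 1, and f is a
   multiple of (1 + u)^(d + p). *)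
have f0 : f = 0.
  apply/eqP; apply: contraT => nz; have : q ^+ (d + p) %| f by rewrite dvdp_mulr.
  move=> /(dvdp_leq nz); rewrite sqn leqNgt; case/negP.
  have : (size f <= d.-1)%N.
    apply/leq_sizeP => j dj; have := congr1 (fun g : {poly rat} => g`_(j - d.-1)) f0'.
    rewrite coef_derivn coef0 subnKC // => /eqP; rewrite mulrn_eq0 => /orP[|/eqP //].
    by rewrite eqn0Ngt ffact_gt0 dj.
  by move=> s1; rewrite ltnS (leq_trans s1) // (leq_trans (leq_pred _)) ?leq_addr.
apply/rowP => i; rewrite mxE -hi.
have /eqP := f0; rewrite mulf_eq0 (negPf (q0 _)) /= => /eqP ->.
by rewrite coef0.
Qed.
End Toeplitz.

(** * Polynomials in the shift, acting on functions of the degree *)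

Section ShiftAction.
Implicit Types (P Q : {poly rat}) (f g : nat -> rat).

Definition act P f (e : nat) : rat := \sum_(i < size P) P`_i * f (e + i)%N.

Lemma act_wide P f e n : (size P <= n)%N -> act P f e = \sum_(i < n) P`_i * f (e + i)%N.
Proof.
move=> le; rewrite /act (big_ord_widen _ (fun i => P`_i * f (e + i)%N) le) big_mkcond.
by apply: eq_bigr => i _; case: ltnP => // h; rewrite nth_default // mul0r.
Qed.

Lemma actD P Q f e : act (P + Q) f e = act P f e + act Q f e.
Proof.
have h1 := leq_maxl (size P) (size Q); have h2 := leq_maxr (size P) (size Q).
rewrite (act_wide (P := P + Q) f e (size_polyD _ _)) (act_wide (P := P) f e h1) (act_wide (P := Q) f e h2) -big_split.
by apply: eq_bigr => i _; rewrite coefD mulrDl.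
Qed.

Lemma actZ c P f e : act (c *: P) f e = c * act P f e.
Proof.
rewrite (act_wide (P := c *: P) f e (size_scale_leq _ _)) mulr_sumr.
by apply: eq_bigr => i _; rewrite coefZ mulrA.
Qed.

Lemma actN P f e : act (- P) f e = - act P f e.
Proof. by rewrite -scaleN1r actZ mulN1r. Qed.

Lemma act0 f e : act 0 f e = 0.
Proof. by rewrite -(scale0r 0) actZ mul0r. Qed.

Lemma actXM P f e : act (P * 'X) f e = act P f e.+1.
Proof.
have le : (size (P * 'X)%R <= (size P).+1)%N.
  by apply: leq_trans (size_polyMleq _ _) _; rewrite size_polyX addn2.
rewrite (act_wide (P := P * 'X) f e le) big_ord_recl coefMX eqxx mul0r add0r.
by apply: eq_bigr => i _; rewrite coefMX /= addSnnS.
Qed.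

Lemma actC c f e : act c%:P f e = c * f e.
Proof.
by rewrite (act_wide (P := c%:P) f e (size_polyC_leq1 _)) big_ord1 coefC addn0.
Qed.

Lemma act1 f e : act 1 f e = f e.
Proof. by rewrite actC mul1r. Qed.

Lemma act_comp P Q f e : act (P * Q) f e = act P (act Q f) e.
Proof.
elim/poly_ind: P e => [|P c IH] e; first by rewrite mul0r !act0.
by rewrite mulrDl !actD mulrAC !actXM IH -[c%:P * _]/(c%:P * Q) mul_polyC actZ actC.
Qed.

Lemma act_ext P f g e : (forall i, f (e + i)%N = g (e + i)%N) -> act P f e = act P g e.
Proof. by move=> fg; apply: eq_bigr => i _; rewrite fg. Qed.

Lemma act_sumr P (I : Type) (r : seq I) (p : pred I) (F : I -> nat -> rat) e :
  act P (fun e => \sum_(i <- r | p i) F i e) e = \sum_(i <- r | p i) act P (F i) e.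
Proof.
by rewrite /act exchange_big; apply: eq_bigr => i _; rewrite mulr_sumr.
Qed.

Definition ez f := exists E, forall e, (E <= e)%N -> f e = 0.

Lemma ez_act P f : ez f -> ez (act P f).
Proof.
case=> E fE; exists E => e le; rewrite /act big1 // => i _.
by rewrite fE ?mulr0 // (leq_trans le) // leq_addr.
Qed.

Lemma ezZ c f : ez f -> ez (fun e => c * f e).
Proof. by case=> E fE; exists E => e le; rewrite fE ?mulr0. Qed.

Lemma ez_ext f g : (forall e, f e = g e) -> ez f -> ez g.
Proof. by move=> fg [E fE]; exists E => e le; rewrite -fg fE. Qed.

Lemma ez_sum n (F : 'I_n -> nat -> rat) :
  (forall i, ez (F i)) -> ez (fun e => \sum_(i < n) F i e).
Proof.
move=> ezF; have /choice[E EF] := ezF; exists (\max_i E i) => e le; rewrite big1 // => i _.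
by apply: EF; apply: leq_trans le; apply: leq_bigmax.
Qed.

(** X - 1 is the difference operator, so this is Pascal's rule. *)
Lemma act_binomial s j e : (j <= s)%N ->
  act (('X - 1) ^+ j) (fun e => 'C(e + s, s)%:R) e = 'C(e + s, s - j)%:R.
Proof.
elim: j e => [|j IH] e js; first by rewrite expr0 act1 subn0.
have D1 g i : act ('X - 1) g i = g i.+1 - g i by rewrite actD actN -['X]mul1r actXM !act1.
rewrite exprS act_comp D1 !IH ?(ltnW js) //.
rewrite -(subnSK js) addSn binS natrD; ring.
Qed.
End ShiftAction.

(** * Elimination at t = -1 *)

Section Numerics.
Variables (d p m r' : nat).
Let a := (d + p)%N.
Let b := (d + m)%N.
Hypothesis d0 : (0 < d)%N.
Variables DD KK : nat -> nat -> nat -> rat.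
Hypothesis DD0 : forall a' e, DD a' 0%N e = 'C(e + r', r')%:R.
Hypothesis KK0 : forall b' e, KK b' 0%N e = 'C(e + r', r')%:R.
Hypothesis DDS : forall a' n e, DD a'.+1 n.+1 e = DD a' n.+1 e + DD a' n e.+1.
Hypothesis KKS : forall b' n e, KK b'.+1 n.+1 e = KK b' n.+1 e + KK b' n e.
Hypothesis DDv : forall n e, (m < n)%N -> DD 0 n e = 0.
Hypothesis KKv : forall n e, (a < n)%N -> KK 0 n e = 0.
Hypothesis DK : forall n, exists E, forall e, (E <= e)%N -> DD a n e = KK b n e.

Let B := (a + b + m).+1.

Let DDV a' n e : (m + a' < n)%N -> DD a' n e = 0.
Proof.
elim: a' n e => [|a' IH] [|n] e lt; rewrite ?addn0 // in lt *; try exact: DDv.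
by rewrite DDS !IH ?addr0 //; lia.
Qed.

Let KKV b' n e : (a + b' < n)%N -> KK b' n e = 0.
Proof.
elim: b' n e => [|b' IH] [|n] e lt; rewrite ?addn0 // in lt *; try exact: KKv.
by rewrite KKS !IH ?addr0 //; lia.
Qed.

(** Up to the sign (-1)^q, the coefficient of (1 + t)^q in the expansion at t = -1 of the sum of the
    F n t^n. *)
Definition moment (F : nat -> rat) q : rat := \sum_(n < B) (-1) ^+ n * 'C(n, q)%:R * F n.

(* The moments of c n + c' (n - 1) in terms of those of c and c'. *)
Let moment_rec (F F' G : nat -> rat) q : F B.-1 = 0 -> F' B.-1 = 0 ->
  G 0%N = F 0%N -> (forall n, G n.+1 = F n.+1 + F' n) ->
  moment G q = moment F q - moment F' q - (if q is q'.+1 then moment F' q' else 0).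
Proof.
move=> FB F'B G0 GS.
have e1 : moment G q = moment F q + \sum_(n < B.-1) (-1) ^+ n.+1 * 'C(n.+1, q)%:R * F' n.
  rewrite /moment !(big_ord_recl B.-1) /= G0 -addrA; congr (_ + _).
  by rewrite -big_split; apply: eq_bigr => i _ /=; rewrite GS mulrDr.
have e2 q' : moment F' q' = \sum_(n < B.-1) (-1) ^+ n * 'C(n, q')%:R * F' n.
  by rewrite /moment (big_ord_recr B.-1) /= F'B mulr0 addr0.
rewrite e1 -addrA; congr (_ + _); case: q {e1} => [|q].
  rewrite e2 subr0 -sumrN; apply: eq_bigr => i _; rewrite !bin0 exprS; ring.
rewrite !e2 -opprD -big_split -sumrN; apply: eq_bigr => i _ /=.
rewrite binS natrD exprS; ring.
Qed.

Let psi a' q e := moment (fun n => DD a' n e) q.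
Let phi b' q e := moment (fun n => KK b' n e) q.

Let psiS a' q e : (a' < a)%N -> psi a'.+1 q e =
  psi a' q e - psi a' q e.+1 - (if q is q'.+1 then psi a' q' e.+1 else 0).
Proof.
move=> lt; rewrite /psi (@moment_rec (fun n => DD a' n e) (fun n => DD a' n e.+1)) //.
- by apply: DDV; rewrite /B /=; lia.
- by apply: DDV; rewrite /B /=; lia.
- by rewrite !DD0.
Qed.

Let phiS b' q e : (b' < b)%N -> phi b'.+1 q e = - (if q is q'.+1 then phi b' q' e else 0).
Proof.
move=> lt; rewrite /phi (@moment_rec (fun n => KK b' n e) (fun n => KK b' n e)) //.
- by rewrite subrr sub0r.
- by apply: KKV; rewrite /B /=; lia.
- by apply: KKV; rewrite /B /=; lia.
- by rewrite !KK0.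
Qed.

(** The generating function of [KK b'] is divisible by (1 + t)^b'. *)
Let phi0 b' q e : (b' <= b)%N -> (q < b')%N -> phi b' q e = 0.
Proof.
elim: b' q => [|b' IH] [|q] // lb lt; rewrite phiS ?oppr0 // IH ?oppr0 //; exact: ltnW.
Qed.

Let psi_ez q : (q < b)%N -> ez (psi a q).
Proof.
move=> qb; have /choice[E EF] := DK; exists (\max_(n < B) E n) => e le.
rewrite -(phi0 e (leqnn b) qb); apply: eq_bigr => n _; congr (_ * _); apply: EF.
by apply: leq_trans le; apply: (@leq_bigmax _ (fun n : 'I_B => E n)).
Qed.

(** The coefficient of (1 + t)^j in (1 + t X)^a', written as ((1 - X) + (1 + t) X)^a', with the sign
    (-1)^j of the moments included. *)
Let coeff a' j : {poly rat} :=
  (-1) ^+ a' *: ('C(a', j)%:R *: (('X - 1) ^+ (a' - j) * 'X^j)).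

Let psiE a' q e : (a' <= a)%N ->
  psi a' q e = \sum_(i < q.+1) act (coeff a' (q - i)) (psi 0 i) e.
Proof.
have c0S j : coeff 0 j.+1 = 0 by rewrite /coeff bin0n scale0r scaler0.
have cS0 a1 : coeff a1.+1 0 = coeff a1 0 - coeff a1 0 * 'X.
  rewrite /coeff !bin0 !subn0 expr0 !mulr1 !scale1r !exprS -!scalerAl.
  by rewrite mulN1r scaleNr -!scalerN -scalerDr; congr (_ *: _); ring.
have cSS a1 j : coeff a1.+1 j.+1 = coeff a1 j.+1 - coeff a1 j.+1 * 'X - coeff a1 j * 'X.
  rewrite /coeff !exprS -!scalerAl mulN1r scaleNr -!scalerN -!scalerDr; congr (_ *: _).
  rewrite subSS; have [lt|ge] := ltnP j a1.
    by rewrite -(subnSK lt) binS natrD scalerDl !exprS -!mul_polyC; ring.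
  rewrite (bin_small (n := a1) (m := j.+1)) ?ltnS // binS (bin_small (n := a1) (m := j.+1)) ?ltnS //.
  rewrite add0n !scale0r add0r; congr (_ *: - _); ring.
elim: a' q e => [|a' IH] q e le.
  rewrite big_ord_recr /= subnn /coeff expr0 !scale1r expr0 mulr1 act1 big1 ?add0r // => i _.
  by rewrite -/(coeff 0 _) -(subnSK (ltn_ord i)) c0S act0.
rewrite psiS // !IH ?(ltnW le) //; case: q => [|q].
  by rewrite !big_ord1 subr0 subnn cS0 actD actN actXM.
rewrite IH ?(ltnW le) // big_ord_recr [X in _ - X - _]big_ord_recr [RHS]big_ord_recr /= !subnn.
rewrite cS0 actD actN actXM opprD !addrA.
rewrite (_ : \sum_(i < q.+1) act (coeff a'.+1 (q.+1 - i)) (psi 0 i) e =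
  \sum_(i < q.+1) act (coeff a' (q.+1 - i)) (psi 0 i) e
  - \sum_(i < q.+1) act (coeff a' (q.+1 - i)) (psi 0 i) e.+1
  - \sum_(i < q.+1) act (coeff a' (q - i)) (psi 0 i) e.+1); first by ring.
rewrite -!sumrB; apply: eq_bigr => i _; rewrite subSn -1?ltnS //.
by rewrite cSS !actD !actN !actXM.
Qed.

Let psi0 q e : (m < q)%N -> psi 0 q e = 0.
Proof.
move=> lt; rewrite /psi /moment big1 // => n _.
have [nm|mn] := leqP n m; first by rewrite bin_small ?mulr0 ?mul0r // (leq_ltn_trans nm).
by rewrite DDv ?mulr0.
Qed.

(** The relation given by the moment of order d - 1 + l is multiplied by (X - 1)^l X^(m - l). Then
    the operator applied to [psi 0 i] depends on l only through a binomial coefficient, which is an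
    entry of [toep]. *)
Let poleG (i : nat) : {poly rat} := ('X - 1) ^+ (p.+1 + i) * 'X^(d.-1 + m - i).

Lemma exponent_bound : (r' <= p + m)%N.
Proof.
have G0 (l : 'I_m.+1) : ez (fun e => \sum_(i < m.+1) toep d p m l i * act (poleG i) (psi 0 i) e).
  have ql : (d.-1 + l < b)%N by rewrite /b; have := ltn_ord l; lia.
  pose Q : {poly rat} := ('X - 1) ^+ l * 'X^(m - l).
  have := ezZ ((-1) ^+ a) (ez_act Q (psi_ez ql)); apply: ez_ext => e.
  rewrite (@act_ext _ _ (fun e => \sum_(i < (d.-1 + l).+1) act (coeff a (d.-1 + l - i)) (psi 0 i) e));
    last by move=> i; rewrite psiE.
  rewrite act_sumr mulr_sumr.
  pose F i := (-1) ^+ a * act (Q * coeff a (d.-1 + l - i)) (psi 0 i) e.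
  transitivity (\sum_(i < m.+1 | (i <= d.-1 + l)%N) F i).
    transitivity (\sum_(i < (d.-1 + l).+1) F i).
      by apply: eq_bigr => i _; rewrite /F act_comp.
    rewrite (big_ord_widen_cond _ (fun _ => true) F (leq_addr m.+1 (d.-1 + l).+1)).
    rewrite (big_ord_widen_cond _ (fun i => i <= d.-1 + l)%N F (leq_addl (d.-1 + l).+1 m.+1)).
    rewrite [LHS](bigID (fun i : 'I_(_ + _) => (i < m.+1)%N)) /= [X in _ + X]big1 ?addr0.
      by apply: eq_bigl => i; rewrite ltnS andbC.
    move=> i /andP[_ im]; rewrite /F /act big1 ?mulr0 // => j _.
    by rewrite psi0 ?mulr0 // ltnNge -ltnS.
  rewrite big_mkcond; apply: eq_bigr => i _; rewrite !mxE.
  case: ifP => le; last by rewrite mul0r.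
  rewrite /F /coeff -!scalerAr !actZ !mulrA -expr2 sqrr_sign mul1r.
  have [big|small] := ltnP (d + p) (d.-1 + l - i).
    by rewrite /a bin_small // !mul0r.
  congr (_ * act _ _ _); rewrite /Q /poleG -[LHS]mulrA mulrACA -!exprD; congr (_ ^+ _ * _ ^+ _).
    by rewrite /a; lia.
  by have := ltn_ord l; have := ltn_ord i; lia.
(* Inverting [toep] isolates each moment [psi 0 i]. *)
have G1 (i : 'I_m.+1) : ez (act (poleG i) (psi 0 i)).
  have := ez_sum (fun l => ezZ ((invmx (toep d p m)) i l) (G0 l)); apply: ez_ext => e.
  transitivity (\sum_(j < m.+1) (invmx (toep d p m) *m toep d p m) i j * act (poleG j) (psi 0 j) e).
    under eq_bigr do rewrite mulr_sumr; rewrite exchange_big; apply: eq_bigr => j _.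
    by rewrite mxE mulr_suml; apply: eq_bigr => l _; rewrite mulrA.
  rewrite mulVmx ?toep_unit // (bigD1 i) //= mxE eqxx mul1r big1 ?addr0 // => j ji.
  by rewrite mxE eq_sym (negPf ji) mul0r.
(* The expansion at t = -1 is evaluated at t = 0. *)
have c0 e : 'C(e + r', r')%:R = \sum_(i < m.+1) (-1) ^+ i * psi 0 i e.
  rewrite -(DD0 0) /psi /moment; under eq_bigr do rewrite mulr_sumr.
  rewrite exchange_big (bigD1 ord0) //= [X in _ + X]big1 ?addr0 => [|n n0].
    rewrite big_ord_recl bin0 !mul1r big1 ?addr0 // => i _.
    by rewrite bin0n /= mulr0 mul0r mulr0.
  have [nm|mn] := leqP n m; last by rewrite big1 // => i _; rewrite DDv ?mulr0.
  transitivity ((-1) ^+ n * DD 0 n e * \sum_(i < m.+1) (-1) ^+ i * 'C(n, i)%:R).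
    by rewrite mulr_sumr; apply: eq_bigr => i _; ring.
  rewrite (_ : \sum_(_ < _) _ = (1 - 1) ^+ n); first by rewrite subrr expr0n -[nat_of_ord n == 0%N]/(n == ord0) (negPf n0) mulr0.
  rewrite exprBn (big_ord_widen _ (fun i => (-1) ^+ i * 1 ^+ (n - i) * 1 ^+ i *+ 'C(n, i))
    (_ : n.+1 <= m.+1)%N) // [LHS](bigID (fun i : 'I_m.+1 => (i < n.+1)%N)) /=.
  rewrite [X in _ + X]big1 ?addr0 => [|i]; last by rewrite -leqNgt => h; rewrite bin_small ?mulr0.
  by apply: eq_bigr => i _; rewrite !expr1n !mulr1 mulr_natr.
have [E Ez] : ez (act (('X - 1) ^+ (p + m).+1 * 'X^(d.-1 + m)) (fun e => 'C(e + r', r')%:R)).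
  have := ez_sum (fun i : 'I_m.+1 => ezZ ((-1) ^+ i)
    (ez_act (('X - 1) ^+ (m - i) * 'X^i) (G1 i))); apply: ez_ext => e.
  rewrite (@act_ext _ _ (fun e => \sum_(i < m.+1) (-1) ^+ i * psi 0 i e)) //.
  rewrite act_sumr; apply: eq_bigr => i _; rewrite -act_comp -actZ.
  have im : (i <= m)%N by rewrite -ltnS.
  rewrite (_ : poleG i = ('X - 1) ^+ (p.+1 + i) * 'X^(d.-1 + m - i)) // mulrACA -!exprD.
  rewrite actZ (_ : (fun e => _) = (fun e => act ((-1) ^+ i)%:P (psi 0 i) e)); last first.
    by apply/funext => x; rewrite actC.
  rewrite -act_comp [_ * _%:P]mulrC mul_polyC actZ; congr (_ * act (_ ^+ _ * _ ^+ _) _ _); lia.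
(* If p + m < r', then (X - 1)^(p + m + 1) turns the Hilbert function of the polynomial ring into a
   binomial coefficient that never vanishes. *)
rewrite leqNgt; apply/negP => lt.
have := Ez E (leqnn _); rewrite mulrC act_comp -(mul1r 'X^_).
set f := act (('X - 1) ^+ _) _.
have actXn n e : act (1 * 'X^n) f e = f (e + n)%N.
  elim: n e => [|n IH] e; first by rewrite expr0 mulr1 act1 addn0.
  by rewrite exprSr mulrA actXM IH addSnnS.
rewrite actXn /f act_binomial //; apply/eqP; rewrite pnatr_eq0 -lt0n bin_gt0; lia.
Qed.
End Numerics.

(** * Constant-rank spaces of matrices *)

Lemma dimP_hom (k : fieldType) r d : dimP (@hom k r.+1 d) 'C(d + r, d).
Proof.
have <- : \dim {:dhomog r.+1 k d} = 'C(d + r, d) by rewrite dimvf.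
apply: (@dimP_vspace _ _ _ (@mpoly_of_dhomog r.+1 k d)) => [x _|v].
  by move=> x0; apply: val_inj.
split=> [hv|[x _ <-]]; last exact: dhomog_is_dhomog.
by exists (DHomog hv); rewrite ?memvf.
Qed.

Lemma hom_det (k : fieldType) r n (M : 'M[{mpoly k[r]}]_n) :
  (forall i j, hom 1 (M i j)) -> hom n (\det M).
Proof.
move=> hM; apply: hom_sum => s _; rewrite /hom rpredMsign.
suff: hom (\sum_(i < n) 1)%N (\prod_i M i (s i)) by rewrite sum_nat_const card_ord muln1.
by rewrite /hom; elim/big_rec2: _ => [|i x e _ IH]; [exact: dhomog1|apply: homM].
Qed.

Lemma hom_adj (k : fieldType) r n (M : 'M[{mpoly k[r]}]_n) i j :
  (forall i j, hom 1 (M i j)) -> hom n.-1 ((\adj M) i j).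
Proof.
move=> hM; rewrite mxE /cofactor /hom rpredMsign; apply: hom_det => i' j'.
by rewrite !mxE.
Qed.

(* On the index set 'I_a + 'I_b the generators inl i have degree 1, and the
   generators inr j degree 0. *)
Definition wt a b (x : 'I_a + 'I_b) : nat := if x is inl _ then 1%N else 0%N.

Section Recursions.
Variables (k : closedFieldType) (r' a b : nat) (A : 'M[{mpoly k[r'.+1]}]_(a, b)).
Local Notation r := r'.+1.
Local Notation R := {mpoly k[r]}.

(** For a' = a this is the image of the square-zero operator, just as [in_ker] is its kernel for b'
    = b. Varying a' and b' allows generators to be added singly. *)
Definition in_rows a' (v : vec k r ('I_a' + 'I_b)%type) :=
  (forall x, v (inl x) = 0) /\ exists u : 'I_a -> R, forall j, v (inr j) = \sum_i u i * A i j.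

Definition in_ker b' (v : vec k r ('I_a + 'I_b')%type) :=
  forall j, \sum_i v (inl i) * A i j = 0.

(** Forms on the sum of R^a' and the cokernel of [A]; for a' = 0, forms on the cokernel. *)
Definition hilbD a' n e : nat := dm (@fam k r n _ (@wt a' b) (fun Y => exists i, in_rows (Y i)) e).
Definition hilbA a' b' n e : nat := dm (@fam k r n _ (@wt a' b') (fun Y => False) e).
(** Subtracted from [hilbA a b'], this counts the restrictions of forms to the sum of Ker A and
    R^b'. *)
Definition hilbK b' n e : nat := dm (@fam k r n _ (@wt a b') (fun Y => forall i, in_ker (Y i)) e).

(** A form without arguments is a single homogeneous polynomial. *)
Lemma dm_fam0 (I : finType) (w : I -> nat) (S : ('I_0 -> vec k r I) -> Prop) e :
  (forall Y, ~ S Y) -> dm (fam w S e) = 'C(e + r', r').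
Proof.
move=> nS; rewrite -(@bin_sub (e + r') r') ?leq_addl // addnK -(dmE (@dimP_hom k r' e)).
have lz (V : lmodType k) : lsub (fun v : V => v = 0).
  by split=> // c u v -> ->; rewrite scaler0 addr0.
have n0 (V : lmodType k) : dm (fun v : V => v = 0) = 0%N by apply: dm_null.
have f0 : {ffun 'I_0 -> I} by apply: finfun => -[].
have fE f : f = f0 by apply/ffunP => -[].
have w0 : (e + \sum_(i < 0) w (f0 i))%N = e by rewrite big_ord0 addn0.
rewrite -[LHS]addn0 -[RHS]addn0 -[X in (_ + X)%N](n0 R) -[X in _ = (_ + X)%N](n0 (tens k r 0 I)).
apply: (@dm_rel _ _ _ _ _ _ _ (fun t : tens k r 0 I => t f0)) => //.
- exact: fam_fd.
- by move=> t ->; case: (fam_lsub w S e).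
- by exists 'C(e + r', e); apply: dimP_hom.
- by move=> t ->; apply: hom0.
- by move=> c t u _ _; rewrite !ffunE.
- by move=> t [/(_ f0)]; rewrite w0.
- move=> t _; split=> [->|t0]; first by rewrite ffunE.
  by apply/ffunP => f; rewrite (fE f) t0 ffunE.
move=> p hp; exists [ffun=> p]; last by rewrite ffunE subrr.
split=> [f||Y /nS //]; first by rewrite ffunE (fE f) w0.
by apply/alt_coefP => f -[].
Qed.

Lemma dm_fam_nil (I : finType) (w : I -> nat) (S : ('I_0 -> vec k r I) -> Prop) e :
  (forall Y, S Y) -> dm (fam w S e) = 0%N.
Proof.
move=> aS; apply: dm_null => t; split=> [[_ _ vt]|->]; last by case: (fam_lsub w S e).
by apply: tens_ext => Y; rewrite ev0 vt.
Qed.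

Lemma dm_fam_small n (I : finType) (w : I -> nat) (S : ('I_n -> vec k r I) -> Prop) e :
  (#|I| < n)%N -> dm (fam w S e) = 0%N.
Proof.
move=> lt; apply: dm_null => t; split=> [[_ /alt_coefP at_ _]|->]; last by case: (fam_lsub w S e).
apply/ffunP => f; rewrite ffunE; have [/injectiveP fi|/injectivePn[i [i' ii' fii']]] := boolP (injectiveb f).
  by have := leq_card f fi; rewrite card_ord leqNgt lt.
by case: (at_ f i i' ii') => ->.
Qed.

Section Left.
Variables (a' b' : nat).
Let J := ('I_a'.+1 + 'I_b')%type.
Let g (x : 'I_a' + 'I_b') : J := match x with inl i => inl (lift ord0 i) | inr j => inr j end.
Let gi (x : J) : option ('I_a' + 'I_b') :=
  match x with inl i => omap inl (unlift ord0 i) | inr j => Some (inr j) end.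

Lemma dm_extend_left n (S1 : ('I_n.+1 -> vec k r ('I_a' + 'I_b')%type) -> Prop)
   (S0 : ('I_n -> vec k r ('I_a' + 'I_b')%type) -> Prop) (SJ : ('I_n.+1 -> vec k r J) -> Prop) :
  (forall Y, S1 Y -> SJ (fun i => emb gi (Y i))) ->
  (forall Y, SJ Y -> S1 (fun i => res g (Y i))) ->
  (forall Y, S0 Y -> SJ (cons_arg (dl k r (inl ord0)) (fun i => emb gi (Y i)))) ->
  (forall Y, SJ Y -> forall i, Y i (inl ord0) = 0 \/ S0 (fun l => res g (Y (lift i l)))) ->
  forall e, dm (fam (@wt a'.+1 b') SJ e) =
    (dm (fam (@wt a' b') S1 e) + dm (fam (@wt a' b') S0 e.+1))%N.
Proof.
move=> h1 h2 h3 h4 e; have := @dm_extend k r n _ J g (inl ord0) gi _ _ _ (@wt a'.+1 b') S1 S0 SJ h1 h2 h3 h4 e.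
rewrite /= addn1; have -> : (fun i => wt (g i)) = @wt a' b' by apply/funext => -[].
apply.
- by move=> [i|j] //=; rewrite liftK.
- by rewrite /= unlift_none.
- by move=> [i|j] //=; case: unliftP => [i' ->|->].
Qed.
End Left.

Section Right.
Variables (a' b' : nat).
Let J := ('I_a' + 'I_b'.+1)%type.
Let g (x : 'I_a' + 'I_b') : J := match x with inl i => inl i | inr j => inr (lift ord0 j) end.
Let gi (x : J) : option ('I_a' + 'I_b') :=
  match x with inl i => Some (inl i) | inr j => omap inr (unlift ord0 j) end.

Lemma dm_extend_right n (S1 : ('I_n.+1 -> vec k r ('I_a' + 'I_b')%type) -> Prop)
   (S0 : ('I_n -> vec k r ('I_a' + 'I_b')%type) -> Prop) (SJ : ('I_n.+1 -> vec k r J) -> Prop) :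
  (forall Y, S1 Y -> SJ (fun i => emb gi (Y i))) ->
  (forall Y, SJ Y -> S1 (fun i => res g (Y i))) ->
  (forall Y, S0 Y -> SJ (cons_arg (dl k r (inr ord0)) (fun i => emb gi (Y i)))) ->
  (forall Y, SJ Y -> forall i, Y i (inr ord0) = 0 \/ S0 (fun l => res g (Y (lift i l)))) ->
  forall e, dm (fam (@wt a' b'.+1) SJ e) =
    (dm (fam (@wt a' b') S1 e) + dm (fam (@wt a' b') S0 e))%N.
Proof.
move=> h1 h2 h3 h4 e; have := @dm_extend k r n _ J g (inr ord0) gi _ _ _ (@wt a' b'.+1) S1 S0 SJ h1 h2 h3 h4 e.
rewrite /= addn0; have -> : (fun i => wt (g i)) = @wt a' b' by apply/funext => -[].
apply.
- by move=> [i|j] //=; rewrite liftK.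
- by rewrite /= unlift_none.
- by move=> [i|j] //=; case: unliftP => [i' ->|->].
Qed.
End Right.

(** The new generator has weight 1, hence the shifted degree in the last summand: the generating
    function is multiplied by 1 + t X. In the two lemmas that follow, the weight is 0 and the factor
    is 1 + t. *)
Lemma hilbDS a' n e : hilbD a'.+1 n.+1 e = (hilbD a' n.+1 e + hilbD a' n e.+1)%N.
Proof.
apply: dm_extend_left.
- move=> Y [i [Y0 [u uE]]]; exists i; split; last by exists u => j; rewrite ffunE.
  by move=> x; rewrite ffunE /=; case: unliftP => //= x' _; apply: Y0.
- move=> Y [i [Y0 [u uE]]]; exists i; split; last by exists u => j; rewrite ffunE.
  by move=> x; rewrite ffunE Y0.
- move=> Y [i [Y0 [u uE]]]; exists (lift ord0 i); rewrite /cons_arg liftK.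
  split; last by exists u => j; rewrite ffunE.
  by move=> x; rewrite ffunE /=; case: unliftP => //= x' _; apply: Y0.
move=> Y [i [Y0 [u uE]]] i'; have [->|/unlift_some[l lE _]] := eqVneq i' i; first by left.
right; exists l; rewrite -lE; split; last by exists u => j; rewrite ffunE.
by move=> x; rewrite ffunE Y0.
Qed.

Lemma hilbAS a' b' n e : hilbA a' b'.+1 n.+1 e = (hilbA a' b' n.+1 e + hilbA a' b' n e)%N.
Proof. by apply: dm_extend_right. Qed.

Lemma hilbKS b' n e : hilbK b'.+1 n.+1 e = (hilbK b' n.+1 e + hilbK b' n e)%N.
Proof.
apply: dm_extend_right.
- by move=> Y H i j; rewrite -[RHS](H i j); apply: eq_bigr => x _; rewrite ffunE.
- by move=> Y H i j; rewrite -[RHS](H i j); apply: eq_bigr => x _; rewrite ffunE.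
- move=> Y H i j; rewrite /cons_arg; case: unliftP => [l|] _.
    by rewrite -[RHS](H l j); apply: eq_bigr => x _; rewrite ffunE.
  by rewrite big1 // => x _; rewrite ffunE mul0r.
move=> Y H i; right=> l j; rewrite -[RHS](H (lift i l) j); apply: eq_bigr => x _.
by rewrite ffunE.
Qed.
End Recursions.

(** * The bound for matrices of linear forms of constant rank *)

Section Westwick.
Variables (k : closedFieldType) (r' a b d : nat) (A : 'M[{mpoly k[r'.+1]}]_(a, b)).
Local Notation r := r'.+1.
Local Notation R := {mpoly k[r]}.
Hypothesis d0 : (0 < d)%N.
Hypothesis hA : forall i j, hom 1 (A i j).
Hypothesis rkA : forall v : 'I_r -> k, (exists i, v i != 0) -> \rank (map_mx (meval v) A) = d.
Local Notation H := (vec k r ('I_a + 'I_b)%type).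

Let rk_le v : (\rank (map_mx (meval v) A) <= d)%N.
Proof.
have [/existsP[i vi]|] := boolP [exists i, v i != 0]; first by rewrite rkA //; exists i.
rewrite negb_exists => /forallP v0; rewrite (_ : map_mx _ _ = 0) ?mxrank0 //.
apply/matrixP => i j; rewrite !mxE.
have [|q _ ->] := @homog_split k r 0 (A i j); first exact: hA.
rewrite rmorph_sum /= big1 // => l _; rewrite mevalM mevalXU.
by have := v0 l; rewrite negbK => /eqP ->; rewrite mul0r.
Qed.

(** Up to multiplication by a nonzero minor of size [d], the basis vectors of its [d] columns are
    redundant modulo the rows of [A]. The remaining b - d basis vectors leave no room for an
    alternating form in more arguments. *)
Lemma hilbD_small n e : (b < n + d)%N -> @hilbD k r' a b A 0 n e = 0%N.
Proof.
move=> lt.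
pose v1 : 'I_r -> k := fun=> 1.
have [f [g dfg]] := minor_exists (rkA (ex_intro (fun i => v1 i != 0) ord0 (oner_neq0 _))).
have ev_det : (\det (mxsub f g A)).@[v1] = \det (mxsub f g (map_mx (meval v1) A)).
  by rewrite -det_map_mx map_mxsub.
have D0 : \det (mxsub f g A) != 0.
  by apply: contra_neq dfg => D0; rewrite -ev_det D0 meval0.
set D := \det _ in D0.
have gi : injective g.
  move=> x y xy; apply/eqP; apply: contraT => nxy; case/eqP: D0.
  rewrite /D -det_tr; rewrite (@determinant_alternate _ _ _ x y) // => i; by rewrite !mxE xy.
apply: dm_null => t; split=> [[_ at_ vt]|->]; last exact: (fam_lsub (@wt 0 b) (fun Y => exists i, in_rows A (Y i)) e).1.
pose L : vec k r ('I_0 + 'I_b)%type -> 'M[R]_(1, d) := fun v =>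
  (\row_l v (inr (g l))) *m \adj (mxsub f g A).
pose im v : vec k r ('I_0 + 'I_b)%type := [ffun x =>
  if x is inr j then \sum_l L v 0 l * A (f l) j else 0].
have im_rows v : in_rows A (im v).
  split=> [[]//|]; exists (fun i => \sum_(l | f l == i) L v 0 l) => j; rewrite ffunE.
  under [RHS]eq_bigr do rewrite mulr_suml.
  rewrite (exchange_big_dep xpredT) //=; apply: eq_bigr => l _.
  by rewrite (big_pred1 (f l)) // => i; rewrite eq_sym.
have imJ (v : vec k r ('I_0 + 'I_b)%type) l : D * v (inr (g l)) = im v (inr (g l)).
  rewrite ffunE; transitivity ((L v *m mxsub f g A) 0 l).
    by rewrite /L -mulmxA mul_adj_mx mul_mx_scalar !mxE.
  by rewrite [LHS]mxE; apply: eq_bigr => i _; rewrite [mxsub _ _ _ _ _]mxE.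
have resJ (v : vec k r ('I_0 + 'I_b)%type) l : (D *: v - im v) (inr (g l)) = 0.
  transitivity (D * v (inr (g l)) - im v (inr (g l))); first by rewrite !ffunE.
  by rewrite imJ subrr.
apply: tens_ext => Y; rewrite ev0.
have Dn : (\prod_(i < n) D) != 0 by rewrite prodf_seq_neq0; apply/allP.
apply/eqP; rewrite -(mulrI_eq0 _ (lregP Dn)) -ev_scale.
have [Z ZE ZJ] : exists2 Z, (forall i, D *: Y i = Z i + im (Y i)) &
    forall i l, Z i (inr (g l)) = 0.
  by exists (fun i => D *: Y i - im (Y i)) => [i|i l]; [rewrite subrK|apply: resJ].
rewrite (eq_ev _ ZE).
rewrite ev_split (bigD1 set0) //= big1 ?addr0 => [|S /set0Pn[i iS]]; last first.
  by apply: vt; exists i; rewrite iS.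
rewrite (eq_ev _ (Y' := Z)); last by move=> i; rewrite inE.
apply/eqP; apply: big1 => h _.
have [/existsP[i /existsP[l /eqP hi]]|noJ] := boolP [exists i, [exists l, h i == inr (g l)]].
  by rewrite (bigD1 i isT) /= hi ZJ mul0r mulr0.
suff /injectivePn[i [i' ii' hii']] : ~~ injectiveb h.
  by move/alt_coefP: at_ => /(_ h i i' ii')[-> //]; rewrite mul0r.
apply/negP => /injectiveP hi.
(* An injective [h] that avoids the columns of the minor would embed n + d elements into [b]. *)
pose F (x : ('I_n + 'I_d)%type) : ('I_0 + 'I_b)%type :=
  match x with inl i => h i | inr l => inr (g l) end.
have nJ i l : h i <> inr (g l).
  by move=> E; case/negP: noJ; apply/existsP; exists i; apply/existsP; exists l; rewrite E.
have Fi : injective F.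
  by move=> [i|l] [i'|l'] //= => [/hi -> | /nJ | /esym /nJ | [/gi ->]].
have := leq_card F Fi; rewrite !card_sum !card_ord; lia.
Qed.

(** The matrix [A] as an endomorphism of R^a + R^b. The weights [wt] make it homogeneous of degree
    0. *)
Definition square_zero (h : H) : H :=
  [ffun x => if x is inr j then \sum_i h (inl i) * A i j else 0].

Lemma square_zero_linear : linear square_zero.
Proof.
move=> c u v; apply/ffunP => -[i|j]; rewrite !ffunE ?scaler0 ?addr0 //.
rewrite scaler_sumr -big_split; apply: eq_bigr => i _.
by rewrite !ffunE mulrDl scalerAl.
Qed.
HB.instance Definition _ := GRing.isLinear.Build _ _ _ _ square_zero square_zero_linear.

Lemma square_zero_hom : ghom (@wt a b) (@wt a b) 0 square_zero.
Proof.
move=> [i|j] [i'|j']; rewrite ffunE; try by left.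
  right; exists 1%N => //; apply: hom_sum => l _; rewrite ffunE.
  by case: eqP => _; rewrite ?mul1r ?mul0r //; apply: hom0.
by left; apply: big1 => l _; rewrite ffunE mul0r.
Qed.

(** The operator [Q] is the adjugate of a minor that does not vanish at [v], placed at the positions
    of that minor, and the required equation is [minor_identity]. *)
Lemma square_zero_section (v : 'I_r -> k) : (exists i, v i != 0) ->
  exists d p (Q : {linear H -> H}), [/\ hom d p, p.@[v] != 0, ghom (@wt a b) (@wt a b) d Q &
    forall h, square_zero (Q (square_zero h)) = p *: square_zero h].
Proof.
move=> v0; have [f [g dfg]] := minor_exists (rkA v0).
have ev_det : (\det (mxsub f g A)).@[v] = \det (mxsub f g (map_mx (meval v) A)).
  by rewrite -det_map_mx map_mxsub.
have D0 : \det (mxsub f g A) != 0.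
  by apply: contra_neq dfg => D0; rewrite -ev_det D0 meval0.
pose Q (h : H) : H := [ffun x => if x is inl i then
   \sum_(l | f l == i) \sum_s h (inr (g s)) * (\adj (mxsub f g A)) s l else 0].
have Ql : linear Q.
  move=> c h h'; apply/ffunP => -[i|j]; rewrite !ffunE ?scaler0 ?addr0 //.
  rewrite scaler_sumr -big_split; apply: eq_bigr => l _.
  rewrite scaler_sumr -big_split; apply: eq_bigr => s _.
  by rewrite !ffunE mulrDl scalerAl.
have hsub i j : hom 1 (mxsub f g A i j) by rewrite mxE.
pose QL : {linear H -> H} := HB.pack Q (GRing.isLinear.Build _ _ _ _ Q Ql).
exists d, (\det (mxsub f g A)), QL; split.
- exact: hom_det.
- by rewrite ev_det.
- move=> [i|j] [i'|j']; rewrite ffunE; try by left.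
    by left; rewrite big1 // => l _; rewrite big1 // => s _; rewrite ffunE mul0r.
  (* Entries of the adjugate have degree d - 1, and the generator they multiply has weight 1. *)
  right; exists d.-1; last by rewrite /= addn1 addn0 prednK.
  apply: hom_sum => l _; apply: hom_sum => s _; rewrite ffunE.
  by case: eqP => _; rewrite ?mul1r ?mul0r; [apply: hom_adj|apply: hom0].
move=> h; apply/ffunP => -[i|j]; rewrite !ffunE ?scaler0 //=.
have /matrixP AE := minor_identity rk_le D0.
transitivity (\sum_i h (inl i) * (\det (mxsub f g A) *: A) i j); last first.
  by rewrite scaler_sumr; apply: eq_bigr => i _; rewrite mxE [RHS]mulrCA.
under [RHS]eq_bigr do rewrite AE mxE mulr_sumr.
rewrite exchange_big /=.
under eq_bigr do rewrite ffunE mulr_suml.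
rewrite (exchange_big_dep xpredT) //=; apply: eq_bigr => l _.
rewrite (big_pred1 (f l)) => [|i]; last by rewrite eq_sym.
under [RHS]eq_bigr do rewrite mxE mulr_suml mulr_sumr.
rewrite exchange_big /= mulr_suml; apply: eq_bigr => s _.
rewrite ffunE !mulr_suml; apply: eq_bigr => i _.
by rewrite !mxE !mulrA.
Qed.

Theorem westwick : (r' + 2 * d <= a + b)%N.
Proof.
have [da db] : (d <= a /\ d <= b)%N.
  have v0 : exists i : 'I_r, (fun=> 1 : k) i != 0 by exists ord0; apply: oner_neq0.
  by rewrite -(rkA v0) rank_leq_row rank_leq_col.
have hilb n : exists e0, forall e, (e0 <= e)%N ->
    (@hilbD k r' a b A a n e + @hilbK k r' a b A b n e = @hilbA k r' a b n e)%N.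
  have [|e0 He] := @square_zero_hilbert k r n _ (@wt a b) square_zero _ square_zero_hom square_zero_section.
    by move=> v; apply/ffunP => -[i|j]; rewrite !ffunE // big1 // => i _; rewrite ffunE mul0r.
  exists e0 => e ee; rewrite /hilbA -(He e ee); congr (_ + _)%N; apply: eq_dm => t; split; apply: fam_mono => Y.
  - move=> [i [h hE]]; exists i; rewrite hE; split=> [x|]; first by rewrite ffunE.
    by exists (fun i => h (inl i)) => j; rewrite ffunE.
  - move=> [i [Y0 [u uE]]]; exists i; exists [ffun x => if x is inl i then u i else 0].
    apply/ffunP => -[x|j]; rewrite !ffunE ?Y0 ?uE //.
    by apply: eq_bigr => l _; rewrite ffunE.
  - move=> H i j; have /ffunP/(_ (inr j)) := H i; by rewrite !ffunE.
  - move=> H i; apply/ffunP => -[x|j]; rewrite !ffunE //; exact: H.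
have [p aE] : exists p, (a = d + p)%N by exists (a - d)%N; rewrite subnKC.
have [m bE] : exists m, (b = d + m)%N by exists (b - d)%N; rewrite subnKC.
suff : (r' <= p + m)%N by lia.
(* As [KK] counts the restrictions to the sum of Ker A and R^b', the sum formula for Hilbert
   functions says that [DD a n] and [KK b n] agree in large degrees. *)
apply: (@exponent_bound d p m r' d0 (fun a' n e => (@hilbD k r' a b A a' n e)%:R)
  (fun b' n e => (@hilbA k r' a b' n e)%:R - (@hilbK k r' a b A b' n e)%:R)).
- by move=> a' e; rewrite /hilbD dm_fam0 // => Y [[]].
- move=> b' e; have -> : @hilbK k r' a b A b' 0 e = 0%N by apply: dm_fam_nil => Y [].
  by rewrite subr0 /hilbA dm_fam0 // => Y [].
- by move=> a' n e; rewrite hilbDS natrD.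
- by move=> b' n e; rewrite hilbAS hilbKS !natrD opprD addrACA.
- by move=> n e lt; rewrite hilbD_small //; lia.
- move=> n e lt; rewrite /hilbA /hilbK !dm_fam_small ?subr0 //.
    by rewrite card_sum !card_ord; lia.
  by rewrite card_sum !card_ord; lia.
move=> n; have [e0 He] := hilb n; exists e0 => e /He E.
by rewrite -aE -bE -E natrD addrK.
Qed.
End Westwick.

(** * Generic ranks of pencils *)

Section Spaces.
Import VectorInternalTheory.
Variables (k : fieldType).
Implicit Types (V W : vectType k).

(** An endomorphism with kernel [U]; its image serves as the quotient W/U. *)
Definition killv W (U : {vspace W}) : 'End(W) := (\1 - projv U)%VF.

Lemma killvE W (U : {vspace W}) w : killv U w = w - projv U w.
Proof. by rewrite add_lfunE opp_lfunE id_lfunE. Qed.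

Lemma lker_killv W (U : {vspace W}) : lker (killv U) = U.
Proof.
apply/vspaceP => w; rewrite memv_ker killvE subr_eq0; apply/eqP/idP => [->|/projv_id -> //].
exact: memv_proj.
Qed.

Lemma dim_killv W (U Y : {vspace W}) : (\dim (Y + U) = \dim U + \dim (killv U @: Y))%N.
Proof.
have := limg_ker_dim (killv U) Y; rewrite lker_killv => E.
by have := dimv_add_leqif Y U => _; have := dimv_sum_cap Y U; lia.
Qed.

Lemma comp_img V W (Z : vectType k) (g : 'Hom(W, Z)) (f : 'Hom(V, W)) X :
  ((g \o f) @: X = g @: (f @: X))%VS.
Proof. exact: limg_comp. Qed.

Lemma dim_img_mod V W (f : 'Hom(V, W)) X (U : {vspace W}) :
  (\dim (f @: X + U) + \dim (X :&: lker (killv U \o f)) = \dim U + \dim X)%N.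
Proof. by rewrite dim_killv -comp_img -[in RHS](limg_ker_dim (killv U \o f) X); lia. Qed.

Lemma memv_ker_kill V W (f : 'Hom(V, W)) (U : {vspace W}) v :
  (v \in lker (killv U \o f)) = (f v \in U).
Proof. by rewrite memv_ker comp_lfunE -memv_ker lker_killv. Qed.

(** On a complement in [X] of its kernel, [f] modulo [U] has a left inverse rho. If g - mu f is not
    injective on this complement modulo [U], then mu is an eigenvalue of rho g, so a characteristic
    polynomial serves as [p]. *)
Lemma generic_dim V W (f g : 'Hom(V, W)) X (U : {vspace W}) :
  exists2 p : {poly k}, p != 0 & forall mu, ~~ root p mu ->
    (\dim (f @: X + U) <= \dim ((g - mu *: f)%VF @: X + U))%N.
Proof.
pose f1 := (killv U \o f)%VF; pose g1 := (killv U \o g)%VF.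
pose X' := (X :\: lker f1)%VS.
have inj v : v \in X' -> f1 v = 0 -> v = 0.
  move=> vX fv; apply/eqP; rewrite -memv0 -(capv_diff X (lker f1)) memv_cap vX.
  by rewrite memv_ker fv /=.
pose f2 := (f1 \o projv X')%VF; pose rho := (projv X' \o f2^-1)%VF.
have f2E u : f2 u = f1 (projv X' u) by apply: comp_lfunE.
have rhoE u : rho u = projv X' (f2^-1%VF u) by apply: comp_lfunE.
have rhoK v : v \in X' -> rho (f1 v) = v.
  move=> vX; apply/eqP; rewrite -subr_eq0; apply/eqP/inj.
    by rewrite memvB // rhoE memv_proj.
  have f12 : f1 v = f2 v by rewrite f2E projv_id.
  rewrite linearB /= rhoE -f2E f12 limg_lfunVK ?subrr //; exact: memv_img (memvf v).
exists (char_poly (f2mx (rho \o g1))); first exact: monic_neq0 (char_poly_monic _).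
move=> mu; rewrite -eigenvalue_root_char => nev.
rewrite !dim_killv leq_add2l -!comp_img -/f1.
rewrite -limg_ker_compl limg_dim_eq ?capv_diff // -/X'.
set h := (killv U \o _)%VF.
rewrite -(_ : \dim (h @: X') = \dim X') ?dimvS ?limgS ?diffvSl // limg_dim_eq //.
apply/eqP; rewrite -subv0; apply/subvP => v; rewrite memv_cap memv_ker memv0 => /andP[vX /eqP hv].
apply: contraNT nev => v0; apply/eigenvalueP; exists (v2r v); last first.
  by apply: contra_neq v0 => /(congr1 r2v); rewrite v2rK linear0.
have gv : g1 v = mu *: f1 v.
  apply/eqP; rewrite -subr_eq0 -hv !comp_lfunE add_lfunE opp_lfunE scale_lfunE.
  rewrite linearB; apply/eqP; congr (_ - _); by rewrite linearZ.
have : (rho \o g1)%VF v = mu *: v by rewrite comp_lfunE gv linearZ /= rhoK.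
by move/(congr1 v2r); rewrite linearZ /= => <-; rewrite unlock /= r2vK.
Qed.
End Spaces.

Section SpacesMore.
Variables (k : fieldType) (V W : vectType k).
Implicit Types (f g : 'Hom(V, W)) (X : {vspace V}) (U : {vspace W}).

Lemma memv_img_add f X U z :
  z \in (f @: X + U)%VS <-> exists2 x, x \in X & z - f x \in U.
Proof.
split=> [/memv_addP[y /memv_imgP[x xX ->] [u uU ->]]|[x xX zU]].
  by exists x => //; rewrite addrC addKr.
apply/memv_addP; exists (f x); first exact: memv_img.
by exists (z - f x) => //; rewrite addrC subrK.
Qed.

Lemma common_kernel (I : finType) (P : pred I) (h : I -> 'Hom(V, W)) X :
  exists Y, [/\ (Y <= X)%VS, forall i v, P i -> v \in Y -> h i v = 0 &
    (\dim X <= \dim Y + \sum_(i | P i) \dim (h i @: X))%N].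
Proof.
exists (X :&: \bigcap_(i | P i) lker (h i))%VS; split; first exact: capvSl.
  move=> i v Pi; rewrite memv_cap => /andP[_ /subv_bigcapP].
  by move=> /(_ i Pi); rewrite -memvE memv_ker => /eqP.
elim/big_rec2: _ => [|i n Z Pi IH]; first by rewrite capvf addn0.
apply: leq_trans IH _; rewrite addnA leq_add2r.
rewrite [(lker _ :&: Z)%VS]capvC capvA.
by rewrite -(limg_ker_dim (h i) (X :&: Z)) leq_add2l dimvS // limgS // capvSl.
Qed.

Lemma dim_add_line (X : {vspace V}) v : v \notin X -> \dim (X + <[v]>) = (\dim X).+1.
Proof.
move=> vX; have := dimv_sum_cap X <[v]>%VS; rewrite dim_vline.
have -> : (v != 0) by apply: contraNneq vX => ->; apply: mem0v.
suff -> : (X :&: <[v]> = 0)%VS by rewrite dimv0; lia.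
apply/eqP; rewrite -subv0; apply/subvP => x; rewrite memv_cap => /andP[xX /vlineP[c xE]].
move: xX; rewrite xE; have [->|c0] := eqVneq c 0; first by rewrite scale0r => _; apply: mem0v.
by rewrite rpredZeq (negPf c0) (negPf vX).
Qed.
Lemma hyperplane X X' : (X' <= X)%VS -> (\dim X' < \dim X)%N ->
  exists H, [/\ (X' <= H)%VS, (H <= X)%VS & (\dim H).+1 = \dim X].
Proof.
move=> X'X lt; elim: {lt}(\dim X - \dim X').-1 {-2}X' X'X (erefl (\dim X - \dim X').-1) lt
  => [|n IH] Y YX E lt; first by exists Y; split=> //; lia.
have [v vX vY] : exists2 v, v \in X & v \notin Y.
  by apply/subvPn; apply: contraL lt => /dimvS; rewrite -leqNgt.
have dY := dim_add_line vY.
have sub : (Y + <[v]> <= X)%VS by rewrite subv_add YX -memvE.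
have [||H [h1 h2 h3]] := IH _ sub; rewrite ?dY; [lia|lia|].
by exists H; split=> //; apply: subv_trans h1; apply: addvSl.
Qed.


Lemma dim_sum_mod (I : finType) (P : pred I) (A : I -> {vspace V}) (Z : {vspace V}) :
  (\dim (Z + \sum_(i | P i) A i) <=
   \dim Z + \sum_(i | P i) (\dim (Z + A i) - \dim Z))%N.
Proof.
elim/big_rec2: _ => [|i n Y Pi IH]; first by rewrite addv0 addn0.
rewrite addvA [(Z + A i)%VS]addvC -addvA.
have := dimv_sum_cap (A i) (Z + Y)%VS; have := dimv_sum_cap (A i) Z.
have /dimvS : (A i :&: Z <= A i :&: (Z + Y))%VS by rewrite capvS // addvSl.
by have /dimvS := addvSr (A i) Z; lia.
Qed.
End SpacesMore.

Section Generic.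
Variables (k : closedFieldType) (V W : vectType k).
Implicit Types (f g : 'Hom(V, W)) (X : {vspace V}) (U : {vspace W}).

(** Modulo U + <z> the rank of [f] is at most that of g - mu f for a general mu, where z contributes
    nothing. As [f] has maximal rank modulo [U], z contributes nothing to it either. *)
Lemma generic_mem f g X U z :
  (forall mu, (\dim ((g - mu *: f)%VF @: X + U) <= \dim (f @: X + U))%N) ->
  (forall mu, z \in ((g - mu *: f)%VF @: X + U)%VS) -> z \in (f @: X + U)%VS.
Proof.
move=> le zin; have [p p0 H] := generic_dim f g X (U + <[z]>)%VS.
have [mu /H] := closed_nonrootP p p0; rewrite !addvA.
rewrite [X in (_ <= \dim X)%N](_ : _ = ((g - mu *: f)%VF @: X + U)%VS); last first.
  by apply/addv_idPl; rewrite -memvE.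
move=> h; have := leq_trans h (le mu); apply: contraTT => zN.
by rewrite dim_add_line // ltnn.
Qed.
End Generic.

Section Pencil.
Variables (k : fieldType) (r : nat) (M : krep k r).

Lemma pencilE y v : pencil M y v = \sum_i y 0 i *: arr M i v.
Proof. by rewrite /pencil sum_lfunE; apply: eq_bigr => i _; rewrite scale_lfunE. Qed.

Lemma pencil_delta i : pencil M (delta_mx 0 i) = arr M i.
Proof.
rewrite /pencil (bigD1 i) //= big1 => [|j ji]; first by rewrite mxE !eqxx scale1r addr0.
by rewrite mxE (negPf ji) andbF scale0r.
Qed.

Lemma pencilB y z mu : pencil M (z - mu *: y) = pencil M z - mu *: pencil M y.
Proof.
rewrite /pencil scaler_sumr -sumrB; apply: eq_bigr => i _.
by rewrite !mxE scalerBl scalerA.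
Qed.

Lemma pencil_sub (U : subspaces M) y v : is_subrep U -> v \in U.1 -> pencil M y v \in U.2.
Proof.
move=> sU vU; rewrite pencilE memv_suml // => i _; apply: memvZ.
by apply: (subvP (sU i)); apply: memv_img.
Qed.
End Pencil.

(** * Splitting off small subrepresentations and quotients numerically *)

Section Strip.
Variables (k : closedFieldType) (r : nat) (M : krep k r).
Implicit Types (U W : subspaces M) (y z x : 'rV[k]_r).
Local Notation pen := (pencil M).

(* The representation (W1, V2 / U2) has generic rank d. *)
Definition has_grank (W1 : {vspace V1 M}) (U2 : {vspace V2 M}) d :=
  (exists2 x : 'rV[k]_r, x != 0 & \dim (pen x @: W1 + U2) = (d + \dim U2)%N) /\
  (forall y, (\dim (pen y @: W1 + U2) <= d + \dim U2)%N).

(* Semicontinuity: it suffices to bound the ranks away from a hyperplane. *)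
Lemma grank_bound (W1 : {vspace V1 M}) (U2 : {vspace V2 M}) (eta : 'rV[k]_r -> k) n l :
  (forall y z mu, eta (z - mu *: y) = eta z - mu * eta y) -> eta l != 0 ->
  (forall y, eta y != 0 -> (\dim (pen y @: W1 + U2) <= n)%N) ->
  forall y, (\dim (pen y @: W1 + U2) <= n)%N.
Proof.
move=> etaB l0 H y; have [y0|] := eqVneq (eta y) 0; last exact: H.
have [p p0 Hp] := generic_dim (pen y) (pen l) W1 U2.
have [mu /Hp] := closed_nonrootP p p0; rewrite -pencilB => h; apply: leq_trans h _.
by apply: H; rewrite etaB y0 mulr0 subr0.
Qed.

Section Step.
Variables (U W : subspaces M) (d : nat) (x : 'rV[k]_r) (j l : 'I_r).
Hypotheses (sU : is_subrep U) (sW : is_subrep W) (UW1 : (U.1 <= W.1)%VS) (UW2 : (U.2 <= W.2)%VS).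
Hypotheses (xj : x 0 j != 0) (lj : l != j).
Hypothesis xd : \dim (pen x @: W.1 + U.2) = (d + \dim U.2)%N.
Hypothesis led : forall y, (\dim (pen y @: W.1 + U.2) <= d + \dim U.2)%N.
Let f := pen x.
Let K := (W.1 :&: lker (killv U.2 \o f))%VS.
Let I := (f @: W.1 + U.2)%VS.

Let KP v : v \in K <-> v \in W.1 /\ f v \in U.2.
Proof. by rewrite memv_cap memv_ker_kill; split=> [/andP|[-> ->]]. Qed.

Let x0 : x != 0.
Proof. by apply: contraNneq xj => ->; rewrite mxE. Qed.

Let dimK : (\dim K + d = \dim W.1)%N.
Proof. by have := dim_img_mod f W.1 U.2; rewrite xd -/K; lia. Qed.

Let in_I t (z : V2 M) : (forall mu, z \in ((pen t - mu *: f)%VF @: W.1 + U.2)%VS) -> z \in I.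
Proof.
apply: generic_mem => mu; rewrite -[(_ - _)%VF]/(pen t - mu *: pen x) -pencilB.
by rewrite xd; apply: led.
Qed.

(** Modulo U_2, the vector pen t kap is the image of [kap] under pen t - mu f for every mu. *)
Let KI t kap : kap \in K -> pen t kap \in I.
Proof.
case/KP => kW fk; apply: (@in_I t) => mu; apply/memv_img_add; exists kap => //.
by rewrite add_lfunE opp_lfunE scale_lfunE opprB addrC subrK memvZ.
Qed.

(** Modulo U_2, the vector pen t w is the image of w + mu kap under pen t - mu f for every mu. *)
Let KKI t kap w : kap \in K -> w \in W.1 -> pen t kap - f w \in U.2 -> pen t w \in I.
Proof.
case/KP => kW fk wW h; apply: (@in_I t) => mu; apply/memv_img_add.
exists (w + mu *: kap); first by rewrite memvD ?memvZ.
have -> : pen t w - (pen t - mu *: f)%VF (w + mu *: kap) =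
    (mu * mu) *: f kap - mu *: (pen t kap - f w).
  have e1 (g : 'Hom(V1 M, V2 M)) : g (w + mu *: kap) = g w + mu *: g kap by rewrite linearD linearZ.
  rewrite add_lfunE opp_lfunE scale_lfunE !e1 opprB addrCA opprD addNKr.
  by rewrite scalerDr scalerA scalerBr opprB -addrA addrCA.
by rewrite memvB // memvZ.
Qed.

(** Let W' consist of the vectors of W_1 that pen t sends into I. Its codimension is the rank of the
    map induced on W_1/K. It contains K, and by [KKI] its image under f contains that of K under pen
    t, modulo U_2. So the two ranks add up to at most dim W_1 - dim K = d. *)
Let betachi t :
  (\dim ((killv U.2 \o pen t) @: K) + \dim (I + pen t @: W.1) <= d + \dim I)%N.
Proof.
pose W' := (W.1 :&: lker (killv I \o pen t))%VS.
have W'P w : w \in W' <-> w \in W.1 /\ pen t w \in I.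
  by rewrite memv_cap memv_ker_kill; split=> [/andP|[-> ->]].
have KW' : (K <= W')%VS by apply/subvP => v vK; apply/W'P; split; [case/KP: vK|apply: KI].
have E1 := dim_img_mod (pen t) W.1 I; rewrite -/W' addvC in E1.
have E2 := limg_ker_dim (killv U.2 \o f) W'.
have E3 : (\dim K <= \dim (W' :&: lker (killv U.2 \o f)))%N.
  by rewrite dimvS // subv_cap KW' capvSr.
have E4 : (\dim ((killv U.2 \o pen t) @: K) <= \dim ((killv U.2 \o f) @: W'))%N.
  rewrite dimvS //; apply/subvP => _ /memv_imgP[kap kK ->].
  have /memv_img_add[w wW h] := KI t kK.
  have -> : (killv U.2 \o pen t)%VF kap = (killv U.2 \o f)%VF w.
    apply/eqP; rewrite -subr_eq0 !comp_lfunE -linearB /= -memv_ker lker_killv //.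
  by apply: memv_img; apply/W'P; split=> //; apply: KKI kK wW h.
by lia.
Qed.

(** The coefficient of the l-th basis vector when [y] is expressed in the basis of k^r with [x] in
    place of the j-th one. *)
Let eta y : k := y 0 l - y 0 j * (x 0 l / x 0 j).

Let etaB y z mu : eta (z - mu *: y) = eta z - mu * eta y.
Proof. by rewrite /eta !mxE; ring. Qed.

Let eta_l : eta (delta_mx 0 l) != 0.
Proof. by rewrite /eta !mxE !eqxx /= [j == l]eq_sym (negPf lj) mul0r subr0 oner_neq0. Qed.

(* If all arrows but j, l and the combination x send v into Z, then all
   combinations y send v to multiples of arr l v modulo Z. *)
Let pen_mod (Z : {vspace V2 M}) v y :
  f v \in Z -> (forall i, i != j -> i != l -> arr M i v \in Z) ->
  pen y v - eta y *: arr M l v \in Z.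
Proof.
move=> fZ aZ.
pose S y' := \sum_(i | (i != j) && (i != l)) y' 0 i *: arr M i v.
have splitE y' : pen y' v = y' 0 j *: arr M j v + (y' 0 l *: arr M l v + S y').
  by rewrite pencilE (bigD1 j) //= (bigD1 l).
have SZ y' : S y' \in Z.
  by apply: memv_suml => i /andP[ij il]; apply: memvZ; apply: aZ.
have jZ : arr M j v + (x 0 l / x 0 j) *: arr M l v \in Z.
  have := memvZ (x 0 j)^-1 (memvB fZ (SZ x)).
  rewrite /f splitE addrA addrK scalerDr !scalerA mulVf // scale1r.
  by rewrite [_^-1 * _]mulrC.
have -> : pen y v - eta y *: arr M l v =
    y 0 j *: (arr M j v + (x 0 l / x 0 j) *: arr M l v) + S y.
  apply/eqP; rewrite subr_eq splitE scalerDr scalerA -!addrA; apply/eqP; congr (_ + _).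
  by rewrite [S y + _]addrC addrA -scalerDl; congr (_ *: _ + _); rewrite /eta; ring.
by rewrite memvD ?memvZ.
Qed.


Definition stripped U' W' d' := [/\ is_subrep U', is_subrep W', (U'.1 <= W'.1)%VS /\ (U'.2 <= W'.2)%VS
  & has_grank W'.1 U'.2 d'].

Let away (i : 'I_r) := (i != j) && (i != l).

(** By dimension, some v in K outside U_1 is killed modulo U_2 by the arrows other than j and l, as
    well as by f. It is adjoined to U together with w = arr l v. If w is new, it lies in the image
    of pen y whenever eta y is nonzero, so the generic rank drops by one. *)
Lemma strip_bottom :
  (\dim U.1 + \sum_(i | away i) \dim ((killv U.2 \o arr M i) @: K) < \dim K)%N ->
  exists U' e, [/\ \dim U'.1 = (\dim U.1).+1, \dim U'.2 = (\dim U.2 + e)%N,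
    (e <= d)%N & stripped U' W (d - e)].
Proof.
move=> lt; have [Y [YK Y0 dY]] := common_kernel away (fun i => killv U.2 \o arr M i)%VF K.
have [v vY vU] : exists2 v, v \in Y & v \notin U.1.
  apply/subvPn; apply: contraL (leq_trans lt dY) => /dimvS; rewrite -leqNgt.
  by rewrite leq_add2r.
have /KP[vW fv] := subvP YK _ vY.
have av i : i != j -> i != l -> arr M i v \in U.2.
  move=> ij il; rewrite -memv_ker_kill memv_ker; apply/eqP/Y0 => //; exact/andP.
have pv y := pen_mod y fv av.
set w := arr M l v in pv.
have wW : w \in W.2 by apply: (subvP (sW l)); apply: memv_img.
pose U' : subspaces M := (U.1 + <[v]>, U.2 + <[w]>)%VS.
have sU' : is_subrep U'.
  move=> i; rewrite limgD subv_add (subv_trans (sU i)) ?addvSl //= limg_line -memvE.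
  have := pv (delta_mx 0 i); rewrite pencil_delta => h.
  by rewrite -[arr M i v](subrK (eta (delta_mx 0 i) *: w)) memv_add // memvZ // memv_line.
have U'W : (U'.1 <= W.1)%VS /\ (U'.2 <= W.2)%VS.
  by rewrite /= !subv_add UW1 UW2 -!memvE vW wW.
have d1 : \dim U'.1 = (\dim U.1).+1 by apply: dim_add_line.
have im_w y : eta y != 0 -> w \in (pen y @: W.1 + U.2)%VS.
  move=> ey; apply/memv_img_add; exists ((eta y)^-1 *: v); first exact: memvZ.
  rewrite linearZ /= -[w](scalerK ey) -scalerBr memvZ // -opprB memvN //.
have [wU|wU] := boolP (w \in U.2).
  have E2 : (U.2 + <[w]>)%VS = U.2 by apply/addv_idPl; rewrite -memvE.
  exists U', 0%N; rewrite /= E2 addn0 subn0; split=> //; split=> //=.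
  by rewrite E2; split; [exists x|].
have d2 : \dim (U.2 + <[w]>) = (\dim U.2).+1 by apply: dim_add_line.
have bound y : (\dim (pen y @: W.1 + (U.2 + <[w]>)) <= d + \dim U.2)%N.
  move: y; apply: (grank_bound etaB eta_l) => y ey; rewrite addvA.
  by rewrite (_ : _ + <[w]> = pen y @: W.1 + U.2)%VS ?led //; apply/addv_idPl; rewrite -memvE im_w.
have dpos : (0 < d)%N.
  have /dimvS : (U.2 + <[w]> <= pen (delta_mx 0 l) @: W.1 + U.2)%VS.
    by rewrite subv_add addvSr -memvE im_w.
  by rewrite d2 => /leq_trans/(_ (led _)); rewrite -add1n leq_add2r.
have dE : (d - 1 + (\dim U.2).+1 = d + \dim U.2)%N by rewrite -addSnnS subn1 prednK.
exists U', 1%N; rewrite /= d2 addn1; split=> //; split=> //; split=> [|y] /=; rewrite d2 dE //.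
by exists x => //; apply/eqP; rewrite eqn_leq bound /= -xd dimvS // addvS // addvSl.
Qed.

(** Dual to [strip_bottom]: W_2 is replaced by a hyperplane H that contains I and the images of the
    arrows other than j and l, and W_1 by the vectors that arr l sends into H. *)
Lemma strip_top :
  (\dim I + \sum_(i | away i) (\dim (I + arr M i @: W.1) - \dim I) < \dim W.2)%N ->
  exists W' e, [/\ (\dim W'.1 + e)%N = \dim W.1, (\dim W'.2).+1 = \dim W.2,
    (e <= d)%N & stripped U W' (d - e)].
Proof.
move=> lt; pose S := (I + \sum_(i | away i) arr M i @: W.1)%VS.
have imW y : (pen y @: W.1 <= W.2)%VS.
  by apply/subvP => _ /memv_imgP[w wW ->]; apply: pencil_sub.
have IW : (I <= W.2)%VS by rewrite subv_add UW2 imW.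
have SW : (S <= W.2)%VS by rewrite subv_add IW; apply/subv_sumP.
have dS : (\dim S <= \dim I + \sum_(i | away i) (\dim (I + arr M i @: W.1) - \dim I))%N.
  exact: dim_sum_mod.
have [H [SH HW dH]] := hyperplane SW (leq_ltn_trans dS lt).
have IH : (I <= H)%VS by apply: subv_trans SH; apply: addvSl.
have UH : (U.2 <= H)%VS by apply: subv_trans IH; apply: addvSr.
pose W1' := (W.1 :&: lker (killv H \o arr M l))%VS.
have W1'P w : w \in W1' <-> w \in W.1 /\ arr M l w \in H.
  by rewrite memv_cap memv_ker_kill; split=> [/andP|[-> ->]].
have fH w : w \in W.1 -> f w \in H.
  move=> wW; apply: (subvP IH); apply: (subvP (addvSl _ _)); exact: memv_img.
have aH i w : w \in W.1 -> i != j -> i != l -> arr M i w \in H.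
  move=> wW ij il; apply: (subvP SH); apply: (subvP (addvSr _ _)).
  apply: (subvP (sumv_sup i _ (subvv _))); first exact/andP.
  exact: memv_img.
have pH w y (wW : w \in W.1) := pen_mod y (fH w wW) (fun i => aH i w wW).
pose W' : subspaces M := (W1', H).
have sW' : is_subrep W'.
  move=> i; apply/subvP => _ /memv_imgP[w /W1'P[wW lw] ->].
  have := pH w (delta_mx 0 i) wW; rewrite pencil_delta => h.
  by rewrite -[arr M i w](subrK (eta (delta_mx 0 i) *: arr M l w)) memvD // memvZ.
have UW' : (U.1 <= W'.1)%VS /\ (U.2 <= W'.2)%VS.
  split=> //; apply/subvP => u uU; apply/W1'P; split; first exact: (subvP UW1).
  by apply: (subvP UH); apply: (subvP (sU l)); apply: memv_img.
have [lH|] := boolP (arr M l @: W.1 <= H)%VS.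
  have E1 : W1' = W.1.
    apply/eqP; rewrite eqEsubv capvSl; apply/subvP => w wW; apply/W1'P; split=> //.
    by apply: (subvP lH); apply: memv_img.
  exists W', 0%N; rewrite /= E1 addn0 subn0; split=> //; split=> //=.
  by rewrite E1; split; [exists x|].
case/subvPn => _ /memv_imgP[w0 w0W ->] w0H.
have ey_out y : eta y != 0 -> pen y w0 \notin H.
  move=> ey; apply: contra w0H => yH; rewrite -(scalerK ey (arr M l w0)) memvZ //.
  rewrite -[_ *: _](subKr (pen y w0)) memvB //; exact: pH.
have dW1 : (\dim W1').+1 = \dim W.1.
  have w0W1 : w0 \notin W1' by apply/negP => /W1'P[_]; apply/negP.
  apply/eqP; rewrite eqn_leq -{1}(dim_add_line w0W1) dimvS /=; last first.
    by rewrite subv_add capvSl -memvE.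
  have := dim_img_mod (arr M l) W.1 H; rewrite -/W1' => E.
  have /dimvS : (arr M l @: W.1 + H <= W.2)%VS.
    by rewrite subv_add HW andbT; apply: sW.
  by rewrite -dH -(leq_add2l (\dim H) (\dim W.1)) -E addnS -addSn leq_add2r.
have W1E : W.1 = (W1' + <[w0]>)%VS.
  apply/esym/eqP; rewrite eqEdim subv_add capvSl -memvE w0W /= -dW1 dim_add_line //.
  by apply/negP => /W1'P[_]; apply/negP.
have bound y : (\dim (pen y @: W1' + U.2) <= d + \dim U.2 - 1)%N.
  move: y; apply: (grank_bound etaB eta_l) => y ey.
  have yH : (pen y @: W1' + U.2 <= H)%VS.
    rewrite subv_add UH andbT; apply/subvP => _ /memv_imgP[w wW ->]; exact: (pencil_sub y sW').
  suff lt' : (\dim (pen y @: W1' + U.2) < \dim (pen y @: W.1 + U.2))%N.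
    by move: (leq_trans lt' (led y)); rewrite subn1; case: (d + _)%N.
  rewrite ltn_neqAle dimvS ?addvS ?limgS ?capvSl // andbT.
  apply/negP => /eqP E; case/negP: (ey_out y ey); apply: (subvP yH).
  have /eqP -> : (pen y @: W1' + U.2 == pen y @: W.1 + U.2)%VS.
    by rewrite eqEdim addvS ?limgS ?capvSl // E leqnn.
  by apply: (subvP (addvSl _ _)); apply: memv_img.
have dx : (d + \dim U.2 <= (\dim (pen x @: W1' + U.2)).+1)%N.
  rewrite -xd W1E limgD limg_line -addvA [(<[_]> + _)%VS]addvC addvA.
  by rewrite (leq_trans (dimv_add_leqif _ _)) // -addn1 leq_add2l dim_vline; case: eqP.
have dpos : (0 < d)%N.
  pose t : 'rV[k]_r := delta_mx 0 l.
  have o : pen t w0 \notin U.2.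
    by apply: contra (ey_out _ eta_l); apply: (subvP UH).
  have /dimvS : (U.2 + <[pen t w0]> <= pen t @: W.1 + U.2)%VS.
    by rewrite subv_add addvSr -memvE (subvP (addvSl _ _)) // memv_img.
  by rewrite dim_add_line // => /leq_trans/(_ (led _)); rewrite -add1n leq_add2r.
have dE : (d - 1 + \dim U.2 = d + \dim U.2 - 1)%N by rewrite addnC addnBA // addnC.
exists W', 1%N; rewrite /= addn1; split=> //; split=> //; split=> [|y] /=; rewrite dE //.
by exists x => //; apply/eqP; rewrite eqn_leq bound /= leq_subLR add1n.
Qed.

(** By [betachi] the two sums over the r - 2 arrows other than j and l total at most (r - 2) d, so
    one of [strip_bottom] and [strip_top] applies. The last equation keeps track of the generic
    rank. *)
Lemma strip_step : ((r - 2) * d + 2 * d + \dim U.1 + \dim U.2 < \dim W.1 + \dim W.2)%N ->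
  exists U' W' d', [/\ stripped U' W' d',
    (\dim W'.1 + \dim W'.2 + \dim U.1 + \dim U.2 <
     \dim W.1 + \dim W.2 + \dim U'.1 + \dim U'.2)%N &
    (d + \dim U.2 + \dim W'.1 = d' + \dim U'.2 + \dim W.1)%N].
Proof.
pose B := (\sum_(i | away i) \dim ((killv U.2 \o arr M i) @: K))%N.
pose C := (\sum_(i | away i) (\dim (I + arr M i @: W.1) - \dim I))%N.
have cardA : #|away| = (r - 2)%N.
  have := cardsC [set j; l]; rewrite cards2 eq_sym lj card_ord => E.
  suff -> : #|away| = #|~: [set j; l]| by rewrite -[in RHS]E addKn.
  by apply: eq_card => i; rewrite !inE negb_or.
have BC : (B + C <= (r - 2) * d)%N.
  rewrite -cardA -sum_nat_const -big_split /=; apply: leq_sum => i _.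
  have := betachi (delta_mx 0 i); rewrite pencil_delta.
  have := dimvS (addvSl I (arr M i @: W.1)%VS).
  move: (\dim _) (\dim (I + _)) (\dim _) => a' b' c'; clear; lia.
move=> lt; have [bot|top] := ltnP (\dim U.1 + B) (\dim K).
  have [U' [e [d1 d2 ed st]]] := strip_bottom bot.
  exists U', W, (d - e)%N; split=> //; rewrite ?d1 d2.
    by rewrite addnS addSn ltnS addnA leq_addr.
  by move: ed; move: (\dim _) (\dim _) => a' b'; clear; lia.
have [|W' [e [d1 d2 ed st]]] := strip_top.
  rewrite -/C; move: BC lt top dimK; rewrite xd.
  by move: B C (\dim K) (\dim _) (\dim _) (\dim _) (\dim _) => ? ? ? ? ? ? ?; clear; lia.
exists U, W', (d - e)%N; split=> //; rewrite -d1 -?d2.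
  by move: (\dim _) (\dim _) (\dim _) (\dim _) => ? ? ? ?; clear; lia.
by move: ed; move: (\dim _) (\dim _) => a' b'; clear; lia.
Qed.
End Step.

Lemma strip U W d : (2 <= r)%N -> stripped U W d ->
  exists U' W' d', [/\ stripped U' W' d',
    (\dim W'.1 + \dim W'.2 <= (r - 2) * d' + 2 * d' + \dim U'.1 + \dim U'.2)%N &
    (d + \dim U.2 + \dim W'.1 = d' + \dim U'.2 + \dim W.1)%N].
Proof.
move=> r2; have [n] := ubnP (\dim W.1 + \dim W.2 - \dim U.1 - \dim U.2).
elim: n U W d => // n IH U W d lt st.
have [small|big] := leqP (\dim W.1 + \dim W.2) ((r - 2) * d + 2 * d + \dim U.1 + \dim U.2).
  by exists U, W, d; split.
have [sU sW [UW1 UW2] [[x x0 xd] led]] := st.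
have [j xj] : exists j, x 0 j != 0.
  apply/existsP; apply: contraNT x0; rewrite negb_exists => /forallP x0.
  by apply/eqP/rowP => i; rewrite mxE; apply/eqP; have := x0 i; rewrite negbK.
have [l lj] : exists l, l != j.
  apply/existsP; apply: contraTT r2; rewrite negb_exists -ltnNge => /forallP lj.
  rewrite -[r in (r < 2)%N]card_ord ltnS -(cards1 j) subset_leq_card //.
  by apply/subsetP => i _; rewrite inE; have := lj i; rewrite negbK.
have [U1 [W1 [d1 [st1 lt1 E1]]]] := strip_step sU sW UW1 UW2 xj lj xd led big.
have lt2 : (\dim W1.1 + \dim W1.2 - \dim U1.1 - \dim U1.2 < n)%N.
  move: lt big lt1; clear.
  move: (\dim W.1) (\dim W.2) (\dim U.1) (\dim U.2) => ? ? ? ?.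
  move: (\dim W1.1) (\dim W1.2) (\dim U1.1) (\dim U1.2) => ? ? ? ?; lia.
have [U' [W' [d' [st' le' E']]]] := IH _ _ _ lt2 st1.
exists U', W', d'; split=> //; move: E1 E'; clear.
move: (\dim W.1) (\dim U.2) (\dim W1.1) (\dim U1.2) (\dim U'.2) (\dim W'.1) => ? ? ? ? ? ?.
lia.
Qed.

(* M is, numerically, an extension of W / U, which has defect at most r - 2
   times its generic rank, by U and M / W. *)
Lemma generic_rank_strip : (2 <= r)%N -> exists (U W : subspaces M) d,
  [/\ is_subrep U, is_subrep W, generic_rank M = (d + \dim U.2 + (dim1 M - \dim W.1))%N &
   exists2 c, (c <= (r - 2) * d)%N &
     (generic_rank M + cdef M = d + c + \dim U.1 + (dim2 M - \dim W.2))%N].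
Proof.
move=> r2; have r0 : (0 < r)%N by apply: ltnW.
have [[a a0 aE] le] := generic_rankP M r0.
pose Z : subspaces M := (0%VS, 0%VS); pose F : subspaces M := (fullv, fullv).
have rkE y : \dim (pen y @: fullv + 0) = rk M y by rewrite addv0.
have [|U [W [d [[sU sW [UW1 UW2] [[x x0 xd] _]] le' E]]]] := @strip Z F (generic_rank M) r2.
  split.
  - by move=> i; rewrite limg0 sub0v.
  - by move=> i; apply: subvf.
  - by split; apply: sub0v.
  split=> [|y]; first by exists a; rewrite // rkE aE dimv0 addn0.
  rewrite rkE dimv0 addn0; have [->|] := eqVneq y 0; last exact: le.
  have p0 : pencil M 0 = 0 by apply: big1 => i _; rewrite mxE scale0r.
  by rewrite /rk p0 lim0g dimv0.
have dW1 : (\dim W.1 <= dim1 M)%N by apply: dimvS (subvf _).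
have dW2 : (\dim W.2 <= dim2 M)%N by apply: dimvS (subvf _).
have dU1 := dimvS UW1; have dU2 := dimvS UW2.
have k1 : (d <= \dim W.1 - \dim U.1)%N.
  have := dim_img_mod (pen x) W.1 U.2; rewrite xd.
  have /dimvS : (U.1 <= W.1 :&: lker (killv U.2 \o pen x))%VS.
    apply/subvP => u uU; rewrite memv_cap (subvP UW1) //= memv_ker_kill.
    exact: pencil_sub.
  by move: (\dim _) (\dim _) (\dim _) (\dim _) => ? ? ? ?; clear; lia.
have k2 : (d + \dim U.2 <= \dim W.2)%N.
  rewrite -xd dimvS // subv_add UW2 andbT; apply/subvP => _ /memv_imgP[w wW ->].
  exact: pencil_sub.
have dE : generic_rank M = (d + \dim U.2 + (dim1 M - \dim W.1))%N.
  by move: E; rewrite /= dimv0 -/(dim1 M); lia.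
exists U, W, d; split=> //; exists (\dim W.1 + \dim W.2 - \dim U.1 - \dim U.2 - 2 * d)%N.
  by move: le'; lia.
have g1 : (generic_rank M <= dim1 M)%N by rewrite -aE rk_le_dim1.
have g2 : (generic_rank M <= dim2 M)%N by rewrite -aE dimvS ?subvf.
rewrite /cdef; move: g1 g2; rewrite dE; move: k1 k2 dW1 dW2 dU1 dU2; clear.
move: (\dim W.1) (\dim W.2) (\dim U.1) (\dim U.2) (dim1 M) (dim2 M) => ? ? ? ? ? ?; lia.
Qed.
End Strip.

(** * Reflections *)

Section Cone.
Local Open Scope nat_scope.
Variable r : nat.
Hypothesis r2 : 2 <= r.

(* The lattice points below the line of slope rho, where rho >= 1 is the
   larger root of t^2 - r t + 1. *)
Definition cone (x y : nat) := (y <= x) || (x * x + y * y <= r * x * y).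

(** For a slope t >= 1 the condition is t + 1/t <= r, whose left side increases with t. *)
Lemma cone_slope x y X Y : cone x y -> 0 < x -> Y * x <= y * X -> cone X Y.
Proof.
rewrite /cone => c x0 sl; case: leqP => //= XY.
have X0 : 0 < X by case: X sl XY => // sl XY; nia.
have xy : x < y by nia.
move: c; rewrite leqNgt xy /= => c.
have h1 : (X * X + Y * Y) * (x * y) <= (x * x + y * y) * (X * Y).
  have [e eE] : exists e, y * X = Y * x + e by exists (y * X - Y * x); lia.
  have [g gE] : exists g, y * Y = x * X + g by exists (y * Y - x * X); nia.
  have -> : (x * x + y * y) * (X * Y) = (X * X + Y * Y) * (x * y) + e * g.
    have : ((x * x + y * y) * (X * Y))%:Z = ((X * X + Y * Y) * (x * y) + e * g)%:Z; last by case.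
    have ez : (e%:Z = y%:Z * X%:Z - Y%:Z * x%:Z)%R by lia.
    have gz : (g%:Z = y%:Z * Y%:Z - x%:Z * X%:Z)%R by lia.
    by rewrite !(PoszD, PoszM) ez gz; ring.
  exact: leq_addr.
have h2 : (x * x + y * y) * (X * Y) <= (r * x * y) * (X * Y) by rewrite leq_mul2r c orbT.
have xy0 : 0 < x * y by rewrite muln_gt0 x0 (ltn_trans x0 xy).
rewrite -(leq_pmul2r xy0) (leq_trans h1) // (leq_trans h2) //.
by apply: eq_leq; ring.
Qed.

Lemma cone0 y : cone 0 y -> y = 0.
Proof. by rewrite /cone !muln0 mul0n add0n leqn0 !leqn0 muln_eq0 orbb orbb => /eqP. Qed.

(** The slope of a sum is at most the larger of the two slopes. *)
Lemma coneD x y x' y' : cone x y -> cone x' y' -> cone (x + x') (y + y').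
Proof.
move=> c c'; case: (posnP x) => [x0|x0].
  by move: c c'; rewrite x0 => /cone0 ->.
case: (posnP x') => [x0'|x0'].
  by move: c' c; rewrite x0' => /cone0 ->; rewrite !addn0.
have [sl|sl] := leqP (y * x') (y' * x).
  by apply: (cone_slope c') => //; nia.
by apply: (cone_slope c) => //; nia.
Qed.

Lemma cone_anti x y y1 : y1 <= y -> cone x y -> cone x y1.
Proof.
move=> le c; case: (posnP x) => [x0|x0].
  by move: c le; rewrite x0 => /cone0 ->; rewrite leqn0 => /eqP ->.
by apply: (cone_slope c x0); rewrite leq_mul2r le orbT.
Qed.

(** The slope r - 1 is at most rho. *)
Lemma cone_small x y : y + x <= r * x -> cone x y.
Proof. rewrite /cone; case: leqP => //= xy h; nia. Qed.

(** The map (x, y) -> (r x - y, x) preserves both the quadratic form and the line of slope rho. *)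
Lemma cone_step x y : y <= r * x -> cone (r * x - y) x -> cone x y.
Proof.
move=> le; have [z zE] : exists z, r * x = z + y by exists (r * x - y); rewrite subnK.
rewrite zE addnK => /orP[h|h]; first by apply: cone_small; lia.
rewrite /cone; apply/orP; right; nia.
Qed.

Lemma qform_cone x y : x <= y -> cone x y -> (qform r x%:Z y%:Z <= 0)%R.
Proof.
rewrite /cone /qform => xy /orP[yx|h]; last by lia.
have -> : y = x by lia.
nia.
Qed.
End Cone.

Section Pow.
Variables (k : fieldType) (r : nat).

Lemma linfun_lin (V W : vectType k) (f : V -> W) : linear f -> forall v, linfun f v = f v.
Proof.
move=> lf v; pose F : {linear V -> W} := HB.pack f (GRing.isLinear.Build _ _ _ _ f lf).
exact: (lfunE F v).
Qed.

Definition coord_lfun (V : vectType k) (i : 'I_r) : 'Hom({ffun 'I_r -> V}, V) :=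
  linfun (fun y : {ffun 'I_r -> V} => y i).

Lemma coord_lfunE V i y : coord_lfun V i y = y i.
Proof. by apply: linfun_lin => c u v; rewrite !ffunE. Qed.

Definition pow (V : vectType k) (A : {vspace V}) : {vspace {ffun 'I_r -> V}} :=
  (\bigcap_i coord_lfun V i @^-1: A)%VS.

Lemma powP V (A : {vspace V}) y : y \in pow A <-> forall i, y i \in A.
Proof.
split=> [|yA].
  rewrite memvE => /subv_bigcapP h i; have := h i isT.
  by rewrite -memvE -memv_preim coord_lfunE.
rewrite memvE; apply/subv_bigcapP => i _.
by rewrite -memvE -memv_preim coord_lfunE.
Qed.

Lemma dim_pow V (A : {vspace V}) : \dim (pow A) = (r * \dim A)%N.
Proof.
pose f (y : {ffun 'I_r -> subvs_of A}) : {ffun 'I_r -> V} := [ffun i => vsval (y i)].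
have fl : linear f by move=> c u v; apply/ffunP => i; rewrite !ffunE linearP.
have fE := linfun_lin fl.
have -> : pow A = limg (linfun f).
  apply/vspaceP => y; apply/idP/memv_imgP => [/powP yA|[z _ ->]].
    exists [ffun i => vsproj A (y i)]; first exact: memvf.
    by rewrite fE; apply/ffunP => i; rewrite !ffunE vsprojK.
  by apply/powP => i; rewrite fE ffunE subvsP.
rewrite limg_dim_eq; first by rewrite dimvf -[r in RHS]card_ord.
apply/eqP; rewrite capfv -subv0; apply/subvP => y; rewrite memv_ker memv0 fE => /eqP/ffunP y0.
by apply/eqP/ffunP => i; apply: val_inj; have := y0 i; rewrite !ffunE.
Qed.
End Pow.

Section Reflection.
Variables (k : fieldType) (r : nat).
Implicit Types (M N : krep k r).

Definition out N (y : 'I_r -> V1 N) : V2 N := \sum_i arr N i (y i).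
(** Fails exactly when the simple at vertex 2 is a quotient; [detected] fails exactly when the
    simple at vertex 1 is a subrepresentation. *)
Definition reached N := forall z : V2 N, exists y, z = out y.
Definition detected M := forall v : V1 M, (forall i, arr M i v = 0) -> v = 0.

Lemma outB N (y y' : 'I_r -> V1 N) : out (fun i => y i - y' i) = out y - out y'.
Proof. by rewrite /out -sumrB; apply: eq_bigr => i _; rewrite linearB. Qed.

Lemma out0 N : out (fun _ : 'I_r => 0 : V1 N) = 0.
Proof. by apply: big1 => i _; rewrite linear0. Qed.

Lemma eq_out N (y y' : 'I_r -> V1 N) : (forall i, y i = y' i) -> out y = out y'.
Proof. by move=> E; apply: eq_bigr => i _; rewrite E. Qed.

Definition spanv N (A : {vspace V1 N}) : {vspace V2 N} := (\sum_i arr N i @: A)%VS.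

Lemma spanvP N (A : {vspace V1 N}) z :
  z \in spanv A <-> exists2 y, (forall i, y i \in A) & z = out y.
Proof.
split=> [/memv_sumP[y yA ->]|[y yA ->]]; last first.
  by apply: memv_sumr => i _; apply: memv_img.
have /choice[x xP] : forall i, exists x, x \in A /\ y i = arr N i x.
  by move=> i; have /memv_imgP[x xA ->] := yA i isT; exists x.
exists x => [i|]; first by case: (xP i).
by apply: eq_bigr => i _; case: (xP i).
Qed.

(** The largest partner of [A] in a subrepresentation, as [spanv] is the smallest. *)
Definition satv M (A : {vspace V2 M}) : {vspace V1 M} := (\bigcap_i arr M i @^-1: A)%VS.

Lemma satvP M (A : {vspace V2 M}) v : v \in satv A <-> forall i, arr M i v \in A.
Proof.
split=> [|vA].
  by rewrite memvE => /subv_bigcapP h i; have := h i isT; rewrite -memvE -memv_preim.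
by rewrite memvE; apply/subv_bigcapP => i _; rewrite -memvE -memv_preim.
Qed.

(* N is the reflection of M at the source: up to the identification th of V2 M
   with V1 N, the sequence 0 -> V1 M -> (V2 M)^r -> V2 N -> 0 is exact. *)
Definition refl_by M N (th : 'Hom(V2 M, V1 N)) :=
  [/\ lker th = 0%VS /\ limg th = fullv, detected M, reached N &
   forall y : 'I_r -> V2 M,
     out (fun i => th (y i)) = 0 <-> exists v, forall i, y i = arr M i v].

Definition refl M N := exists th : 'Hom(V2 M, V1 N), refl_by th.

Lemma refl_up M : detected M -> exists N, refl M N.
Proof.
move=> dM; pose T : vectType k := {ffun 'I_r -> V2 M}.
pose colf (v : V1 M) : T := [ffun i => arr M i v].
have coll : linear colf by move=> c u v; apply/ffunP => i; rewrite !ffunE linearP.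
pose E : {vspace T} := limg (linfun colf); pose P := killv E.
pose single (i : 'I_r) (v : V2 M) : T := [ffun j => if j == i then v else 0].
have singl i : linear (single i).
  by move=> c u v; apply/ffunP => j; rewrite !ffunE; case: ifP => // _; rewrite scaler0 addr0.
pose N := @KRep k r (V2 M) (subvs_of (limg P)) (fun i => linfun (fun v => vsproj (limg P) (P (single i v)))).
have arrE i v : arr N i v = vsproj (limg P) (P (single i v)).
  by apply: linfun_lin => c u w; rewrite singl !linearP.
have outE (y : 'I_r -> V2 M) : vsval (@out N y) = P [ffun i => y i].
  rewrite /out; under eq_bigr do rewrite arrE.
  rewrite linear_sum /=; under eq_bigr do rewrite vsprojK ?memv_img ?memvf //.
  rewrite -linear_sum; congr (P _); apply/ffunP => i; rewrite sum_ffunE ffunE (bigD1 i) //= ffunE eqxx.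
  by rewrite big1 ?addr0 // => j ji; rewrite ffunE eq_sym (negPf ji).
exists N, \1%VF; split=> //.
- split; last by apply/vspaceP => v; rewrite memvf; apply/memv_imgP; exists v; rewrite ?memvf ?id_lfunE.
  by apply/eqP; rewrite -subv0; apply/subvP => v; rewrite memv_ker id_lfunE memv0.
- move=> z; have /memv_imgP[y _ yE] := subvsP z.
  exists (fun i => y i); apply: subvs_inj; rewrite outE yE; congr (P _).
  by apply/ffunP => i; rewrite ffunE.
move=> y; rewrite (@eq_out N _ y); last by move=> i; rewrite id_lfunE.
split=> [/(congr1 vsval)|[v yE]].
  rewrite outE linear0 => /eqP; rewrite -memv_ker lker_killv => /memv_imgP[v _].
  rewrite (linfun_lin coll) => /ffunP yE; exists v => i; have := yE i; by rewrite !ffunE.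
apply: subvs_inj; rewrite outE linear0; apply/eqP; rewrite -memv_ker lker_killv.
apply/memv_imgP; exists v; first exact: memvf.
by rewrite (linfun_lin coll); apply/ffunP => i; rewrite !ffunE yE.
Qed.

Lemma refl_down N : reached N -> exists M, refl M N.
Proof.
move=> rN; pose T : vectType k := {ffun 'I_r -> V1 N}.
have outl : linear (fun y : T => out y).
  move=> c u v; rewrite /out scaler_sumr -big_split; apply: eq_bigr => i _.
  by rewrite !ffunE linearP.
pose E : {vspace T} := lker (linfun (fun y : T => out y)).
pose M := @KRep k r (subvs_of E) (V1 N) (fun i => linfun (fun v => coord_lfun _ i (vsval v))).
have arrE i v : arr M i v = (vsval v : T) i.
  by rewrite -coord_lfunE; apply: linfun_lin => c u w; rewrite !linearP.
have EP y : y \in E <-> out (y : T) = 0.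
  by rewrite memv_ker (linfun_lin outl); split=> [/eqP|/eqP].
exists M, (\1%VF : 'Hom(V2 M, V1 N)); split=> //.
- split; last by apply/vspaceP => v; rewrite memvf; apply/memv_imgP; exists v; rewrite ?memvf ?id_lfunE.
  by apply/eqP; rewrite -subv0; apply/subvP => v; rewrite memv_ker id_lfunE memv0.
- move=> v v0; apply: subvs_inj; rewrite linear0; apply/ffunP => i.
  by rewrite -arrE v0 ffunE.
move=> y; rewrite (@eq_out N _ y); last by move=> i; rewrite id_lfunE.
have yE : @out N y = @out N ([ffun i => y i] : T) by apply: eq_out => i; rewrite ffunE.
rewrite yE; split=> [/EP yE'|[v vE]].
  by exists (vsproj E [ffun i => y i]) => i; rewrite arrE vsprojK // ffunE.
have /EP := subvsP v; rewrite -yE => E0; rewrite -[RHS]E0.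
by apply: eq_out => i; rewrite vE arrE.
Qed.

Section Refl.
Variables (M N : krep k r) (th : 'Hom(V2 M, V1 N)).
Hypothesis rMN : refl_by th.

Let th0 : lker th == 0%VS. Proof. by case: rMN => -[-> _]. Qed.

Lemma refl_th_inj : injective th. Proof. exact/lker0P. Qed.

Lemma refl_th_sur w : exists v, w = th v.
Proof.
case: rMN => -[_ E] _ _ _; have : w \in limg th by rewrite E memvf.
by case/memv_imgP => v _; exists v.
Qed.

Lemma memv_th (A : {vspace V2 M}) v : (th v \in (th @: A)%VS) = (v \in A).
Proof. by rewrite memvE -limg_line limg_ker0 // -memvE. Qed.

Lemma dim_th (A : {vspace V2 M}) : \dim (th @: A) = \dim A.
Proof. by apply: limg_dim_eq; rewrite (eqP th0) capv0. Qed.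

Lemma refl_reached z : exists y, z = out (fun i => th (y i)).
Proof.
case: rMN => _ _ /(_ z)[y ->] _; have /choice[x xE] := fun i => refl_th_sur (y i).
by exists x; apply: eq_out.
Qed.

(** Restricted to A^r, the map of the reflection onto V2 N has kernel [satv A] and image
    [spanv (th @: A)]. *)
Lemma refl_dim (A : {vspace V2 M}) :
  (\dim (satv A) + \dim (spanv (th @: A)) = r * \dim A)%N.
Proof.
case: rMN => _ dM _ ex.
pose T : vectType k := {ffun 'I_r -> V2 M}.
pose f (y : T) : V2 N := out (fun i => th (y i)); pose g (v : V1 M) : T := [ffun i => arr M i v].
have fl : linear f.
  move=> c u v; rewrite /f /out scaler_sumr -big_split; apply: eq_bigr => i _.
  by rewrite !ffunE !linearP.
have gl : linear g by move=> c u v; apply/ffunP => i; rewrite !ffunE linearP.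
have fE := linfun_lin fl; have gE := linfun_lin gl.
rewrite -dim_pow -(limg_ker_dim (linfun f) (pow r A)); congr (_ + _)%N.
  have -> : (pow r A :&: lker (linfun f) = linfun g @: satv A)%VS.
    apply/vspaceP => y; apply/idP/memv_imgP => [|[v /satvP vA ->]].
      rewrite memv_cap memv_ker fE => /andP[/powP yA /eqP /ex[v vE]].
      exists v; first by apply/satvP => i; rewrite -vE.
      by rewrite gE; apply/ffunP => i; rewrite ffunE.
    rewrite memv_cap; apply/andP; split; first by apply/powP => i; rewrite gE ffunE.
    by rewrite memv_ker fE; apply/eqP/ex; exists v => i; rewrite gE ffunE.
  rewrite limg_dim_eq //; apply/eqP; rewrite -subv0; apply/subvP => v.
  rewrite memv_cap memv_ker gE memv0 => /andP[_ /eqP/ffunP v0]; apply/eqP/dM => i.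
  by have := v0 i; rewrite !ffunE.
congr (\dim _); apply/vspaceP => z; apply/idP/memv_imgP => [/spanvP[y yA ->]|[y /powP yA ->]].
  have /choice[x xP] : forall i, exists x, x \in A /\ y i = th x.
    by move=> i; have /memv_imgP[x xA ->] := yA i; exists x.
  exists [ffun i => x i]; first by apply/powP => i; rewrite ffunE; case: (xP i).
  by rewrite fE; apply: eq_out => i; rewrite ffunE; case: (xP i).
by apply/spanvP; exists (fun i => th (y i)) => [i|]; [apply: memv_img|rewrite fE].
Qed.

Lemma refl_dims : dim1 N = dim2 M /\ (dim1 M + dim2 N = r * dim2 M)%N.
Proof.
case: rMN => -[_ fN] _ rN _; split; first by rewrite /dim1 -fN dim_th.
have := refl_dim fullv.
have -> : satv fullv = fullv :> {vspace V1 M}.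
  by apply/vspaceP => v; rewrite memvf; apply/satvP => i; apply: memvf.
suff -> : spanv (th @: fullv) = fullv :> {vspace V2 N} by [].
apply/vspaceP => v; rewrite memvf; apply/spanvP; have [y ->] := rN v.
by exists y => // i; rewrite fN memvf.
Qed.
End Refl.

(** After n reflections no further one upwards is possible; for indecomposable [M] this means that
    it is preinjective, as [ffin] means preprojective. *)
Fixpoint gfin n M := if n is n'.+1 then exists2 N, refl M N & gfin n' N else ~ detected M.
Fixpoint ffin n N := if n is n'.+1 then exists2 M, refl M N & ffin n' M else ~ reached N.

(** Once U_1 is enlarged to [satv U.2], reflecting the subrepresentation is the map of [cone_step].
    The dimension at vertex 1 becomes dim U_2, which is smaller than dim U_1 unless the claim is
    trivial. *)
Lemma sub_cone M (U : subspaces M) : (2 <= r)%N -> (forall n, ~ gfin n M) -> is_subrep U ->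
  cone r (\dim U.2) (\dim U.1).
Proof.
move=> r2; have [n] := ubnP (\dim U.1); elim: n M U => // n IH M U lt nG sU.
have [le|lt21] := leqP (\dim U.1) (\dim U.2); first by rewrite /cone le.
have [N [th rMN]] : exists N, refl M N by apply: refl_up; apply: contrapT; apply: (nG 0%N).
have US : (U.1 <= satv U.2)%VS.
  by apply/subvP => v vU; apply/satvP => i; apply: (subvP (sU i)); apply: memv_img.
apply: (cone_anti r2 (dimvS US)); have E := refl_dim rMN U.2.
apply: cone_step => //; first by rewrite -E leq_addr.
rewrite -E addKn -(dim_th rMN U.2).
apply: (IH N (th @: U.2, spanv (th @: U.2))%VS) => [|m gN|i] /=.
- by rewrite (dim_th rMN) (leq_trans lt21).
- by apply: (nG m.+1); exists N => //; exists th.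
by apply/subvP => _ /memv_imgP[v vA ->]; apply: (subvP (sumv_sup i isT (subvv _))); apply: memv_img.
Qed.

(** Dual to [sub_cone]: W_2 is shrunk to [spanv W.1], and the quotient is reflected downwards. *)
Lemma quot_cone N (W : subspaces N) : (2 <= r)%N -> (forall n, ~ ffin n N) -> is_subrep W ->
  cone r (dim1 N - \dim W.1) (dim2 N - \dim W.2).
Proof.
move=> r2; have [n] := ubnP (dim2 N - \dim W.2); elim: n N W => // n IH N W lt nF sW.
have [le|lt21] := leqP (dim2 N - \dim W.2) (dim1 N - \dim W.1); first by rewrite /cone le.
have [M [th rMN]] : exists M, refl M N by apply: refl_down; apply: contrapT; apply: (nF 0%N).
have SW : (spanv W.1 <= W.2)%VS by apply/subv_sumP => i _; apply: sW.
apply: (@cone_anti r r2 _ (dim2 N - \dim (spanv W.1))); first by rewrite leq_sub2l // dimvS.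
pose A := (th @^-1: W.1)%VS.
have AE : (th @: A)%VS = W.1 by apply: lpreimK; case: rMN => -[_ ->] _ _ _; apply: subvf.
have E := refl_dim rMN A; rewrite AE in E.
have [E1 E2] := refl_dims rMN.
have dA : \dim A = \dim W.1 by rewrite -AE (dim_th rMN).
have leA : (\dim A <= dim2 M)%N by apply: dimvS (subvf _).
have leS : (\dim (spanv W.1) <= dim2 N)%N by apply: dimvS (subvf _).
have leT : (\dim (satv A) <= dim1 M)%N by apply: dimvS (subvf _).
have key : (r * (dim1 N - \dim W.1) = (dim1 M - \dim (satv A)) + (dim2 N - \dim (spanv W.1)))%N.
  by rewrite mulnBr E1 -E2 -dA -E; lia.
apply: cone_step => //; first by rewrite key leq_addl.
rewrite key addnK E1 -dA.
apply: (IH M (satv A, A)) => [|m fM|i] /=.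
- by rewrite -E1 dA; apply: leq_trans lt21 _.
- by apply: (nF m.+1); exists M => //; exists th.
by apply/subvP => _ /memv_imgP[v /satvP vA ->].
Qed.
End Reflection.

(** * Decompositions *)

Section Splits.
Variables (k : fieldType) (r : nat).
Implicit Types (M N X Y : krep k r).

Lemma dim0P (V : vectType k) (A : {vspace V}) : \dim A = 0%N <-> forall v, v \in A -> v = 0.
Proof.
split=> [/eqP|A0]; first by rewrite dimv_eq0 => /eqP -> v; rewrite memv0 => /eqP.
apply/eqP; rewrite dimv_eq0 -subv0; apply/subvP => v vA; rewrite (A0 v vA) mem0v //.
Qed.

Lemma is_zeroP M : is_zero M <-> (forall v : V1 M, v = 0) /\ (forall v : V2 M, v = 0).
Proof.
split=> [[/dim0P a /dim0P b]|[a b]]; first by split=> v; [apply: a|apply: b]; rewrite memvf.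
by split; apply/dim0P => v _.
Qed.

Definition dsum (V : vectType k) (A B : {vspace V}) :=
  (forall v, exists2 a, a \in A & v - a \in B) /\ (forall v, v \in A -> v \in B -> v = 0).

Definition splits M (U U' : subspaces M) :=
  [/\ is_subrep U, is_subrep U', dsum U.1 U'.1 & dsum U.2 U'.2].

Definition null M (U : subspaces M) := (forall v, v \in U.1 -> v = 0) /\ (forall v, v \in U.2 -> v = 0).

(** Indecomposability in terms of complementary subrepresentations, which can be carried along
    reflections. *)
Definition unsplit M := ~ is_zero M /\ forall U U' : subspaces M, splits U U' -> null U \/ null U'.

Definition subrep M (U : subspaces M) : krep k r :=
  @KRep k r (subvs_of U.1) (subvs_of U.2) (fun i => linfun (fun v => vsproj U.2 (arr M i (vsval v)))).

Lemma subrepE M (U : subspaces M) i v : is_subrep U -> vsval (arr (subrep U) i v) = arr M i (vsval v).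
Proof.
move=> sU; have -> : arr (subrep U) i v = vsproj U.2 (arr M i (vsval v)).
  by apply: linfun_lin => c u w; rewrite !linearP.
by rewrite vsprojK // (subvP (sU i)) // memv_img // subvsP.
Qed.

Lemma sub_arr M (U : subspaces M) i v : is_subrep U -> v \in U.1 -> arr M i v \in U.2.
Proof. by move=> sU vU; apply: (subvP (sU i)); apply: memv_img. Qed.

Lemma indecomposable_unsplit M : indecomposable M -> unsplit M.
Proof.
case=> nz ind; split=> // U U' [sU sU' d1 d2].
suff /ind[/is_zeroP[z1 z2]|/is_zeroP[z1 z2]] : kiso M (ksum (subrep U) (subrep U')).
- left; split=> v vU; rewrite -(vsprojK vU).
    by rewrite (z1 (vsproj U.1 v : V1 (subrep U))) linear0.
  by rewrite (z2 (vsproj U.2 v : V2 (subrep U))) linear0.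
- right; split=> v vU; rewrite -(vsprojK vU).
    by rewrite (z1 (vsproj U'.1 v : V1 (subrep U'))) linear0.
  by rewrite (z2 (vsproj U'.2 v : V2 (subrep U'))) linear0.
have proj (V : vectType k) (A B : {vspace V}) : dsum A B -> exists p q : 'End(V),
    (forall v, [/\ p v \in A, q v \in B & v = p v + q v]) /\
    (forall a b, a \in A -> b \in B -> p (a + b) = a /\ q (a + b) = b).
  case=> h1 h2; exists (daddv_pi A B), (daddv_pi B A).
  have AB0 : (A :&: B = 0)%VS.
    by apply/eqP; rewrite -subv0; apply/subvP => v; rewrite memv_cap memv0 => /andP[/h2 h /h ->].
  have dec v : [/\ daddv_pi A B v \in A, daddv_pi B A v \in B & v = daddv_pi A B v + daddv_pi B A v].
    split; try exact: memv_pi.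
    have [a aA bB] := h1 v; rewrite daddv_pi_add //.
    by rewrite -[v](subrK a) addrC memv_add.
  split=> // a b aA bB; have [a'A b'B E] := dec (a + b).
  move: a'A b'B E; set a' := daddv_pi A B (a + b); set b' := daddv_pi B A (a + b) => a'A b'B E.
  have aE : a' - a = b - b'.
    by apply: (addIr b'); rewrite subrK; apply: (addrI a); rewrite addrA [a + (a' - a)]addrC subrK -E.
  have a0 : a' - a = 0 by apply: h2; [rewrite memvB|rewrite aE memvB].
  move: aE; rewrite a0 => /eqP; rewrite eq_sym subr_eq0 => /eqP ->.
  by move/eqP: a0; rewrite subr_eq0 => /eqP ->.
have [p1 [q1 [P1 R1]]] := proj _ _ _ d1; have [p2 [q2 [P2 R2]]] := proj _ _ _ d2.
pose S := ksum (subrep U) (subrep U').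
pose f1 (v : V1 M) : V1 S := (vsproj U.1 (p1 v), vsproj U'.1 (q1 v)).
pose f2 (v : V2 M) : V2 S := (vsproj U.2 (p2 v), vsproj U'.2 (q2 v)).
pose g1 (v : V1 S) : V1 M := vsval v.1 + vsval v.2.
pose g2 (v : V2 S) : V2 M := vsval v.1 + vsval v.2.
have f1l : linear f1 by move=> c u v; rewrite /f1 !linearP.
have f2l : linear f2 by move=> c u v; rewrite /f2 !linearP.
have g1l : linear g1 by move=> c u v; rewrite /g1 !linearP scalerDr addrACA.
have g2l : linear g2 by move=> c u v; rewrite /g2 !linearP scalerDr addrACA.
have f1E := linfun_lin f1l; have f2E := linfun_lin f2l.
have g1E := linfun_lin g1l; have g2E := linfun_lin g2l.
exists (linfun f1, linfun f2), (linfun g1, linfun g2); split.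
- move=> i; apply/lfunP => v; rewrite !comp_lfunE ksumE f1E // f2E //.
  have [pv qv vE] := P1 v.
  have -> : arr M i v = arr M i (p1 v) + arr M i (q1 v) by rewrite {1}vE linearD.
  rewrite /f2.
  have [-> ->] := R2 _ _ (sub_arr i sU pv) (sub_arr i sU' qv).
  by congr (_, _); apply: subvs_inj; rewrite subrepE // !vsprojK // sub_arr.
- by move=> i; apply/lfunP => v; rewrite !comp_lfunE ksumE g1E // g2E // linearD /g2 /= !subrepE.
- congr (_, _); apply/lfunP => v; rewrite comp_lfunE id_lfunE.
    by have [pv qv vE] := P1 v; rewrite f1E // g1E // /g1 /= !vsprojK.
  by have [pv qv vE] := P2 v; rewrite f2E // g2E // /g2 /= !vsprojK.
congr (_, _); apply/lfunP => -[a b]; rewrite comp_lfunE id_lfunE.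
  rewrite g1E // f1E // /f1; have [-> ->] := R1 _ _ (subvsP a) (subvsP b).
  by congr (_, _); apply: subvs_inj; rewrite vsprojK ?subvsP.
rewrite g2E // f2E // /f2; have [-> ->] := R2 _ _ (subvsP a) (subvsP b).
by congr (_, _); apply: subvs_inj; rewrite vsprojK ?subvsP.
Qed.

Lemma unsplit_indecomposable M : unsplit M -> indecomposable M.
Proof.
case=> nz uns; split=> // X Y [f [g [fH gH gf fg]]].
have gf1 v : g.1 (f.1 v) = v by have [/lfunP/(_ v)] := gf; rewrite comp_lfunE id_lfunE.
have gf2 v : g.2 (f.2 v) = v by have [_ /lfunP/(_ v)] := gf; rewrite comp_lfunE id_lfunE.
have fg1 v : f.1 (g.1 v) = v by have [/lfunP/(_ v)] := fg; rewrite comp_lfunE id_lfunE.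
have fg2 v : f.2 (g.2 v) = v by have [_ /lfunP/(_ v)] := fg; rewrite comp_lfunE id_lfunE.
have fA i v : f.2 (arr M i v) = (arr X i (f.1 v).1, arr Y i (f.1 v).2).
  by rewrite -ksumE -!comp_lfunE fH.
pose kr (V W Z : vectType k) (h : 'Hom(V, (W * Z)%type)) := lker (linfun (fun v => (h v).2)).
pose kl (V W Z : vectType k) (h : 'Hom(V, (W * Z)%type)) := lker (linfun (fun v => (h v).1)).
have krP (V W Z : vectType k) (h : 'Hom(V, (W * Z)%type)) v : v \in kr _ _ _ h <-> (h v).2 = 0.
  rewrite memv_ker linfun_lin; last by move=> c u w; rewrite linearP.
  by split=> [/eqP|->].
have klP (V W Z : vectType k) (h : 'Hom(V, (W * Z)%type)) v : v \in kl _ _ _ h <-> (h v).1 = 0.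
  rewrite memv_ker linfun_lin; last by move=> c u w; rewrite linearP.
  by split=> [/eqP|->].
pose U : subspaces M := (kr _ _ _ (f.1 : 'Hom(V1 M, (V1 X * V1 Y)%type)), kr _ _ _ (f.2 : 'Hom(V2 M, (V2 X * V2 Y)%type))).
pose U' : subspaces M := (kl _ _ _ (f.1 : 'Hom(V1 M, (V1 X * V1 Y)%type)), kl _ _ _ (f.2 : 'Hom(V2 M, (V2 X * V2 Y)%type))).
have ds (V W Z : vectType k) (h : 'Hom(V, (W * Z)%type)) (e : 'Hom((W * Z)%type, V)) : (forall v, e (h v) = v) -> (forall v, h (e v) = v) ->
    dsum (kr _ _ _ h) (kl _ _ _ h).
  move=> eh he; split=> v.
    exists (e ((h v).1, 0)); first by apply/krP; rewrite he.
    apply/klP; have -> : h (v - e ((h v).1, 0)) = h v - ((h v).1, 0).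
      by rewrite -[in RHS](he ((h v).1, 0)); apply: linearB.
    exact: subrr.
  move=> /krP a /klP b; rewrite -(eh v) [h v]surjective_pairing a b.
  by rewrite -[RHS](linear0 e).
have sp : splits U U'.
  split; [| |exact: ds|exact: ds]; move=> i; apply/subvP => z /memv_imgP[v].
    by move=> /krP v0 ->; apply/krP; rewrite fA v0 linear0.
  by move=> /klP v0 ->; apply/klP; rewrite fA v0 linear0.
case: (uns _ _ sp) => -[n1 n2]; [left|right]; apply/is_zeroP; split=> x.
- have : g.1 (x, 0) = 0 by apply: n1; apply/krP; rewrite fg1.
  by move/(congr1 f.1); rewrite fg1 linear0 => -[].
- have : g.2 (x, 0) = 0 by apply: n2; apply/krP; rewrite fg2.
  by move/(congr1 f.2); rewrite fg2 linear0 => -[].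
- have : g.1 (0, x) = 0 by apply: n1; apply/klP; rewrite fg1.
  by move/(congr1 f.1); rewrite fg1 linear0 => -[].
- have : g.2 (0, x) = 0 by apply: n2; apply/klP; rewrite fg2.
  by move/(congr1 f.2); rewrite fg2 linear0 => -[].
Qed.
End Splits.

(** * Indecomposability, roots and extremal ranks under reflections *)

Section Transfer.
Variables (k : fieldType) (r : nat).
Implicit Types (M N X Y : krep k r).

Section OneStep.
Variables (M N : krep k r) (th : 'Hom(V2 M, V1 N)).
Hypothesis rMN : refl_by th.

Lemma spanv_th (A : {vspace V2 M}) z : z \in spanv (th @: A) <->
  exists2 a, (forall i, a i \in A) & z = out (fun i => th (a i)).
Proof.
split=> [/spanvP[y yA ->]|[a aA ->]].
  have /choice[x xP] : forall i, exists x, x \in A /\ y i = th x.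
    by move=> i; have /memv_imgP[x xA ->] := yA i; exists x.
  by exists x => [i|]; [case: (xP i)|apply: eq_out => i; case: (xP i)].
by apply/spanvP; exists (fun i => th (a i)) => // i; apply: memv_img.
Qed.

Lemma refl_unsplit_down : unsplit N -> unsplit M.
Proof.
have [_ dM rN ex] := rMN.
case=> nz uns; split=> [/is_zeroP[z1 z2]|U U' [sU sU' [e1 u1] [e2 u2]]].
  apply: nz; apply/is_zeroP; split=> [v|z].
    by have [x ->] := refl_th_sur rMN v; rewrite (z2 x) linear0.
  by have [y ->] := refl_reached rMN z; rewrite -(out0 N); apply: eq_out => i; rewrite (z2 (y i)) linear0.
pose G (A : subspaces M) : subspaces N := (th @: A.2, spanv (th @: A.2))%VS.
have sG A : is_subrep (G A).
  by move=> i; apply: (sumv_sup i isT (subvv _)).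
have nG A : is_subrep A -> null (G A) -> null A.
  move=> sA [n1 _]; have n2 v : v \in A.2 -> v = 0.
    by move=> vA; apply: (refl_th_inj rMN); rewrite linear0; apply: n1; apply: memv_img.
  by split=> // v vA; apply: dM => i; apply: n2; apply: sub_arr.
suff /uns[/nG h|/nG h] : splits (G U) (G U') by [left; apply: h|right; apply: h].
split; [exact: sG|exact: sG| |]; split=> [w|w].
- have [v ->] := refl_th_sur rMN w; have [a aU bU] := e2 v.
  by exists (th a); [apply: memv_img|rewrite -linearB memv_img].
- by case/memv_imgP=> v vU ->; rewrite /= (memv_th rMN) => vU'; rewrite (u2 v) ?linear0.
- have [y ->] := refl_reached rMN w.
  have /choice[a aP] : forall i, exists a, a \in U.2 /\ y i - a \in U'.2.
    by move=> i; have [a aU bU] := e2 (y i); exists a.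
  exists (out (fun i => th (a i))); first by apply/spanv_th; exists a => // i; case: (aP i).
  apply/spanv_th; exists (fun i => y i - a i) => [i|]; first by case: (aP i).
  by rewrite -outB; apply: eq_out => i; rewrite linearB.
case/spanv_th=> a aU -> /spanv_th[a' aU' E].
(* The difference of two tuples with the same value comes from a vector v of M_1. By directness at
   vertex 2, the component u of v in U_1 accounts for the tuple [a], whose value is therefore 0. *)
have /ex[v vE] : out (fun i => th (a i - a' i)) = 0.
  rewrite (eq_out (y' := fun i => th (a i) - th (a' i))); last by move=> i; rewrite linearB.
  by rewrite outB -E subrr.
have [u uU vu] := e1 v; apply/ex; exists u => i; apply/eqP; rewrite -subr_eq0; apply/eqP/u2.
  by rewrite memvB // sub_arr.
have -> : a i - arr M i u = arr M i (v - u) + a' i by rewrite linearB /= -vE addrAC subrK.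
by rewrite memvD // sub_arr.
Qed.

Lemma refl_unsplit_up : unsplit M -> unsplit N.
Proof.
have [_ dM rN ex] := rMN.
case=> nz uns; split=> [/is_zeroP[z1 z2]|W W' [sW sW' [e1 u1] [e2 u2]]].
  have V2z v : v = 0 :> V2 M by apply: (refl_th_inj rMN); rewrite linear0; apply: z1.
  by apply: nz; apply/is_zeroP; split=> // v; apply: dM => i; apply: V2z.
pose F (A : subspaces N) : subspaces M := (satv (th @^-1: A.1), th @^-1: A.1)%VS.
have sF A : is_subrep (F A) by move=> i; apply/subvP => _ /memv_imgP[v /satvP vA ->].
have F2 (A : {vspace V1 N}) v : (v \in (th @^-1: A)%VS) = (th v \in A) by rewrite memv_preim.
have out_in (A : subspaces N) (y : 'I_r -> V1 N) : is_subrep A -> (forall i, y i \in A.1) -> out y \in A.2.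
  by move=> sA yA; apply: memv_suml => i _; apply: sub_arr.
have nF (A B : subspaces N) : is_subrep B -> (forall v, exists2 a, a \in A.1 & v - a \in B.1) ->
    (forall v, v \in A.2 -> v \in B.2 -> v = 0) -> null (F A) -> null A.
  move=> sB e u [_ n2]; have n1 w : w \in A.1 -> w = 0.
    have [v ->] := refl_th_sur rMN w; move=> vA.
    by rewrite (n2 v) ?linear0 //; rewrite F2.
  split=> // z zA; apply: u => //; have [y ->] := rN z; apply: out_in => // i.
  by have [a aA yB] := e (y i); rewrite -[y i]subr0 -(n1 a aA).
have e1' v : exists2 a, a \in W'.1 & v - a \in W.1.
  by have [a aA bB] := e1 v; exists (v - a); rewrite // opprB addrC subrK.
suff /uns[/(nF W W') h|/(nF W' W) h] : splits (F W) (F W').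
- by left; apply: h.
- by right; apply: h => // v vW' vW; apply: u2.
split; [exact: sF|exact: sF| |]; split=> v.
(* The tuple of the arr i v is split along W_1 and W'_1. The values of the parts are opposite and
   lie in W_2 and W'_2, so both vanish, and each part comes from a vector of M_1. *)
- have /choice[a aP] : forall i, exists a, th a \in W.1 /\ th (arr M i v) - th a \in W'.1.
    move=> i; have [w wW wW'] := e1 (th (arr M i v)).
    by have [a aE] := refl_th_sur rMN w; exists a; rewrite -aE.
  have o0 : out (fun i => th (arr M i v)) = 0 by apply/ex; exists v.
  have /ex[u uE] : out (fun i => th (a i)) = 0.
    apply: u2; first by apply: out_in => // i; case: (aP i).
    rewrite -rpredN -sub0r -o0 -outB; apply: out_in => // i; by case: (aP i).
  exists u; first by apply/satvP => i; rewrite F2 -uE; case: (aP i).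
  by apply/satvP => i; rewrite F2 linearB /= -uE linearB; case: (aP i).
- move=> /satvP v1 /satvP v2; apply: dM => i; apply: (refl_th_inj rMN); rewrite linear0.
  by apply: u1; rewrite -F2.
- have [w wW wW'] := e1 (th v); have [a aE] := refl_th_sur rMN w.
  by exists a; rewrite F2 ?linearB /= -aE.
by rewrite !F2 => v1 v2; apply: (refl_th_inj rMN); rewrite linear0; apply: u1.
Qed.
End OneStep.

Lemma dsum_compl (V : vectType k) (A : {vspace V}) : dsum A (A^C)%VS.
Proof.
split=> [v|v vA vC]; last by apply/eqP; rewrite -memv0 -(capv_compl A) memv_cap vA.
have : v \in (A + A^C)%VS by rewrite addv_complf memvf.
by case/memv_addP=> a aA [b bB ->]; exists a => //; rewrite addrC addKr.
Qed.

(** A vector killed by all arrows spans a direct summand. *)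
Lemma unsplit_undetected M : unsplit M -> ~ detected M -> dim1 M = 1%N /\ dim2 M = 0%N.
Proof.
case=> nz uns nd.
have [v [v0 av]] : exists v : V1 M, v <> 0 /\ forall i, arr M i v = 0.
  apply: contrapT => ne; apply: nd => v av; apply: contrapT => v0; by apply: ne; exists v.
pose U : subspaces M := (<[v]>, 0)%VS; pose U' : subspaces M := (<[v]>^C, fullv)%VS.
have sp : splits U U'.
  split; [|by move=> i; apply: subvf|exact: dsum_compl|].
    by move=> i; rewrite limg_line av.
  split=> [w|w]; first by exists 0; rewrite ?mem0v ?memvf.
  by rewrite memv0 => /eqP.
case: (uns _ _ sp) => -[n1 n2]; first by case: v0; apply: n1; apply: memv_line.
split; last by apply/dim0P.
have := dimv_compl <[v]>%VS; have -> : \dim (<[v]>^C) = 0%N by apply/dim0P.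
rewrite dim_vline; have /eqP -> := v0.
have : (\dim <[v]> <= dim1 M)%N by apply: dimvS (subvf _).
by rewrite dim_vline; have /eqP -> := v0; rewrite /dim1 dimvf; case: (dim _) => [|[]].
Qed.

Lemma unsplit_unreached N : unsplit N -> ~ reached N -> dim1 N = 0%N /\ dim2 N = 1%N.
Proof.
case=> nz uns nr; pose S := @spanv k r N fullv.
have [z zS] : exists z : V2 N, z \notin S.
  apply: contrapT => ne; apply: nr => z; apply: contrapT => nz'; apply: ne; exists z.
  by apply/negP => /spanvP[y _ yE]; apply: nz'; exists y.
pose H := (S + (S + <[z]>)^C)%VS.
pose U : subspaces N := (fullv, H)%VS; pose U' : subspaces N := (0, <[z]>)%VS.
have dH : dsum H <[z]>%VS.
  split=> [v|v].
    have [a /memv_addP[s sS [l lz ->]] bC] := (dsum_compl (S + <[z]>)%VS).1 v.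
    exists (s + (v - (s + l))); first by rewrite memv_add.
    have -> : v - (s + (v - (s + l))) = l; last by [].
    by apply/eqP; rewrite subr_eq addrA [l + s]addrC [X in _ == X]addrC subrK.
  move=> /memv_addP[s sS [t tC ->]] /vlineP[c E].
  have t0 : t = 0.
    apply: (dsum_compl (S + <[z]>)%VS).2 => //; rewrite -[t](addKr s) E.
    by rewrite memv_add ?memvN // memvZ // memv_line.
  move: E; rewrite t0 addr0 => E; have [c0|c0] := eqVneq c 0; first by rewrite E c0 scale0r.
  by case/negP: zS; rewrite -[z](scalerK c0) -E memvZ.
have sp : splits U U'.
  split; [| |by split=> [w|w]; [exists w; rewrite ?memvf ?subrr ?mem0v|rewrite memv0 => _ /eqP]|exact: dH].
    move=> i; apply: subv_trans (addvSl _ _); exact: (sumv_sup i isT (subvv _)).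
  by move=> i; rewrite limg0 sub0v.
case: (uns _ _ sp) => -[n1 n2]; last first.
  by case/negP: zS; rewrite (n2 z (memv_line z)) mem0v.
split; first by apply/dim0P.
have -> : dim2 N = \dim <[z]>%VS.
  congr (\dim _); apply/vspaceP => v; rewrite memvf; symmetry.
  by have [a aH vz] := dH.1 v; rewrite -[v]subr0 -(n2 a aH).
rewrite dim_vline; case: eqP => // z0; by case/negP: zS; rewrite z0 mem0v.
Qed.

Lemma dual_coefs (a : 'rV[k]_r) : (2 <= r)%N -> a != 0 -> exists al be : 'rV[k]_r,
  [/\ be != 0, \sum_i a 0 i * al 0 i = 1 & \sum_i a 0 i * be 0 i = 0].
Proof.
move=> r2 a0; have [j aj] : exists j, a 0 j != 0.
  apply/existsP; apply: contraNT a0; rewrite negb_exists => /forallP a0.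
  by apply/eqP/rowP => i; rewrite mxE; apply/eqP; have := a0 i; rewrite negbK.
have [l lj] : exists l, l != j.
  apply/existsP; apply: contraTT r2; rewrite negb_exists -ltnNge => /forallP lj.
  rewrite -[r in (r < 2)%N]card_ord ltnS -(cards1 j) subset_leq_card //.
  by apply/subsetP => i _; rewrite inE; have := lj i; rewrite negbK.
have sd (c : 'I_r) : \sum_i a 0 i * (delta_mx 0 c : 'rV[k]_r) 0 i = a 0 c.
  rewrite (bigD1 c) //= mxE !eqxx mulr1 big1 ?addr0 // => i ic.
  by rewrite mxE (negPf ic) andbF mulr0.
exists ((a 0 j)^-1 *: delta_mx 0 j), (delta_mx 0 l - (a 0 l / a 0 j) *: delta_mx 0 j); split.
- apply/eqP => /rowP/(_ l); rewrite !mxE !eqxx (negPf lj) /= mulr0 subr0.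
  by move/eqP; rewrite oner_eq0.
- by under eq_bigr do rewrite mxE mulrCA; rewrite -mulr_sumr sd mulVf.
have E i : a 0 i * (delta_mx 0 l - (a 0 l / a 0 j) *: delta_mx 0 j : 'rV[k]_r) 0 i =
   a 0 i * (delta_mx 0 l : 'rV[k]_r) 0 i - (a 0 l / a 0 j) * (a 0 i * (delta_mx 0 j : 'rV[k]_r) 0 i).
  by rewrite !mxE; ring.
by under eq_bigr do rewrite E; rewrite sumrB -mulr_sumr !sd divfK ?subrr.
Qed.

Definition real_root M := (dim1 M * dim1 M + dim2 M * dim2 M = 1 + r * dim1 M * dim2 M)%N.

Lemma refl_real_root M N : refl M N -> real_root M <-> real_root N.
Proof.
case=> th /refl_dims[E1 E2]; rewrite /real_root E1.
move: (dim1 M) (dim2 M) (dim2 N) E2 => x y z E2.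
have [e1 e2] : (z * (x + z) = r * y * z /\ x * (x + z) = r * y * x)%N by rewrite E2; split; ring.
by split; nia.
Qed.

Lemma gfin_surjective n M : (2 <= r)%N -> gfin n M -> unsplit M ->
  real_root M /\ forall a : 'rV[k]_r, a != 0 -> limg (pencil M a) = fullv.
Proof.
move=> r2; elim: n M => [|n IH] M /=.
  move=> nd uns; have [d1 d2] := unsplit_undetected uns nd.
  split=> [|a _]; first by rewrite /real_root d1 d2 !muln0.
  apply/eqP; rewrite eqEsubv subvf /=; apply/subvP => v vf.
  by have /dim0P/(_ v vf) -> := d2; rewrite mem0v.
case=> N [th rMN] gN uM; have [rr sur] := IH N gN (refl_unsplit_up rMN uM).
split=> [|a a0]; first exact: (proj2 (refl_real_root (ex_intro _ th rMN)) rr).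
have [al [be [be0 al1 abe]]] := dual_coefs r2 a0; have [_ _ _ ex] := rMN.
apply/vspaceP => z; rewrite memvf; apply/memv_imgP.
(* Combining a tuple al_i z + be_i m with the coefficients a_i gives z. Surjectivity of N^be
   provides an m for which the tuple is a relation, hence comes from a vector of M_1. *)
have : - pencil N al (th z) \in limg (pencil N be) by rewrite sur ?memvf.
case/memv_imgP=> w _; have [m ->] := refl_th_sur rMN w => mE.
have /ex[v vE] : out (fun i => th (al 0 i *: z + be 0 i *: m)) = 0.
  rewrite -[RHS](addrN (pencil N al (th z))) mE !pencilE -big_split.
  by apply: eq_bigr => i _; rewrite !linearD !linearZ.
exists v; first exact: memvf.
rewrite pencilE; under eq_bigr do rewrite -vE scalerDr !scalerA.
by rewrite big_split /= -!scaler_suml al1 abe scale1r scale0r addr0.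
Qed.

Lemma ffin_injective n N : (2 <= r)%N -> ffin n N -> unsplit N ->
  real_root N /\ forall a : 'rV[k]_r, a != 0 -> lker (pencil N a) = 0%VS.
Proof.
move=> r2; elim: n N => [|n IH] N /=.
  move=> nd uns; have [d1 d2] := unsplit_unreached uns nd.
  split=> [|a _]; first by rewrite /real_root d1 d2 !(muln0, mul0n).
  apply/eqP; rewrite -subv0; apply/subvP => v _.
  by have /dim0P/(_ v (memvf v)) -> := d1; rewrite mem0v.
case=> M [th rMN] fM uN; have [rr inj] := IH M fM (refl_unsplit_down rMN uN).
split=> [|a a0]; first exact: (proj1 (refl_real_root (ex_intro _ th rMN)) rr).
have [al [be [be0 al1 abe]]] := dual_coefs r2 a0; have [_ _ _ ex] := rMN.
apply/eqP; rewrite -subv0; apply/subvP => w; rewrite memv_ker memv0.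
have [z ->] := refl_th_sur rMN w => /eqP az.
(* The tuple a_i z is a relation, so it comes from some m in M_1. As a and be are orthogonal, M^be
   kills m, so m = 0. *)
have /ex[m mE] : out (fun i => th (a 0 i *: z)) = 0.
  by rewrite -[RHS]az pencilE; apply: eq_bigr => i _; rewrite !linearZ.
have m0 : m = 0.
  apply/eqP; rewrite -memv0 -(inj be be0) memv_ker pencilE.
  under eq_bigr do rewrite -mE scalerA mulrC.
  by rewrite -scaler_suml abe scale0r.
apply/eqP; rewrite -[z]scale1r -al1 scaler_suml big1 ?linear0 // => i _.
by rewrite mulrC -scalerA mE m0 !linear0.
Qed.
End Transfer.

(** * Auslander-Reiten translates *)

Section Functionals.
Import VectorInternalTheory.
Variables (k : fieldType) (V : vectType k).

Definition coordf (b : 'I_(dim V)) : 'Hom(V, k^o) := linfun (fun w => v2r w 0 b : k^o).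

Lemma coordfE b w : coordf b w = v2r w 0 b.
Proof. by apply: linfun_lin => c u v; rewrite linearP !mxE. Qed.

Lemma functional_sep (w : V) : (forall la : 'Hom(V, k^o), la w = 0) -> w = 0.
Proof.
move=> h; apply: (can_inj v2rK); rewrite linear0; apply/rowP => b.
by rewrite -coordfE h mxE.
Qed.

Lemma reflexive (psi : 'Hom(V, k^o) -> k^o) : linear psi -> exists y, forall la, psi la = la y.
Proof.
move=> lpsi; have psiE := linfun_lin lpsi.
pose e b : V := r2v (delta_mx 0 b).
exists (\sum_b psi (coordf b) *: e b) => la; rewrite linear_sum /=.
have laE : la = \sum_b la (e b) *: coordf b.
  apply/lfunP => w; rewrite sum_lfunE -{1}[w]v2rK [v2r w]row_sum_delta !linear_sum /=.
  by apply: eq_bigr => b _; rewrite scale_lfunE coordfE !linearZ; apply: mulrC.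
rewrite -[LHS]psiE {1}laE linear_sum; apply: eq_bigr => b _.
by rewrite [LHS]linearZ [RHS]linearZ /= psiE; apply: mulrC.
Qed.
End Functionals.

Section ProjInj.
Variables (k : fieldType) (r : nat).
Implicit Types (M N X Y P Q : krep k r).

Lemma epi_section (V W : vectType k) (g : 'Hom(V, W)) : limg g = fullv -> forall w, g (g^-1%VF w) = w.
Proof. by move=> E w; apply: limg_lfunVK; rewrite E memvf. Qed.

Lemma mono_retract (V W : vectType k) (g : 'Hom(V, W)) : lker g = 0%VS -> forall w, g^-1%VF (g w) = w.
Proof. by move=> E; apply: lker0_lfunK; apply/eqP. Qed.

Lemma hom_arr M N (f : khom M N) i v : is_hom f -> f.2 (arr M i v) = arr N i (f.1 v).
Proof. by move=> fH; rewrite -!comp_lfunE fH. Qed.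

(** The hypotheses say that (P_1)^r -> P_2 is bijective: [P] is a sum of copies of P(1). *)
Lemma projective_free P : reached P -> (forall y : 'I_r -> V1 P, out y = 0 -> forall i, y i = 0) ->
  projective P.
Proof.
move=> rP dP X Y g f gH [g1 g2] fH.
pose T : vectType k := {ffun 'I_r -> V1 P}.
have ol : linear (fun y : T => out y).
  move=> c u v; rewrite /out scaler_sumr -big_split; apply: eq_bigr => i _.
  by rewrite !ffunE linearP.
pose R : 'Hom(T, V2 P) := linfun (fun y : T => out y).
have RE : forall y, R y = out y := linfun_lin ol.
have R0 : lker R = 0%VS.
  apply/eqP; rewrite -subv0; apply/subvP => y; rewrite memv_ker RE memv0 => /eqP/dP y0.
  by apply/eqP/ffunP => i; rewrite y0 ffunE.
have outR z : out (R^-1%VF z : T) = z.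
  rewrite -RE epi_section //; apply/vspaceP => w; rewrite memvf; apply/memv_imgP.
  have [y ->] := rP w; exists ([ffun i => y i] : T); first exact: memvf.
  by rewrite RE; apply: eq_out => i; rewrite ffunE.
pose h1 := (g.1^-1 \o f.1)%VF.
have h1E v : g.1 (h1 v) = f.1 v by rewrite comp_lfunE epi_section.
pose h2 (z : V2 P) : V2 X := out (fun i => h1 ((R^-1%VF z : T) i)).
have h2l : linear h2.
  move=> c u v; rewrite /h2 linearP /out scaler_sumr -big_split; apply: eq_bigr => i _.
  by rewrite !ffunE !linearP.
have h2E := linfun_lin h2l.
exists (h1, linfun h2).
  move=> i; apply/lfunP => v; rewrite [LHS]comp_lfunE [RHS]comp_lfunE h2E /h2.
  pose y : T := [ffun j => if j == i then v else 0].
  have yE : arr P i v = R y.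
    rewrite RE /out (bigD1 i) //= ffunE eqxx big1 ?addr0 // => j ji.
    by rewrite ffunE (negPf ji) linear0.
  rewrite yE mono_retract // /out (bigD1 i) //= ffunE eqxx big1 ?addr0 // => j ji.
  by rewrite ffunE (negPf ji) !linear0.
rewrite [f]surjective_pairing; congr (_, _); apply/lfunP => z; rewrite comp_lfunE //=.
rewrite h2E -[z in RHS]outR /h2 /out !linear_sum; apply: eq_bigr => i _ /=.
by rewrite !hom_arr // h1E.
Qed.

Lemma projective_dim1_0 P : (forall v : V1 P, v = 0) -> projective P.
Proof.
move=> P0 X Y g f gH [g1 g2] fH; exists (0, (g.2^-1 \o f.2)%VF).
  by move=> i; apply/lfunP => v; rewrite (P0 v) !linear0.
rewrite [f]surjective_pairing; congr (_, _); apply/lfunP => v.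
  by rewrite (P0 v) !linear0.
by rewrite !comp_lfunE epi_section.
Qed.

(** Here Q_1 -> (Q_2)^r is bijective: [Q] is a sum of copies of the injective hull of the simple at
    vertex 2. *)
Lemma injective_cofree Q : detected Q ->
  (forall y : 'I_r -> V2 Q, exists v, forall i, y i = arr Q i v) -> injective_rep Q.
Proof.
move=> dQ sQ X Y g f gH [g1 g2] fH.
pose T : vectType k := {ffun 'I_r -> V2 Q}.
have cl : linear (fun v : V1 Q => [ffun i => arr Q i v] : T).
  by move=> c u v; apply/ffunP => i; rewrite !ffunE linearP.
pose C : 'Hom(V1 Q, T) := linfun (fun v : V1 Q => [ffun i => arr Q i v] : T).
have CE v i : C v i = arr Q i v by rewrite [C v](linfun_lin cl) ffunE.
have arrC (y : T) i : arr Q i (C^-1%VF y) = y i.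
  rewrite -CE epi_section //; apply/vspaceP => z; rewrite memvf; apply/memv_imgP.
  have [v vE] := sQ z; exists v; first exact: memvf.
  by apply/ffunP => j; rewrite CE.
pose h2 := (f.2 \o g.2^-1)%VF.
have h2E v : h2 (g.2 v) = f.2 v by rewrite comp_lfunE mono_retract.
pose h1 (b : V1 Y) : V1 Q := C^-1%VF ([ffun i => h2 (arr Y i b)] : T).
have h1l : linear h1.
  move=> c u v; rewrite /h1 -linearP; congr (C^-1%VF _); apply/ffunP => i.
  by rewrite !ffunE !linearP.
have h1E := linfun_lin h1l.
have arrh b i : arr Q i (linfun h1 b) = h2 (arr Y i b) by rewrite h1E arrC ffunE.
exists (linfun h1, h2).
  by move=> i; apply/lfunP => v; rewrite !comp_lfunE arrh comp_lfunE.
rewrite [f]surjective_pairing; congr (_, _); apply/lfunP => v; rewrite comp_lfunE ?h2E //.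
apply/eqP; rewrite -subr_eq0; apply/eqP/dQ => i.
by rewrite linearB /= arrh -hom_arr // h2E hom_arr // subrr.
Qed.

Lemma injective_dim2_0 Q : (forall v : V2 Q, v = 0) -> injective_rep Q.
Proof.
move=> Q0 X Y g f gH [g1 g2] fH; exists ((f.1 \o g.1^-1)%VF, 0).
  by move=> i; apply/lfunP => v; rewrite [LHS]Q0 [RHS]Q0.
rewrite [f]surjective_pairing; congr (_, _); apply/lfunP => v.
  by rewrite !comp_lfunE mono_retract.
by rewrite [LHS]Q0 [RHS]Q0.
Qed.
End ProjInj.

(** * Two reflections realise the Auslander-Reiten translation *)

Section ARStep.
Variables (k : fieldType) (r : nat) (N Y X : krep k r).
Variables (th : 'Hom(V2 N, V1 Y)) (et : 'Hom(V2 Y, V1 X)).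
Hypotheses (rNY : refl_by th) (rYX : refl_by et).

Let T : vectType k := {ffun 'I_r -> V1 X}.
Let single (i : 'I_r) (v : V1 X) : T := [ffun j => if j == i then v else 0].

Let single_lin i : linear (single i).
Proof. by move=> c u v; apply/ffunP => j; rewrite !ffunE; case: ifP => // _; rewrite scaler0 addr0. Qed.

Let sum_single (y : T) : y = \sum_i single i (y i).
Proof.
apply/ffunP => i; rewrite sum_ffunE (bigD1 i) //= ffunE eqxx big1 ?addr0 // => j ji.
by rewrite ffunE eq_sym (negPf ji).
Qed.

(* The projective covers of X and of the kernel of P0 -> X, which is
   concentrated at the vertex 2. *)
Definition P0 : krep k r := @KRep k r (V1 X) T (fun i => linfun (single i)).
Definition P1 : krep k r := @KRep k r 'rV[k]_0 (V1 Y) (fun=> 0).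

Let arr0 i v : arr P0 i v = single i v.
Proof. exact: (linfun_lin (single_lin i)). Qed.

Let out_lin : linear (fun y : T => @out k r X y).
Proof.
move=> c u v; rewrite /out scaler_sumr -big_split; apply: eq_bigr => i _.
by rewrite !ffunE linearP.
Qed.

Definition p0 : khom P0 X := (\1%VF, linfun (fun y : T => @out k r X y)).

Let p02 y : p0.2 y = @out k r X y. Proof. exact: (linfun_lin out_lin). Qed.

Let col (y : V1 Y) : T := [ffun i => et (arr Y i y)].
Let col_lin : linear col.
Proof. by move=> c u v; apply/ffunP => i; rewrite !ffunE !linearP. Qed.

Definition p1 : khom P1 P0 := (0, linfun col).

Let p12 y i : (p1.2 y : T) i = et (arr Y i y).
Proof. by rewrite [p1.2 y](linfun_lin col_lin) ffunE. Qed.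

Let rV0 (v : 'rV[k]_0) : v = 0. Proof. exact: thinmx0. Qed.

Let p0_hom : is_hom p0.
Proof.
move=> i; apply/lfunP => v; rewrite [LHS]comp_lfunE [RHS]comp_lfunE p02 arr0 id_lfunE.
rewrite /out (bigD1 i) //= ffunE eqxx big1 ?addr0 // => j ji.
by rewrite ffunE (negPf ji) linear0.
Qed.

Let p1_hom : is_hom p1.
Proof. by move=> i; apply/lfunP => v; rewrite (rV0 v) !linear0. Qed.

Let p0_epi : hepi p0.
Proof.
have [_ _ rX _] := rYX; split; apply/vspaceP => v; rewrite memvf; apply/memv_imgP.
  by exists v; rewrite ?memvf ?id_lfunE.
have [y ->] := rX v; exists ([ffun i => y i] : T); first exact: memvf.
by rewrite p02; apply: eq_out => i; rewrite ffunE.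
Qed.

Let p_exact : himg p1 = hker p0.
Proof.
have [_ _ _ ex] := rYX; congr (_, _); apply/vspaceP => v.
  rewrite lim0g memv0 memv_ker id_lfunE //.
rewrite memv_ker p02; apply/memv_imgP/eqP => [[y _ ->]|ov].
  by rewrite -[RHS](proj2 (ex (fun i => arr Y i y))); [apply: eq_out => i; rewrite p12|exists y].
have /choice[a aE] := fun i => refl_th_sur rYX (v i).
have /ex[y yE] : out (fun i => et (a i)) = 0 by rewrite -ov; apply: eq_out.
exists y; first exact: memvf.
by apply/ffunP => i; rewrite p12 -yE aE.
Qed.

Let p0_superfluous : superfluous (hker p0).
Proof.
move=> [W1 W2] sW /= e1 e2.
have E1 : W1 = fullv.
  apply/vspaceP => v; rewrite memvf.
  have : v \in (lker p0.1 + W1)%VS by rewrite e1 memvf.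
  by case/memv_addP => a; rewrite memv_ker id_lfunE => /eqP -> [b bW ->]; rewrite add0r.
rewrite E1; congr (_, _); apply/vspaceP => y; rewrite memvf (sum_single y).
apply: memv_suml => i _; rewrite -arr0; apply: (subvP (sW i)) => /=.
by apply: memv_img; rewrite E1 memvf.
Qed.

Let lker_p1 : lker p1.2 = 0%VS.
Proof.
have [_ dY _ _] := rYX; apply/eqP; rewrite -subv0; apply/subvP => y.
rewrite memv_ker memv0 => /eqP y0; apply/eqP/dY => i; apply: (refl_th_inj rYX).
by rewrite linear0 -p12 y0 ffunE.
Qed.

Let p1_superfluous : superfluous (hker p1).
Proof.
move=> [W1 W2] sW /= e1 e2; congr (_, _); last by rewrite -e2 lker_p1 add0v.
by apply/vspaceP => v; rewrite (rV0 v) !mem0v.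
Qed.

Lemma refl2_presentation : minimal_presentation p1 p0.
Proof.
split; [split|split|split|split] => //.
  apply: projective_free => [y|y oy i].
    exists (fun i => y i); rewrite {1}(sum_single y); apply: eq_bigr => i _; by rewrite arr0.
  have E : [ffun i => y i] = 0 :> T.
    rewrite (sum_single [ffun i => y i]) -[RHS]oy; apply: eq_bigr => j _.
    by rewrite arr0 ffunE.
  by have := congr1 (fun t : T => t i) E; rewrite !ffunE.
by apply: projective_dim1_0 => v; apply: rV0.
Qed.

Lemma refl2_nonprojective : ~ is_zero N -> ~ projective X.
Proof.
move=> nz pX; apply: nz; have [_ dN _ _] := rNY.
have idH : is_hom (hid X) by move=> i; apply/lfunP => v; rewrite !comp_lfunE !id_lfunE.
have [s sH sE] := pX _ _ p0 (hid X) p0_hom p0_epi idH.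
have ps1 v : p0.1 (s.1 v) = v.
  by have : (hcomp p0 s).1 v = v by [rewrite sE id_lfunE]; rewrite [LHS]comp_lfunE.
have ps2 v : p0.2 (s.2 v) = v.
  by have : (hcomp p0 s).2 v = v by [rewrite sE id_lfunE]; rewrite [LHS]comp_lfunE.
have sW : is_subrep (himg s).
  move=> i; apply/subvP => _ /memv_imgP[_ /memv_imgP[v _ ->] ->].
  by rewrite -(hom_arr _ _ sH); apply: memv_img; apply: memvf.
have split_ (V W : vectType k) (p : 'Hom(V, W)) (t : 'Hom(W, V)) : (forall w, p (t w) = w) ->
    (lker p + limg t)%VS = fullv.
  move=> pt; apply/vspaceP => v; rewrite memvf -[v](subrK (t (p v))) memv_add ?memv_img ?memvf //.
  by rewrite memv_ker linearB /= pt subrr.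
have [_ E2] := p0_superfluous sW (split_ _ _ _ _ ps1) (split_ _ _ _ _ ps2).
have Y0 (y : V1 Y) : y = 0.
  apply/eqP; rewrite -memv0 -lker_p1 memv_ker.
  have : p1.2 y \in limg s.2 by rewrite [limg s.2]E2 memvf.
  case/memv_imgP=> x _ E; have : p1.2 y \in lker p0.2.
    by have := congr1 snd p_exact; rewrite /= => <-; apply: memv_img; apply: memvf.
  by rewrite E memv_ker ps2 => /eqP ->; rewrite linear0.
have N2 (v : V2 N) : v = 0 by apply: (refl_th_inj rNY); rewrite [LHS]Y0 linear0.
by apply/is_zeroP; split=> // v; apply: dN => i; apply: N2.
Qed.

Let hom1_hom (h : 'Hom(V1 Y, 'rV[k]_r)) : is_hom ((0, h) : khom P1 Pproj1).
Proof. by move=> i; apply/lfunP => v; rewrite (rV0 v) !linear0. Qed.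

Let hom2_hom (h : 'Hom(V1 Y, k^o)) : is_hom ((0, h) : khom P1 Pproj2).
Proof. by move=> i; apply/lfunP => v; rewrite (rV0 v) !linear0. Qed.

(** D Hom(P1, P(1)) is (V1 Y)^r, and [n] goes to the tuple of the th (arr N i n); at vertex 2, D
    Hom(P1, P(2)) is V1 Y. *)
Let u1 (n : V1 N) : dual (Hom P1 Pproj1) :=
  linfun (fun h : Hom P1 Pproj1 => (\sum_i ((vsval h).2 (th (arr N i n)) : 'rV[k]_r) 0 i) : k^o).
Let u2 (m : V2 N) : dual (Hom P1 Pproj2) :=
  linfun (fun h : Hom P1 Pproj2 => (vsval h).2 (th m) : k^o).

Let u1E n (h : Hom P1 Pproj1) : u1 n h = \sum_i ((vsval h).2 (th (arr N i n)) : 'rV[k]_r) 0 i.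
Proof.
apply: linfun_lin => c u v; rewrite scaler_sumr -big_split; apply: eq_bigr => i _.
by rewrite linearP /= add_lfunE scale_lfunE !mxE.
Qed.

Let u2E m (h : Hom P1 Pproj2) : u2 m h = (vsval h).2 (th m).
Proof. by apply: linfun_lin => c u v; rewrite linearP /= add_lfunE scale_lfunE. Qed.

Let u1_lin : linear u1.
Proof.
move=> c u v; apply/lfunP => h; rewrite add_lfunE scale_lfunE !u1E scaler_sumr -big_split.
by apply: eq_bigr => i _; rewrite !linearP !mxE.
Qed.

Let u2_lin : linear u2.
Proof. by move=> c u v; apply/lfunP => h; rewrite add_lfunE scale_lfunE !u2E !linearP. Qed.

Definition embed_DTr : khom N (nakayama P1) := (linfun u1, linfun u2).

Let e1E n : embed_DTr.1 n = u1 n. Proof. exact: (linfun_lin u1_lin). Qed.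
Let e2E n : embed_DTr.2 n = u2 n. Proof. exact: (linfun_lin u2_lin). Qed.

Let embed_hom : is_hom embed_DTr.
Proof.
move=> i; apply/lfunP => n; rewrite [LHS]comp_lfunE [RHS]comp_lfunE e1E e2E.
apply/lfunP => h; rewrite dual_mapE comp_lfunE u1E u2E Hom_postE; last exact: proj_arr_hom.
have E (y : V1 Y) j : ((hcomp (proj_arr k i) (vsval h)).2 y : 'rV[k]_r) 0 j =
    (vsval h).2 y * (j == i)%:R.
  rewrite /= comp_lfunE linfun_lin ?mxE //= => c a b; by rewrite scalerDl scalerA.
by rewrite (bigD1 i) //= E eqxx mulr1 big1 ?addr0 // => j ji; rewrite E (negPf ji) mulr0.
Qed.

Let v1h (h : 'Hom(V1 Y, 'rV[k]_r)) : Hom P1 Pproj1 := vsproj _ ((0, h) : khom P1 Pproj1).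
Let v2h (h : 'Hom(V1 Y, k^o)) : Hom P1 Pproj2 := vsproj _ ((0, h) : khom P1 Pproj2).

Let v1hE h : vsval (v1h h) = (0, h).
Proof. by rewrite vsprojK //; apply/homspP/hom1_hom. Qed.

Let v2hE h : vsval (v2h h) = (0, h).
Proof. by rewrite vsprojK //; apply/homspP/hom2_hom. Qed.

Let at_ (i : 'I_r) (la : 'Hom(V1 Y, k^o)) : 'Hom(V1 Y, 'rV[k]_r) :=
  linfun (fun y => la y *: (delta_mx 0 i : 'rV[k]_r)).

Let at_E i la y j : (at_ i la y : 'rV[k]_r) 0 j = la y * (j == i)%:R.
Proof.
by rewrite [at_ i la y]linfun_lin ?mxE // => c u v; rewrite linearP scalerDl scalerA.
Qed.

Let u1_at n i la : u1 n (v1h (at_ i la)) = la (th (arr N i n)).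
Proof.
rewrite u1E v1hE (bigD1 i) //= at_E eqxx mulr1 big1 ?addr0 // => j ji.
by rewrite at_E (negPf ji) mulr0.
Qed.

Let embed_mono : hmono embed_DTr.
Proof.
have [_ dN _ _] := rNY; split; apply/eqP; rewrite -subv0; apply/subvP => n.
  rewrite memv_ker e1E memv0 => /eqP n0; apply/eqP/dN => i; apply: (refl_th_inj rNY).
  by rewrite linear0; apply: functional_sep => la; rewrite -u1_at n0 zero_lfunE.
rewrite memv_ker e2E memv0 => /eqP n0; apply/eqP; apply: (refl_th_inj rNY); rewrite linear0.
apply: functional_sep => la; have := congr1 (fun f : dual _ => f (v2h la)) n0.
by rewrite u2E v2hE zero_lfunE.
Qed.

Let hom_decomp (h : Hom P1 Pproj1) :
  h = \sum_i v1h (at_ i (linfun (fun y => ((vsval h).2 y : 'rV[k]_r) 0 i : k^o))).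
Proof.
apply: subvs_inj; rewrite linear_sum /=.
have sum_pair (A B : vectType k) (F : 'I_r -> A * B) : \sum_i F i = (\sum_i (F i).1, \sum_i (F i).2).
  by elim/big_rec3: _ => // i a b p _ ->.
rewrite [vsval h]surjective_pairing sum_pair; congr (_, _); apply/lfunP => y.
  by rewrite (rV0 y) !linear0.
rewrite sum_lfunE; apply/rowP => j; rewrite summxE (bigD1 j) //= v1hE at_E eqxx mulr1.
rewrite linfun_lin; last by move=> c u v; rewrite linearP !mxE.
by rewrite big1 ?addr0 // => i ij; rewrite v1hE at_E eq_sym (negPf ij) mulr0.
Qed.

Let pre1 (g : Hom P0 Pproj1) (y : V1 Y) i :
  ((vsval (Hom_pre Pproj1 p1 g)).2 y : 'rV[k]_r) 0 i = (vsval g).1 (et (arr Y i y)).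
Proof.
have /homspP gH := subvsP g.
rewrite Hom_preE //= comp_lfunE (sum_single (p1.2 y)) linear_sum summxE (bigD1 i) //=.
have E j : (vsval g).2 (single j ((p1.2 y : T) j)) = (vsval g).1 (et (arr Y j y)) *: delta_mx 0 j :> 'rV[k]_r.
  rewrite p12 -arr0 (hom_arr _ _ gH); apply: (linfun_lin _) => c a b.
  by rewrite scalerDl scalerA.
rewrite E !mxE !eqxx mulr1 big1 ?addr0 // => j ji.
by rewrite E !mxE eq_sym (negPf ji) andbF mulr0.
Qed.

Let gmu_hom (mu : 'Hom(V1 X, k^o)) : exists2 g : Hom P0 Pproj1, True & (vsval g).1 = mu.
Proof.
pose f (y : T) : 'rV[k]_r := \row_i mu (y i).
have fl : linear f by move=> c u v; apply/rowP => i; rewrite !mxE !ffunE linearP.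
have gH : is_hom ((mu, linfun f) : khom P0 Pproj1).
  move=> i; apply/lfunP => v; rewrite [LHS]comp_lfunE [RHS]comp_lfunE arr0 /= (linfun_lin fl).
  rewrite linfun_lin; last by move=> c a b; rewrite scalerDl scalerA.
  apply/rowP => j; rewrite !mxE ffunE eqxx /=.
  by case: (j =P i) => _; rewrite ?mulr1 // linear0 mulr0.
exists (vsproj _ ((mu, linfun f) : khom P0 Pproj1)) => //.
by rewrite vsprojK //; apply/homspP.
Qed.

Let sumY (g : 'Hom(V1 X, k^o)) (F : 'I_r -> V1 Y) :
  \sum_i (g (et (arr Y i (F i))) : k) = g (et (out F)).
Proof. by rewrite /out linear_sum [RHS]linear_sum. Qed.

Let embed_image1 : limg embed_DTr.1 = lker (dual_map (Hom_pre Pproj1 p1)).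
Proof.
have [_ _ _ exN] := rNY.
apply/vspaceP => phi; apply/memv_imgP/idP => [[n _ ->]|].
  rewrite memv_ker e1E; apply/eqP/lfunP => g; rewrite dual_mapE comp_lfunE zero_lfunE u1E.
  under eq_bigr do rewrite pre1.
  rewrite [LHS](sumY (vsval g).1 (fun i => th (arr N i n))).
  by rewrite (proj2 (exN (fun i => arr N i n))) ?linear0 //; exists n.
rewrite memv_ker => /eqP phi0.
have /choice[y yP] : forall i, exists y, forall la, phi (v1h (at_ i la)) = la y.
  move=> i; apply: reflexive => c a b; rewrite -linearP; congr (phi _); apply: subvs_inj.
  rewrite linearP /= !v1hE; congr (_, _); first by apply/lfunP => z; rewrite (rV0 z) !linear0.
  apply/lfunP => z; rewrite add_lfunE scale_lfunE; apply/rowP => j.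
  by rewrite !mxE !at_E add_lfunE scale_lfunE mulrDl -mulrA.
have phiE h : phi h = \sum_i ((vsval h).2 (y i) : 'rV[k]_r) 0 i.
  rewrite {1}(hom_decomp h) linear_sum; apply: eq_bigr => i _; rewrite /= yP linfun_lin //.
  by move=> c u v; rewrite linearP !mxE.
(* Testing phi on the morphisms from [P0] to P(1) shows that the tuple [y] representing it is a
   relation in [Y]. *)
have oy : out (y : 'I_r -> V1 Y) = 0.
  apply: (refl_th_inj rYX); rewrite linear0; apply: functional_sep => mu.
  have [g _ gE] := gmu_hom mu.
  have : phi (Hom_pre Pproj1 p1 g) = 0 by rewrite -comp_lfunE -dual_mapE phi0 zero_lfunE.
  rewrite phiE; under eq_bigr do rewrite pre1 gE.
  by move=> E0; rewrite -[RHS]E0 [RHS](sumY mu y).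
have /choice[a aE] := fun i => refl_th_sur rNY (y i).
have /exN[n nE] : out (fun i => th (a i)) = 0 by rewrite -oy; apply: eq_out => i; rewrite -aE.
exists n; first exact: memvf.
by rewrite e1E; apply/lfunP => h; rewrite phiE u1E; apply: eq_bigr => i _; rewrite -nE -aE.
Qed.

(** At vertex 2 the map nu(p1) is zero, since there are no nonzero morphisms from [P0] to P(2). *)
Let embed_image2 : limg embed_DTr.2 = lker (dual_map (Hom_pre Pproj2 p1)).
Proof.
apply/vspaceP => phi; transitivity true; last (symmetry; apply/idP).
  apply/idP/memv_imgP.
  have [|y yP] := @reflexive k (V1 Y) (fun la => phi (v2h la)).
    move=> c a b; rewrite -linearP; congr (phi _); apply: subvs_inj.
    by rewrite linearP /= !v2hE; congr (_, _); apply/lfunP => z; rewrite (rV0 z) !linear0.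
  have [m mE] := refl_th_sur rNY y; exists m; first exact: memvf.
  rewrite e2E; apply/lfunP => h; rewrite u2E -mE -yP; congr (phi _); apply: subvs_inj.
  rewrite v2hE [LHS]surjective_pairing; congr (_, _); apply/lfunP => z.
  by rewrite (rV0 z) !linear0.
rewrite memv_ker; apply/eqP/lfunP => g; rewrite dual_mapE comp_lfunE zero_lfunE.
suff -> : Hom_pre Pproj2 p1 g = 0 by rewrite linear0.
have /homspP gH := subvsP g.
have g2 (y : T) : (vsval g).2 y = 0.
  rewrite (sum_single y) linear_sum big1 // => i _ /=.
  by rewrite -arr0 (hom_arr _ _ gH) /= zero_lfunE.
apply: subvs_inj; rewrite Hom_preE // linear0 /hcomp; congr (_, _); apply/lfunP => v.
  by rewrite (rV0 v) !linear0.
by rewrite comp_lfunE g2 zero_lfunE.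
Qed.

Lemma AR_step_refl : indecomposable X -> ~ is_zero N -> AR_step X N.
Proof.
move=> iX nzN; split=> //; first exact: refl2_nonprojective.
exists P0, P1, p1, p0, embed_DTr; split; [exact: refl2_presentation| | |] => //.
by congr (_, _); [exact: embed_image1|exact: embed_image2].
Qed.
End ARStep.

Section Ends.
Variables (k : fieldType) (r : nat).
Implicit Types (M N X Y : krep k r).

(** A translation is two reflections, so the induction carries n and n + 1 together. At n = 0 the
    space M_2 is zero, and at n = 1 the map M_1 -> (M_2)^r is bijective; both make [M] injective. *)
Lemma gfin_preinjective n M : gfin n M -> unsplit M -> preinjective M.
Proof.
move=> gM uM; split; first exact: unsplit_indecomposable.
suff H m : forall M, (gfin m M -> unsplit M -> exists Q, [/\ indecomposable Q, injective_rep Q & same_AR_orbit Q M]) /\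
    (gfin m.+1 M -> unsplit M -> exists Q, [/\ indecomposable Q, injective_rep Q & same_AR_orbit Q M]).
  by case: (H n M) => h _; apply: h.
elim: m => [|m IH] {n gM uM}M; last first.
  split=> [|gM uM]; first by case: (IH M).
  case: gM => Y [th rMY] [X [et rYX] gX].
  have uX := refl_unsplit_up rYX (refl_unsplit_up rMY uM).
  have [Q [iQ jQ oQ]] := (IH X).1 gX uX; exists Q; split=> //.
  apply: rst_trans oQ _; apply: rst_step; apply: (AR_step_refl rMY rYX).
    exact: unsplit_indecomposable.
  by case: uM.
split=> [nd uM|[N [th rMN] nd] uM]; exists M; split; try exact: rst_refl;
  try exact: unsplit_indecomposable.
  have [_ /dim0P d2] := unsplit_undetected uM nd; apply: injective_dim2_0 => v.
  by apply: d2; rewrite memvf.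
have [_ /dim0P d2] := unsplit_undetected (refl_unsplit_up rMN uM) nd.
have [_ dM _ ex] := rMN; apply: injective_cofree => // y; apply/ex.
by apply: d2; rewrite memvf.
Qed.

Lemma ffin_preprojective n N : ffin n N -> unsplit N -> preprojective N.
Proof.
move=> fN uN; split; first exact: unsplit_indecomposable.
suff H m : forall N, (ffin m N -> unsplit N -> exists P, [/\ indecomposable P, projective P & same_AR_orbit P N]) /\
    (ffin m.+1 N -> unsplit N -> exists P, [/\ indecomposable P, projective P & same_AR_orbit P N]).
  by case: (H n N) => h _; apply: h.
elim: m => [|m IH] {n fN uN}N; last first.
  split=> [|fN uN]; first by case: (IH N).
  case: fN => Y [et rYN] [X [th rXY] fX].
  have uX := refl_unsplit_down rXY (refl_unsplit_down rYN uN).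
  have [P [iP pP oP]] := (IH X).1 fX uX; exists P; split=> //.
  apply: rst_trans oP _; apply: rst_sym; apply: rst_step; apply: (AR_step_refl rXY rYN).
    exact: unsplit_indecomposable.
  by case: uX.
split=> [nr uN|[M [th rMN] nr] uN]; exists N; split; try exact: rst_refl;
  try exact: unsplit_indecomposable.
  have [/dim0P d1 _] := unsplit_unreached uN nr; apply: projective_dim1_0 => v.
  by apply: d1; rewrite memvf.
have [/dim0P d1 _] := unsplit_unreached (refl_unsplit_down rMN uN) nr.
have [_ _ rN ex] := rMN; apply: projective_free => // y oy i.
have /choice[a aE] := fun i => refl_th_sur rMN (y i).
have /ex[v vE] : out (fun i => th (a i)) = 0 by rewrite -oy; apply: eq_out => j; rewrite -aE.
by rewrite aE vE (d1 v) ?memvf // !linear0.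
Qed.
End Ends.

(** * The theorem *)

Section GenericBoth.
Variable k : closedFieldType.

Lemma avoid (s : seq k) : exists mu, mu \notin s.
Proof.
have p0 : \prod_(z <- s) ('X - z%:P) != 0 :> {poly k} by apply/monic_neq0/monic_prod_XsubC.
by have [mu] := closed_nonrootP _ p0; rewrite root_prod_XsubC => ?; exists mu.
Qed.

Lemma roots_seq (p : {poly k}) : p != 0 -> exists s : seq k, forall x, x \notin s -> ~~ root p x.
Proof.
move=> p0; have [s sE] := closed_field_poly_normal p; exists s => x.
by rewrite sE rootZ ?lead_coef_eq0 // root_prod_XsubC.
Qed.

(** For mu nonzero, g - mu f is proportional to f - mu^-1 g, so [generic_dim] applies in both
    directions; this is why inverses of roots are excluded. *)
Lemma generic_both (V W : vectType k) (f g : 'Hom(V, W)) : exists s : seq k, forall mu, mu \notin s ->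
  (\dim (limg f) <= \dim (limg (g - mu *: f)%R))%N /\ (\dim (limg g) <= \dim (limg (g - mu *: f)%R))%N.
Proof.
have [p p0 Hp] := generic_dim f g fullv 0; have [q q0 Hq] := generic_dim g f fullv 0.
have [s1 S1] := roots_seq p0; have [s2 S2] := roots_seq q0.
exists (0 :: s1 ++ map GRing.inv s2) => mu; rewrite inE mem_cat !negb_or => /and3P[mu0 m1 m2].
have := Hp mu (S1 mu m1); rewrite !addv0 => ->; split=> //.
have m2' : mu^-1 \notin s2 by apply: contra m2 => h; rewrite -[mu]invrK map_f.
have := Hq _ (S2 _ m2'); rewrite !addv0 => h; apply: leq_trans h _.
rewrite dimvS //; apply/subvP => _ /memv_imgP[v _ ->]; apply/memv_imgP.
exists (- mu^-1 *: v); first exact: memvf.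
rewrite [RHS]linearZ /= !(add_lfunE, opp_lfunE, scale_lfunE) scalerBr scalerA mulNr mulVf //.
by rewrite scaleNr scaleN1r opprK addrC.
Qed.
End GenericBoth.

Section RankMatrix.
Import VectorInternalTheory.
Variables (k : closedFieldType) (r' : nat) (M : krep k r'.+1).

Lemma dim_limg_rank (V W : vectType k) (f : 'Hom(V, W)) : \dim (limg f) = \rank (f2mx f).
Proof.
have := limg_ker_dim f fullv; rewrite capfv dimvf.
have -> : \dim (lker f) = \rank (kermx (f2mx f)) by rewrite /dimv /lker mx2vsK.
rewrite mxrank_ker => E; apply/eqP; rewrite -(eqn_add2l (dim V - \rank (f2mx f))) E.
by rewrite subnK // rank_leq_row.
Qed.

Lemma f2mxE (V W : vectType k) (f : 'Hom(V, W)) a b :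
  f2mx f a b = v2r (f (r2v (delta_mx 0 a))) 0 b.
Proof. by rewrite unlock /= !r2vK -rowE mxE. Qed.

Definition pencil_mx : 'M[{mpoly k[r'.+1]}]_(dim (V1 M), dim (V2 M)) :=
  \matrix_(a, b) \sum_i (f2mx (arr M i) a b) *: 'X_i.

Lemma constant_rank_bound d : (0 < d)%N -> (forall a : 'rV[k]_r'.+1, a != 0 -> rk M a = d) ->
  (r' + 2 * d <= dim1 M + dim2 M)%N.
Proof.
move=> d0 rkd; rewrite /dim1 /dim2 !dimvf; apply: (@westwick k r' _ _ d pencil_mx) => //.
  by move=> a b; rewrite mxE; apply: hom_sum => i _; apply: homZ; apply: homX.
move=> v [i vi]; pose x : 'rV[k]_r'.+1 := \row_j v j.
rewrite -(rkd x); last by apply: contraNneq vi => /rowP/(_ i); rewrite !mxE => ->.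
rewrite /rk dim_limg_rank; congr (\rank _); apply/matrixP => a b; rewrite !mxE.
rewrite rmorph_sum /= f2mxE pencilE linear_sum summxE; apply: eq_bigr => j _.
by rewrite mevalZ mevalXU linearZ !mxE f2mxE mulrC.
Qed.
End RankMatrix.

Section KSums.
Variables (k : fieldType) (r : nat).
Implicit Types (M N : krep k r).

Lemma dim_prod (V W : vectType k) : \dim {:(V * W)%type} = (\dim {:V} + \dim {:W})%N.
Proof. by rewrite !dimvf. Qed.

Lemma pencil_ksum M N a v : pencil (ksum M N) a v = (pencil M a v.1, pencil N a v.2).
Proof.
have sum_pair (A B : vectType k) (F : 'I_r -> A * B) : \sum_i F i = (\sum_i (F i).1, \sum_i (F i).2).
  by elim/big_rec3: _ => // i x y p _ ->.
rewrite !pencilE sum_pair; congr (_, _); apply: eq_bigr => i _; by rewrite ksumE.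
Qed.

Lemma rk_ksum a M N : rk (ksum M N) a = (rk M a + rk N a)%N.
Proof.
have ker (V W : vectType k) (f : 'Hom(V, W)) : (\dim (lker f) + \dim (limg f) = \dim {:V})%N.
  by rewrite -[RHS](limg_ker_dim f) capfv.
have K : \dim (lker (pencil (ksum M N) a)) = (\dim (lker (pencil M a)) + \dim (lker (pencil N a)))%N.
  pose A := lker (pencil M a); pose B := lker (pencil N a).
  pose f (v : subvs_of A * subvs_of B) : V1 (ksum M N) := (vsval v.1, vsval v.2).
  have fl : linear f by move=> c u v; rewrite /f !linearP.
  have -> : lker (pencil (ksum M N) a) = limg (linfun f).
    apply/vspaceP => -[x y]; rewrite memv_ker pencil_ksum; apply/eqP/memv_imgP => [[hx hy]|[v _ ->]].
      exists (vsproj A x, vsproj B y); first exact: memvf.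
      by rewrite (linfun_lin fl) /f /= !vsprojK // memv_ker ?hx ?hy.
    rewrite (linfun_lin fl) /f /=; have := subvsP v.1; have := subvsP v.2.
    by rewrite !memv_ker => /eqP -> /eqP ->.
  rewrite limg_dim_eq ?dim_prod ?dimvf //; apply/eqP; rewrite -subv0; apply/subvP => -[x y].
  rewrite memv_cap memv_ker (linfun_lin fl) memv0 => /andP[_ /eqP[/= hx hy]].
  by apply/eqP; congr (_, _); apply: subvs_inj; rewrite ?hx ?hy linear0.
have := ker _ _ (pencil (ksum M N) a); rewrite K dim_prod.
rewrite -(ker _ _ (pencil M a)) -(ker _ _ (pencil N a)) addnACA => /addnI.
exact.
Qed.

Lemma rk_ksums l (N : 'I_l -> krep k r) a : rk (ksums N) a = (\sum_i rk (N i) a)%N.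
Proof.
apply: (big_morph (fun M => rk M a)) => [M N'|]; first exact: rk_ksum.
by apply/eqP; rewrite -leqn0 (leq_trans (rk_le_dim1 _ _)) // /dim1 dimvf.
Qed.

Lemma dims_ksums l (N : 'I_l -> krep k r) :
  (dim1 (ksums N) + dim2 (ksums N) = \sum_i (dim1 (N i) + dim2 (N i)))%N.
Proof.
apply: (big_morph (fun M : krep k r => dim1 M + dim2 M)%N) => [M N'|].
  by rewrite /dim1 /dim2 !dim_prod addnACA.
by rewrite /dim1 /dim2 !dimvf.
Qed.
End KSums.

Section Main.
Variables (k : closedFieldType) (r : nat).
Hypothesis hr : (2 <= r)%N.
Implicit Types (M : krep k r).

Let r0 : (0 < r)%N. Proof. exact: ltnW. Qed.

Lemma exists_nonzero : exists a : 'rV[k]_r, a != 0.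
Proof.
exists (delta_mx 0 (Ordinal r0)); apply/eqP => /rowP/(_ (Ordinal r0)).
by rewrite !mxE !eqxx => /eqP; rewrite oner_eq0.
Qed.

Lemma cdef_eq M : (2 * generic_rank M + cdef M = dim1 M + dim2 M)%N.
Proof.
have [[a a0 aE] _] := generic_rankP M r0.
have g1 : (generic_rank M <= dim1 M)%N by rewrite -aE rk_le_dim1.
have g2 : (generic_rank M <= dim2 M)%N by rewrite -aE dimvS ?subvf.
by rewrite /cdef; lia.
Qed.

Lemma regular_cone M : (forall n, ~ gfin n M) -> (forall n, ~ ffin n M) ->
  cone r (generic_rank M) (generic_rank M + cdef M).
Proof.
move=> nG nF; have [U [W [d [sU sW -> [c cd ->]]]]] := generic_rank_strip M hr.
have c1 := sub_cone hr nG sU; have c2 := quot_cone hr nF sW.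
apply: coneD c2 => //; rewrite -addnA addnA; apply: coneD c1 => //.
(* The middle subquotient has c <= (r - 2) d, thus d + c <= (r - 1) d. *)
apply: cone_small => //; rewrite addnAC; have : (r * d = (r - 2) * d + 2 * d)%N.
  by rewrite -mulnDl subnK.
by lia.
Qed.

Lemma real_root_qform M : real_root M -> qform r (dim1 M)%:Z (dim2 M)%:Z = 1.
Proof. by rewrite /real_root /qform; nia. Qed.

Lemma qformC x y : qform r x y = qform r y x.
Proof. by rewrite /qform; ring. Qed.

Lemma generic_qform M : unsplit M ->
  qform r (generic_rank M)%:Z (generic_rank M + cdef M)%:Z <= 1.
Proof.
move=> uM; have [[a a0 aE] _] := generic_rankP M r0; have E := cdef_eq M.
have [[n gM]|nG] := pselect (exists n, gfin n M).
  have [rr sur] := gfin_surjective hr gM uM.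
  have dE : generic_rank M = dim2 M by rewrite -aE /rk sur.
  have -> : (generic_rank M + cdef M = dim1 M)%N by move: E; rewrite dE; lia.
  by rewrite dE qformC real_root_qform.
have [[n fM]|nF] := pselect (exists n, ffin n M).
  have [rr inj] := ffin_injective hr fM uM.
  have dE : generic_rank M = dim1 M.
    by rewrite -aE /rk /dim1 -(limg_ker_dim (pencil M a)) inj // capv0 dimv0.
  have -> : (generic_rank M + cdef M = dim2 M)%N by move: E; rewrite dE; lia.
  by rewrite dE real_root_qform.
apply: le_trans (_ : 0 <= 1) => //; apply: qform_cone => //; first exact: leq_addr.
by apply: regular_cone => n h; [apply: nG|apply: nF]; exists n.
Qed.

Lemma arr_rank0 M : (forall a : 'rV[k]_r, a != 0 -> rk M a = 0%N) -> forall i v, arr M i v = 0.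
Proof.
move=> rk0 i v; have := rk0 (delta_mx 0 i); rewrite /rk pencil_delta => E.
have /dim0P h : \dim (limg (arr M i)) = 0%N.
  apply: E; apply/eqP => /rowP/(_ i); rewrite !mxE !eqxx => /eqP; by rewrite oner_eq0.
by apply: h; apply: memv_img; apply: memvf.
Qed.

(** When all arrows vanish, any complementary subspaces give a splitting. *)
Lemma unsplit_rank0_simple M : unsplit M -> (forall i v, arr M i v = 0) -> simple M.
Proof.
case=> nz uns a0; split=> // U sU.
pose U' : subspaces M := (U.1^C, U.2^C)%VS.
have sp : splits U U'.
  split=> //; try exact: dsum_compl.
  by move=> i; apply/subvP => _ /memv_imgP[v _ ->]; rewrite a0 mem0v.
have zero (V : vectType k) (A : {vspace V}) : (forall v, v \in A -> v = 0) -> A = 0%VS.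
  by move=> A0; apply/eqP; rewrite -subv0; apply/subvP => v /A0 ->; rewrite mem0v.
case: (uns _ _ sp) => -[/zero n1 /zero n2]; [left|right].
  by rewrite [U]surjective_pairing n1 n2.
rewrite [U]surjective_pairing; congr (_, _).
  by have := addv_complf U.1; rewrite [(U.1^C)%VS]n1 addv0.
by have := addv_complf U.2; rewrite [(U.2^C)%VS]n2 addv0.
Qed.

Lemma constant_rank_defect M d : (0 < d)%N -> (forall a : 'rV[k]_r, a != 0 -> rk M a = d) ->
  (r - 1 + 2 * d <= dim1 M + dim2 M)%N.
Proof. by case: r M hr => // r' M _; rewrite subn1; apply: constant_rank_bound. Qed.

Lemma constant_generic_rank M d : (forall a : 'rV[k]_r, a != 0 -> rk M a = d) -> generic_rank M = d.
Proof. by move=> rkd; have [[a a0 <-] _] := generic_rankP M r0; apply: rkd. Qed.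

(** At a general point b - mu a, no summand has smaller rank than at [a], and the sum of the ranks
    is the same; so the ranks agree summand by summand, while that of [N i] is at least its rank at
    [b]. *)
Lemma summand_constant_rank l (N : 'I_l -> krep k r) d :
  (forall a : 'rV[k]_r, a != 0 -> rk (ksums N) a = d) ->
  forall i a, a != 0 -> rk (N i) a = generic_rank (N i).
Proof.
move=> rkd i a a0; have [[b b0 bE] le] := generic_rankP (N i) r0.
apply/eqP; rewrite eqn_leq le //= -bE.
have /choice[s sP] := fun j => generic_both (pencil (N j) a) (pencil (N j) b).
have [mu muS] := avoid (flatten [seq s j | j <- enum 'I_l]).
have mus j : mu \notin s j.
  apply/negP => h; case/negP: muS; apply/flattenP.
  by exists (s j) => //; apply: map_f; rewrite mem_enum.
have H j : (rk (N j) a <= rk (N j) (b - mu *: a)%R)%N /\ (rk (N j) b <= rk (N j) (b - mu *: a)%R)%N.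
  by rewrite /rk pencilB; apply: sP.
(* Constancy of the rank says nothing at 0; but if b - mu a = 0, then [N i] has generic rank 0. *)
have [y0|y0] := eqVneq (b - mu *: a) 0.
  have := (H i).2; rewrite y0 => h; apply: leq_trans h _.
  have p0 : pencil (N i) 0 = 0 by apply: big1 => j _; rewrite mxE scale0r.
  by rewrite /rk p0 lim0g dimv0.
have := rkd _ y0; rewrite -(rkd _ a0) !rk_ksums => /esym/eqP E.
have /eqP Ei : rk (N i) a == rk (N i) (b - mu *: a).
  have := leqif_sum (fun j (_ : true) => leqif_eq (H j).1); case=> _; rewrite E => /esym/forallP.
  by move/(_ i).
by rewrite Ei; case: (H i).
Qed.
End Main.

Theorem theorem2p9 (k : closedFieldType) (r : nat) (hr : (2 <= r)%N)
    (M : krep k r) (hM : indecomposable M) :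
  [/\ qform r (generic_rank M)%:Z (generic_rank M + cdef M)%:Z <= 1,
      (~ simple M -> forall c d : nat,
         constant_Jordan_type M c d -> (c, d) \in IJT r) &
      (forall (l : nat) (N : 'I_l -> krep k r) (c d : nat), (0 < l)%N ->
         (forall i, regular (N i)) ->
         constant_Jordan_type (ksums N) c d ->
         qform r d%:Z (d + c)%:Z < 1 /\ (l * (r - 1) <= c)%N)].
Proof.
have uM := indecomposable_unsplit hM; have qM := generic_qform hr uM; split=> //.
  move=> nsM c d [rkd cd]; have gd := constant_generic_rank hr rkd.
  have d0 : (0 < d)%N.
    case: (posnP d) => // d0; case: nsM; apply: unsplit_rank0_simple => //.
    by apply: arr_rank0 => a a0; rewrite rkd.
  have rc := constant_rank_defect hr d0 rkd.
  have cE : cdef M = c by have := cdef_eq hr M; rewrite gd; lia.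
  move: qM; rewrite gd cE => qM; rewrite unfold_in /= d0 qM; move: rc cd hr; clear.
  by move: (dim1 M) (dim2 M) => ? ?; lia.
move=> l N c d _ regN [rkd cd].
have uN i : unsplit (N i) by case: (regN i) => /indecomposable_unsplit.
have nG i n : ~ gfin n (N i).
  by move=> g; case: (regN i) => _ _; apply; apply: gfin_preinjective g (uN i).
have nF i n : ~ ffin n (N i).
  by move=> f; case: (regN i) => _ + _; apply; apply: ffin_preprojective f (uN i).
have rkN := summand_constant_rank hr rkd; pose dd i := generic_rank (N i).
(* If the rank were 0, all arrows of [N i] would vanish, and a representation that is both detected
   and reached would be zero. *)
have d0 i : (0 < dd i)%N.
  case: (posnP (dd i)) => // di; exfalso.
  have a0 : forall j v, arr (N i) j v = 0 by apply: arr_rank0 => a /(rkN i) ->.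
  have dN : detected (N i) by apply: contrapT; apply: (nG i 0%N).
  have rN : reached (N i) by apply: contrapT; apply: (nF i 0%N).
  case: (uN i) => nz _; apply: nz; apply/is_zeroP; split=> [v|z]; first by apply: dN => j; apply: a0.
  by have [y ->] := rN z; apply: big1 => j _; apply: a0.
have dE : d = (\sum_i dd i)%N.
  have [a a0] := exists_nonzero k hr; rewrite -(rkd a a0) rk_ksums.
  by apply: eq_bigr => i _; apply: rkN.
have cE : c = (\sum_i cdef (N i))%N.
  have := dims_ksums N; rewrite -cd.
  under eq_bigr do rewrite -(cdef_eq hr) addnC.
  by rewrite big_split -big_distrr /= -/dd -dE => /addIn.
split; last first.
  rewrite cE -[X in (X * _)%N](card_ord l) -sum_nat_const leq_sum // => i _.
  have := constant_rank_defect hr (d0 i) (rkN i); rewrite -(cdef_eq hr) addnC.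
  by rewrite leq_add2l.
apply: le_lt_trans (_ : 0 < 1) => //; apply: qform_cone => //; first exact: leq_addr.
rewrite dE cE -big_split /=; elim/big_ind2: _ => [||i _]; first by rewrite /cone.
  by move=> x y x' y'; apply: coneD.
exact: regular_cone.
Qed.
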